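(* Let $\theta$ be a smooth symmetric probability density on $\mathbb{R}^2$ supported in $B(0,1)$ whose Fourier transform is radial, $\widehat\theta(\mathbf{k})=\widehat\theta(|\mathbf{k}|)$. Let $L$ be a positive random variable with probability density $f_L$, let $\Gamma=\gamma(L)$ be a function of $L$, and let $X_0$ be uniformly distributed on $\mathbb{T}^2$ and independent of $(\Gamma,L)$. Assume that for some $C>0$ and $\alpha>-1$, $$\gamma^2(r)f_L(r)=Cr^\alpha\qquad (r>0).$$ Set $$D:=\int_0^\infty|\widehat\theta(r)|^2\gamma^2(r)f_L(r)\,dr,$$ which is a finite constant. Then the covariance function of the random field $\Gamma K_L(x,X_0)$ on $\mathbb{T}^2$ is $Q_{\mathrm{vortex}}(x,x')=Q_{\mathrm{vortex}}(x-x')$ with $$Q_{\mathrm{vortex}}(x)=D\sum_{\mathbf{k}\in\mathbb{Z}^2_0}\frac{1}{|\mathbf{k}|^{3+\alpha}}P_{\mathbf{k}}\,e^{i\mathbf{k}\cdot x}.$$ This is (up to the multiplicative constant $D$) the covariance function of the Solenoidal Fractional Gaussian Field of index $$s=\frac{3+\alpha}{2}.$$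
   Context: $\mathbb{T}^2=\mathbb{R}^2/(2\pi\mathbb{Z})^2$, and all integrals $dx$ over $\mathbb{T}^2$ are with respect to the normalized (total mass one) Haar measure. $\mathbb{Z}^2_0=\mathbb{Z}^2\setminus\{0\}$; $P_{\mathbf{k}}=I-\frac{\mathbf{k}\otimes\mathbf{k}}{|\mathbf{k}|^2}$. $\widehat\theta(\xi)=\int_{\mathbb{R}^2}\theta(z)e^{-i\xi\cdot z}dz$ (Lebesgue measure). For $\ell>0$, $\theta_\ell$ is the periodized rescaled mollifier, normalized as a density for normalized Haar measure: $\theta_\ell(x)=(2\pi)^2\sum_{m\in\mathbb{Z}^2}\ell^{-2}\theta(\ell^{-1}(x+2\pi m))$. $K(x,y)=K(x-y)$ is the Biot–Savart kernel on the torus, with Fourier coefficients $\widehat K(\mathbf{k})=i\,\mathbf{k}^\perp/|\mathbf{k}|^2$ for $\mathbf{k}\in\mathbb{Z}^2_0$ and $\widehat K(0)=0$, where $\mathbf{k}^\perp=(k_2,-k_1)$. $K_\ell(x,x_0)=\int_{\mathbb{T}^2}K(x,y)\theta_\ell(y-x_0)\,dy$. The covariance function is $Q_{\mathrm{vortex}}(x,x')=\mathbb{E}[\Gamma K_L(x,X_0)\otimes\Gamma K_L(x',X_0)]$, characterized by $$\int\!\!\int v(x)^TQ_{\mathrm{vortex}}(x,x')w(x')\,dx\,dx'=\mathbb{E}\Big[\Gamma^2\int K_L(x,X_0)\cdot v(x)dx\int K_L(x',X_0)\cdot w(x')dx'\Big]$$ for (e.g. smooth) vector fields $v,w$ on $\mathbb{T}^2$.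 Let $H$ be the space of mean-zero periodic $L^2$ divergence-free vector fields on $\mathbb{T}^2$ and $A$ the Stokes operator, $Av=\Delta v$ (componentwise) on the $\mathsf{H}^2$ fields in $H$. The Solenoidal Fractional Gaussian Field of index $s\in\mathbb{R}$ is the Gaussian measure with covariance operator $(-A)^{-s}$. *)

(* Defs.v *)
From HB Require Import structures.
From mathcomp Require Import all_boot all_order all_algebra.
From mathcomp Require Import finmap.
From mathcomp Require Import all_classical all_reals all_analysis.
From mathcomp.analysis.showcase Require summability.
From mathcomp Require Import complex.

Set Implicit Arguments.
Unset Strict Implicit.
Unset Printing Implicit Defensive.

Import Order.TTheory GRing.Theory Num.Theory.
Import numFieldTopology.Exports numFieldNormedType.Exports.

Local Open Scope classical_set_scope.
Local Open Scope ring_scope.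

(* Functions, vector fields and kernels on the torus R^2/(2 pi Z)^2 are
   2 pi-periodic functions of points of the plane R * R. The library norm on
   R * R is the sup norm, so Euclidean norms are always written out. *)
Notation plane R := (R * R)%type (only parsing).
Notation vfield R := ((R * R)%type -> 'cV[R]_2) (only parsing).

Definition dotp {R : realType} (x y : plane R) : R := x.1 * y.1 + x.2 * y.2.
Definition enorm {R : realType} (x : plane R) : R := Num.sqrt (dotp x x).
Definition lattice {R : realType} (k : int * int) : plane R :=
  ((k.1)%:~R, (k.2)%:~R).
Definition vec {R : realType} (x : plane R) : 'cV[R]_2 :=
  \col_i (if i == 0 then x.1 else x.2).
Definition perp {R : realType} (x : plane R) : plane R := (x.2, - x.1).

(* P_k = I - k k^T / |k|^2 *)
Definition leray_symbol {R : realType} (k : int * int) : 'M[R]_2 :=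
  1%:M - (enorm (lattice k : plane R) ^- 2)
         *: (vec (lattice k) *m (vec (lattice k))^T).

(* e^{it} *)
Definition cis {R : realType} (t : R) : R[i] := Complex (cos t) (sin t).

Definition complex_integral {d} {T : measurableType d} {R : realType}
    (mu : {measure set T -> \bar R}) (f : T -> R[i]) : R[i] :=
  Complex (Rintegral mu setT (fun x => complex.Re (f x)))
          (Rintegral mu setT (fun x => complex.Im (f x))).

(* Unconditional convergence over Z^2 \ {0}, i.e. along the net of finite
   subsets. *)
Definition has_lattice_sum {R : realType} (F : int * int -> R[i]) (S : R[i]) :=
  (fun A : {fset int * int} => (\sum_(k <- A | k != 0) F k : R[i]^o))
    @ summability.totally --> (S : R[i]^o).

Definition unit_dir {R : realType} (i : 'I_2) : plane R :=
  ((i == 0)%:R, (i == 1)%:R).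
Definition partial {R : realType} (i : 'I_2) (f : plane R -> R) : plane R -> R :=
  fun x => 'D_(unit_dir i) f x.

(* C^infinity: all iterated partial derivatives exist and are continuous. *)
Definition smooth {R : realType} (f : plane R -> R) : Prop :=
  forall s : seq 'I_2,
    continuous (foldr partial f s) /\
    forall i x, derivable (foldr partial f s) x (unit_dir i).

Definition lebesgue2 (R : realType) :
    {measure set (measurableTypeR R * measurableTypeR R)%type -> \bar R} :=
  (lebesgue_measure \x lebesgue_measure)%E.

Definition cell (R : realType) : set (measurableTypeR R * measurableTypeR R) :=
  `[0, 2 * pi[%classic `*` `[0, 2 * pi[%classic.

Lemma measurable_cell (R : realType) : measurable (@cell R).
Proof. by apply: measurableX; exact: measurable_itv. Qed.

Lemma haar_weight_ge0 (R : realType) : 0 <= ((2 * pi) ^- 2 : R).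
Proof. by rewrite invr_ge0 sqr_ge0. Qed.

(* Normalized Haar measure of the torus, carried by [0, 2 pi)^2. *)
Definition haar (R : realType) :
    {measure set (measurableTypeR R * measurableTypeR R)%type -> \bar R} :=
  mscale (NngNum (haar_weight_ge0 R))
    (mrestr (lebesgue2 R) (@measurable_cell R)).

Definition torus_periodic {R : realType} {U : Type} (f : plane R -> U) : Prop :=
  forall x m, f (x + (2 * pi) *: lattice m) = f x.

Definition test_function {R : realType} (f : plane R -> R) : Prop :=
  torus_periodic f /\ smooth f.
Definition component {R : realType} (v : vfield R) (i : 'I_2) : plane R -> R :=
  fun x => v x i 0.
Definition test_field {R : realType} (v : vfield R) : Prop :=
  forall i, test_function (component v i).

(* hat f (k) = int f(x) e^{-i k.x} dx over the torus *)
Definition fourier_coef {R : realType} (f : plane R -> R) (k : int * int) : R[i] :=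
  complex_integral (haar R)
    (fun x => ((f x)%:C * cis (- dotp (lattice k) x))%C).

(* hat f (xi) = int f(z) e^{-i xi.z} dz over R^2 *)
Definition fourier_plane {R : realType} (f : plane R -> R) (xi : plane R) : R[i] :=
  complex_integral (lebesgue2 R)
    (fun z => ((f z)%:C * cis (- dotp xi z))%C).

Definition radial {R : realType} {U : Type} (f : plane R -> U) : Prop :=
  forall x y, enorm x = enorm y -> f x = f y.

(* "Supported in B(0,1)" is read in its weakest form: theta vanishes outside
   the open unit disc. *)
Record mollifier {R : realType} (theta : plane R -> R) : Prop := Mollifier {
  mollifier_smooth : smooth theta ;
  mollifier_even : forall z, theta (- z) = theta z ;
  mollifier_ge0 : forall z, 0 <= theta z ;
  mollifier_mass1 : (\int[lebesgue2 R]_z (theta z)%:E = 1)%E ;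
  mollifier_support : forall z, 1 <= enorm z -> theta z = 0
}.

(* theta_l(x) = (2 pi)^2 sum_m l^-2 theta (l^-1 (x + 2 pi m)); for l > 0 and
   theta of compact support the sum has finitely many nonzero terms, as the
   finitely supported sum over m requires. *)
Definition periodized {R : realType} (theta : plane R -> R) (l : R)
    (x : plane R) : R :=
  (2 * pi) ^+ 2 *
  \sum_(m \in [set: int * int])
     l ^- 2 * theta (l^-1 *: (x + (2 * pi) *: lattice m)).

(* K is the (a.e. unique) integrable periodic field with Fourier coefficients
   i k^perp / |k|^2 for k <> 0, and 0 for k = 0. *)
Record biot_savart {R : realType} (K : vfield R) : Prop := BiotSavart {
  biot_savart_periodic : torus_periodic K ;
  biot_savart_integrable : forall i,
    (haar R).-integrable setT (EFin \o component K i) ;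
  biot_savart_coef0 : forall i, fourier_coef (component K i) 0 = 0 ;
  biot_savart_coef : forall i (k : int * int), k != 0 ->
    fourier_coef (component K i) k =
      Complex 0 (vec (perp (lattice k)) i 0 / enorm (lattice k : plane R) ^+ 2)
}.

(* K_l(x, x0) = int K(x - y) theta_l(y - x0) dy over the torus *)
Definition smoothed_kernel {R : realType} (K : vfield R)
    (theta : plane R -> R) (l : R) (x x0 : plane R) : 'cV[R]_2 :=
  \col_i Rintegral (haar R) setT
           (fun y => component K i (x - y) * periodized theta l (y - x0)).

(* (x, x') |-> E[F(x) (x) F(x')] for a random vector field F *)
Definition covariance_function {d} {T : measurableType d} {R : realType}
    (P : probability T R) (F : T -> vfield R) (x x' : plane R) : 'M[R]_2 :=
  \matrix_(i, j) fine ('E_P[fun w => (F w x *m (F w x')^T) i j])%E.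

Definition has_density {d} {T : measurableType d} {R : realType}
    (P : probability T R) (X : {RV P >-> R}) (f : R -> R) : Prop :=
  [/\ measurable_fun setT f, (forall r, 0 <= f r)
    & forall A, measurable A ->
        (distribution P X A = \int[lebesgue_measure]_(r in A) (f r)%:E)%E].

(* X is given by its representative in [0, 2 pi)^2. *)
Definition uniform_on_torus {d} {T : measurableType d} {R : realType}
    (P : probability T R)
    (X : {RV P >-> (measurableTypeR R * measurableTypeR R)%type}) : Prop :=
  forall A, measurable A -> distribution P X A = haar R A.

Definition independent_rv {d d1 d2} {T : measurableType d}
    {T1 : measurableType d1} {T2 : measurableType d2} {R : realType}
    (P : probability T R) (X : T -> T1) (Y : T -> T2) : Prop :=
  forall A B, measurable A -> measurable B ->
    (P ((X @^-1` A) `&` (Y @^-1` B)) = P (X @^-1` A) * P (Y @^-1` B))%E.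

Definition L2_function {R : realType} (f : plane R -> R) : Prop :=
  torus_periodic f /\
  (f : measurableTypeR R * measurableTypeR R -> R) \in Lfun (haar R) 2%:E.
Definition L2_field {R : realType} (v : vfield R) : Prop :=
  forall i, L2_function (component v i).

Definition inner {R : realType} (v w : vfield R) : R :=
  Rintegral (haar R) setT (fun x => \sum_i component v i x * component w i x).

(* H: mean-zero, (weakly) divergence-free L^2 fields *)
Record solenoidal {R : realType} (v : vfield R) : Prop := Solenoidal {
  solenoidal_L2 : L2_field v ;
  solenoidal_mean0 : forall i, Rintegral (haar R) setT (component v i) = 0 ;
  solenoidal_div0 : forall phi, test_function phi ->
    Rintegral (haar R) setT
      (fun x => \sum_i component v i x * partial i phi x) = 0
}.

Definition weak_partial {R : realType} (i : 'I_2) (f g : plane R -> R) : Prop :=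
  forall phi, test_function phi ->
    Rintegral (haar R) setT (fun x => f x * partial i phi x) =
    - Rintegral (haar R) setT (fun x => g x * phi x).

(* f belongs to the Sobolev space H^2 and Laplace(f) = g almost everywhere *)
Definition laplacian {R : realType} (f g : plane R -> R) : Prop :=
  L2_function f /\
  exists (df : 'I_2 -> plane R -> R) (ddf : 'I_2 -> 'I_2 -> plane R -> R),
    [/\ forall i, L2_function (df i) /\ weak_partial i f (df i),
        forall i j, L2_function (ddf i j) /\ weak_partial j (df i) (ddf i j)
      & {ae haar R, forall x, g x = \sum_i ddf i i x}].

(* v lies in the domain of the Stokes operator and A v = w *)
Definition stokes {R : realType} (v w : vfield R) : Prop :=
  [/\ solenoidal v, solenoidal w
    & forall i, laplacian (component v i) (component w i)].

(* w = (-A)^{-s} v, by the spectral calculus: -A has compact resolvent, so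
   H has an orthonormal basis of eigenfields and (-A)^{-s} acts on the
   lambda-eigenspace as multiplication by lambda^{-s}.  The relation determines
   w up to a null set, and its domain is that of the (for s < 0 unbounded)
   self-adjoint operator (-A)^{-s}. *)
Definition stokes_power {R : realType} (s : R) (v w : vfield R) : Prop :=
  [/\ solenoidal v, solenoidal w
    & forall (lambda : R) (e : vfield R),
        stokes e (fun x => - lambda *: e x) ->
        inner w e = lambda `^ (- s) * inner v e].

Definition stokes_power_dom {R : realType} (s : R) (v : vfield R) : Prop :=
  exists w, stokes_power s v w.

(* p is the orthogonal projection on H of the L^2 field v *)
Definition leray_projection {R : realType} (v p : vfield R) : Prop :=
  [/\ L2_field v, solenoidal p
    & forall h, solenoidal h -> inner v h = inner p h].

(* Dirac masses are Gaussian; normal_prob 0 0 is not the Dirac mass at 0 *)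
Definition centered_gaussian {d} {T : measurableType d} {R : realType}
    (P : probability T R) (X : {RV P >-> R}) : Prop :=
  (exists2 sigma : R, 0 < sigma &
     forall A, measurable A -> distribution P X A = normal_prob 0 sigma A) \/
  {ae P, forall w, X w = 0}.

(* Solenoidal Fractional Gaussian Field of index s, i.e. the centred Gaussian
   measure with covariance operator (-A)^{-s} on H.  For s <= 1 this measure is
   not carried by H but by distributions, so the field is given, for every s,
   by its pairings X v = "int u . v": an a.s. linear centred Gaussian family
   indexed by the domain of (-A)^{-s}, with
   E[X v X w] = <(-A)^{-s} v, w>.  As u is solenoidal with zero mean, the
   pairing with a general field is the pairing with its projection on H.
   Values of X outside these fields are irrelevant. *)
Record SFGF {d} {T : measurableType d} {R : realType} (P : probability T R)
    (s : R) (X : vfield R -> {RV P >-> R}) : Prop := IsSFGF {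
  SFGF_linear : forall (a : R) (v w : vfield R),
    stokes_power_dom s v -> stokes_power_dom s w ->
    {ae P, forall t, X (fun x => a *: v x + w x) t = a * X v t + X w t} ;
  SFGF_solenoidal : forall v p : vfield R, leray_projection v p ->
    {ae P, forall t, X v t = X p t} ;
  SFGF_gaussian : forall v : vfield R, stokes_power_dom s v ->
    centered_gaussian (X v) ;
  SFGF_covariance : forall v w Cv : vfield R,
    stokes_power s v Cv -> stokes_power_dom s w ->
    P.-integrable setT (fun t => (X v t * X w t)%:E) /\
    ('E_P[fun t => (X v t * X w t)%R] = (inner Cv w)%:E)%E
}.

(* Q is the covariance function of a random field given by its pairings X v
   with vector fields: E[X v X w] = int int v(x)^T Q(x, x') w(x') dx dx'. *)
Definition is_covariance_function {d} {T : measurableType d} {R : realType}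
    (P : probability T R) (X : vfield R -> {RV P >-> R})
    (Q : plane R -> plane R -> 'M[R]_2) : Prop :=
  forall v w : vfield R, test_field v -> test_field w ->
    P.-integrable setT (fun t => (X v t * X w t)%:E) /\
    ('E_P[fun t => (X v t * X w t)%R] =
     (Rintegral (haar R) setT (fun x =>
       Rintegral (haar R) setT (fun x' =>
         ((v x)^T *m Q x x' *m w x') 0 0)))%:E)%E.

(* Main.v *)
(* The periodized mollifier is theta_l = sum_k \hat theta(l k) e^{ik.x}, by
   unfolding its Fourier coefficients and Fejer summation; convolving it with K multiplies each mode by
   i k^perp / |k|^2.  Hence, X_0 being uniform and independent of L, Parseval gives
   for the covariance of Gamma K_L
     sum_k E[gamma(L)^2 \hat theta(L |k|)^2] (k^perp (x) k^perp) / |k|^4 e^{ik.(x - x')},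
   where (k^perp (x) k^perp) / |k|^2 = P_k, and the substitution r -> r / |k| in
   int \hat theta(r |k|)^2 C r^alpha dr turns the expectation into D |k|^{-1-alpha}.
   Finiteness of D near 0 is alpha > -1, and near infinity the rapid decay of
   \hat theta.  For the Gaussian field, a test field v has Leray projection
   p v = sum_{k <> 0} P_k \hat v(k) e^{ik.x} and (-A)^{-s} acts on it as |k|^{-2s} on
   each mode, because the trigonometric eigenfields of A determine the Fourier
   coefficients. *)

From HB Require Import structures.
Require Import Defs.
From mathcomp Require Import all_boot all_order all_algebra.
From mathcomp Require Import finmap.
From mathcomp Require Import all_classical all_reals all_analysis.
From mathcomp Require Import measurable_realfun.
From mathcomp.analysis.showcase Require summability.
From mathcomp Require Import complex.
From mathcomp Require Import zify ring lra.

Set Implicit Arguments.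
Unset Strict Implicit.
Unset Printing Implicit Defensive.

Import Order.TTheory GRing.Theory Num.Theory.
Import numFieldTopology.Exports numFieldNormedType.Exports.

Local Open Scope classical_set_scope.
Local Open Scope ring_scope.

(** * Absolutely summable families on Z^2 *)

Section lattice_sums.
Context {R : realType}.
Implicit Types (F G : int * int -> R) (A B : seq (int * int)).

(** Modes are kept real, as cosines and sines: for real fields the imaginary parts at k and -k
    cancel, and complex numbers occur only where the statement is read in or out. K is merely
    integrable, so its own Fourier series is never summed; the absolutely convergent series is that
    of theta_l, integrated termwise against K. The exponent matters when the sum over k is exchanged
    with the expectation: the k-th term is dominated by a function of expectation D |k|^{-3-alpha},
    and these are summable over Z^2 because 3 + alpha > 2. Entries of the covariance off the
    diagonal (or at x <> x') have no sign, so their integrability is borrowed from the diagonal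
    ones, to which Tonelli applies. On the Gaussian side (-A)^{-s} is known only through its
    pairings with eigenfields, but no eigenbasis is constructed: it is enough that an eigenfield for
    lambda has no Fourier coefficient off |k|^2 = lambda. Weak derivatives are therefore only ever
    tested against trigonometric functions. *)

Definition zrange (N : nat) : seq int :=
  [seq n%:Z - N%:Z | n <- iota 0 (N.*2.+1)].

Definition box (N : nat) : seq (int * int) :=
  [seq (i, j) | i <- zrange N, j <- zrange N].

Lemma mem_zrange N (i : int) : (i \in zrange N) = (`|i| <= N)%N.
Proof.
apply/mapP/idP => [[n]|iN].
  rewrite mem_iota /= add0n ltnS -addnn => nN ->; lia.
exists (absz (i + N%:Z)); last lia.
by rewrite mem_iota /= add0n ltnS -addnn; lia.
Qed.

Lemma zrange_uniq N : uniq (zrange N).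
Proof. by rewrite map_inj_uniq ?iota_uniq// => m n /addIr []. Qed.

Lemma mem_box N k : (k \in box N) = (`|k.1| <= N)%N && (`|k.2| <= N)%N.
Proof.
rewrite -!mem_zrange; apply/allpairsP/andP => [[p [p1 p2 ->]]//|[k1 k2]].
by exists k; split => //; case: k {k1 k2}.
Qed.

Lemma box_uniq N : uniq (box N).
Proof.
by apply: allpairs_uniq; rewrite ?zrange_uniq// => -[a b] [c d] _ _ /= [-> ->].
Qed.

Lemma box_sub M N : (M <= N)%N -> {subset box M <= box N}.
Proof.
by move=> MN k; rewrite !mem_box => /andP[a b]; rewrite !(leq_trans _ MN).
Qed.

Lemma box_exhaust A : exists N, {subset A <= box N}.
Proof.
elim: A => [|k A [N AN]]; first by exists 0%N.
exists (maxn N (maxn `|k.1| `|k.2|)) => j; rewrite inE => /orP[/eqP->|/AN].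
  by rewrite mem_box !leq_max !leqnn !orbT.
by apply: box_sub; rewrite leq_maxl.
Qed.

Lemma box_opp N : perm_eq (box N) [seq - k | k <- box N].
Proof.
apply: uniq_perm; first exact: box_uniq.
  by rewrite map_inj_uniq ?box_uniq//; exact: oppr_inj.
move=> k; apply/idP/mapP => [kN|[j jN ->]]; last by move: jN; rewrite !mem_box /=; lia.
by exists (- k); rewrite ?opprK//; move: kN; rewrite !mem_box /=; lia.
Qed.

Lemma ler_sum_subset (I : eqType) (A B : seq I) (F : I -> R) :
  uniq A -> uniq B -> {subset A <= B} -> (forall k, 0 <= F k) ->
  \sum_(k <- A) F k <= \sum_(k <- B) F k.
Proof.
move=> uA uB AB F0.
rewrite [leRHS](bigID (mem A)) /= -[X in _ <= X + _]big_filter.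
have pA : perm_eq [seq i <- B | i \in A] A.
  apply: uniq_perm; rewrite ?filter_uniq// => k; rewrite mem_filter.
  by case: (boolP (k \in A)) => //= /AB ->.
by rewrite (perm_big _ pA) lerDl sumr_ge0.
Qed.

(** Both differences are sums over the elements of B outside A. This reduces the Cauchy property of
    signed sums to that of the absolute ones. *)
Lemma sum_subset_dist (I : eqType) (A B : seq I) (F : I -> R) :
  uniq A -> uniq B -> {subset A <= B} ->
  `|\sum_(k <- B) F k - \sum_(k <- A) F k| <=
   \sum_(k <- B) `|F k| - \sum_(k <- A) `|F k|.
Proof.
move=> uA uB AB.
have pA : perm_eq [seq i <- B | i \in A] A.
  apply: uniq_perm; rewrite ?filter_uniq// => k; rewrite mem_filter.
  by case: (boolP (k \in A)) => //= /AB ->.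
have E (f : I -> R) : \sum_(k <- B) f k - \sum_(k <- A) f k =
    \sum_(k <- B | k \notin A) f k.
  by rewrite (bigID (mem A)) /= -[X in X + _ - _]big_filter (perm_big _ pA) addrAC subrr add0r.
by rewrite !E ler_norm_sum.
Qed.

(** Absolute convergence without any enumeration of Z^2, so that comparison and linearity are
    statements about finite sums. *)
Definition lsummable F := exists M : R, forall A, uniq A ->
  \sum_(k <- A) `|F k| <= M.

(* For absolutely summable F the limit along squares is the unconditional sum,
   see lsum_net. *)
Definition lsum F : R := limn (fun N => \sum_(k <- box N) F k).

(** The absolute sums over squares increase to a supremum, and any finite list fits into some larger
    square, so the remainder beyond a good square bounds the remainder of every list containing
    it. *)
Lemma lsummable_tail F : lsummable F -> forall e : R, 0 < e ->
  exists N, forall A, uniq A -> {subset box N <= A} ->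
    \sum_(k <- A) `|F k| - \sum_(k <- box N) `|F k| <= e.
Proof.
move=> [M FM] e e0.
pose a N := \sum_(k <- box N) `|F k|.
have nda : nondecreasing_seq a.
  move=> m n mn; apply: ler_sum_subset; rewrite ?box_uniq//.
  exact: box_sub.
have uba : has_ubound (range a) by exists M => _ [n _ <-]; exact/FM/box_uniq.
have ca := nondecreasing_cvgn nda uba.
have sa : has_sup (range a) by split => //; exists (a 0%N); exists 0%N.
have /cvgrPdist_le/(_ _ e0)[N _ /(_ N (leqnn N)) /= aN] := ca.
exists N => A uA NA; have [N' AN'] := box_exhaust A.
apply: le_trans aN; apply: le_trans (ler_norm _); rewrite lerD2r.
apply: (@le_trans _ _ (a N')); first by apply: ler_sum_subset; rewrite ?box_uniq.
by apply: sup_upper_bound => //; exists N'.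
Qed.

Lemma lsummable_cauchy F : lsummable F -> forall e : R, 0 < e ->
  exists N, forall A B, uniq A -> uniq B -> {subset box N <= A} ->
    {subset box N <= B} ->
    `|\sum_(k <- A) F k - \sum_(k <- B) F k| <= e.
Proof.
move=> sF e e0; have e20 : 0 < e / 2 by lra.
have [N HN] := lsummable_tail sF e20.
exists N => A B uA uB NA NB.
have := sum_subset_dist F (box_uniq N) uA NA.
have := sum_subset_dist F (box_uniq N) uB NB.
have := HN _ uA NA; have := HN _ uB NB.
move: (\sum_(k <- A) F k) (\sum_(k <- B) F k) (\sum_(k <- box N) F k) => a b c.
move=> h1 h2 /le_trans/(_ h1) + /le_trans/(_ h2).
by rewrite !ler_norml => /andP[? ?] /andP[? ?]; apply/andP; split; lra.
Qed.

Lemma lsum_cvg F : lsummable F ->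
  (fun N => \sum_(k <- box N) F k) @ \oo --> lsum F.
Proof.
move=> sF; suff : cvgn (fun N => \sum_(k <- box N) F k) by [].
apply/cauchy_cvgP/cauchy_exP => e e0.
have e20 : 0 < e / 2 by lra.
have [N HN] := lsummable_cauchy sF e20.
exists (\sum_(k <- box N) F k), N => //= n /= Nn.
rewrite /ball /=; apply: le_lt_trans (_ : e / 2 < e); last by lra.
by apply: HN; rewrite ?box_uniq//; exact: box_sub.
Qed.

(** The Cauchy estimate for two lists containing a square, with one of them running through the
    squares. This is convergence along the net of finite subsets. *)
Lemma lsum_net F : lsummable F -> forall e : R, 0 < e ->
  exists N, forall A, uniq A -> {subset box N <= A} ->
    `|\sum_(k <- A) F k - lsum F| <= e.
Proof.
move=> sF e e0; have [N HN] := lsummable_cauchy sF e0.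
exists N => A uA NA.
have /cvgB/(_ (lsum_cvg sF)) : (fun=> \sum_(k <- A) F k) @ \oo --> (\sum_(k <- A) F k).
  exact: cvg_cst.
move/cvg_norm/cvgr_to_le; apply.
by exists N => // n /= Nn; apply: HN; rewrite ?box_uniq//; exact: box_sub.
Qed.

Lemma lsum_unique F l : (fun N => \sum_(k <- box N) F k) @ \oo --> l -> lsum F = l.
Proof. by move=> Fl; apply/cvg_lim. Qed.

Lemma lsummable_le F G : (forall k, `|F k| <= G k) -> lsummable G -> lsummable F.
Proof.
move=> FG [M GM]; exists M => A uA; apply: le_trans (GM _ uA).
by apply: ler_sum => k _; exact: le_trans (ler_norm _).
Qed.

Lemma lsummableZ c F : lsummable F -> lsummable (fun k => c * F k).
Proof.
move=> [M FM]; exists (`|c| * M) => A uA.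
under eq_bigr do rewrite normrM.
by rewrite -mulr_sumr ler_wpM2l// FM.
Qed.

Lemma lsummableD F G : lsummable F -> lsummable G ->
  lsummable (fun k => F k + G k).
Proof.
move=> [M FM] [M' GM]; exists (M + M') => A uA.
apply: le_trans (lerD (FM _ uA) (GM _ uA)).
by rewrite -big_split /=; apply: ler_sum => k _; exact: ler_normD.
Qed.

Lemma lsummable_normr F : lsummable F -> lsummable (fun k => `|F k|).
Proof.
by move=> [M FM]; exists M => A uA; under eq_bigr do rewrite normr_id; exact: FM.
Qed.

Lemma lsumD F G : lsummable F -> lsummable G ->
  lsum (fun k => F k + G k) = lsum F + lsum G.
Proof.
move=> sF sG; apply: lsum_unique.
by under eq_fun do rewrite big_split; apply: cvgD; exact: lsum_cvg.
Qed.

Lemma lsumZ c F : lsummable F -> lsum (fun k => c * F k) = c * lsum F.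
Proof.
move=> sF; apply: lsum_unique; under eq_fun do rewrite -mulr_sumr.
by apply: cvgMr; exact: lsum_cvg.
Qed.

(** Squares are symmetric about 0, so every partial sum equals its own opposite. *)
Lemma lsum_odd F : (forall k, F (- k) = - F k) -> lsum F = 0.
Proof.
move=> oF; apply: lsum_unique; rewrite [X in X @ _](_ : _ = fun=> 0); first exact: cvg_cst.
apply/funext => N; set s := LHS.
suff : s = - s by move=> ?; lra.
rewrite {1}/s (perm_big _ (box_opp N)) big_map.
by under eq_bigr do rewrite oF; rewrite sumrN.
Qed.

Lemma lsum_norm_box F G N : (forall k, `|F k| <= G k) -> lsummable G ->
  `|\sum_(k <- box N) F k| <= lsum G.
Proof.
move=> FG sG; apply: (@le_trans _ _ (\sum_(k <- box N) G k)).
  by apply: le_trans (ler_norm_sum _ _ _) _; exact: ler_sum.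
have /cvgr_to_ge := lsum_cvg sG; apply.
exists N => // n /= Nn; apply: ler_sum_subset; rewrite ?box_uniq//.
  exact: box_sub.
by move=> k; exact: le_trans (FG k).
Qed.

Lemma lsum_norm F G : (forall k, `|F k| <= G k) -> lsummable G ->
  `|lsum F| <= lsum G.
Proof.
move=> FG sG; have /cvg_norm/cvgr_to_le := lsum_cvg (lsummable_le FG sG); apply.
by apply: nearW => N; exact: lsum_norm_box.
Qed.

Lemma lsum_single F (c : R) (j : int * int) : F j = c ->
  (forall k, k != j -> F k = 0) -> lsum F = c.
Proof.
move=> Fj F0; apply: lsum_unique; apply: cvg_near_cst.
have [N HN] := box_exhaust [:: j].
exists N => // n /= Nn; rewrite (bigD1_seq j) ?box_uniq//=; last first.
  by apply: (box_sub Nn); apply: HN; rewrite inE.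
by rewrite Fj big1 ?addr0// => k /F0.
Qed.

(** A mean value inequality for t^{-s} on [x - 1, x], where x = n + 2: by e^u >= 1 + u and ln(1 + u)
    <= u, (1 - 1/x)^{-s} >= 1 - s ln(1 - 1/x) >= 1 + s/x. *)
Lemma powR_telescope (s : R) (n : nat) : 0 < s ->
  s * (n.+2%:R) `^ (- (1 + s)) <= (n.+1%:R) `^ (- s) - (n.+2%:R) `^ (- s).
Proof.
move=> s0; set x : R := n.+2%:R.
have x0 : 0 < x by rewrite /x ltr0n.
have x1 : 0 < n.+1%:R :> R by rewrite ltr0n.
have -> : n.+1%:R = x * (1 - x^-1) :> R.
  by rewrite mulrBr mulr1 divff ?gt_eqF// /x -[n.+2%:R]natr1 addrK.
have y0 : 0 < 1 - x^-1.
  by rewrite subr_gt0 invf_lt1// /x ltr1n.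
rewrite powRM; [|exact: ltW|exact: ltW].
have -> : x `^ (- (1 + s)) = x `^ (- s) * x^-1.
  rewrite opprD addrC powRD ?powR_inv1// 1?ltW//.
  by apply/implyP => _; rewrite gt_eqF.
rewrite mulrCA -{3}[x `^ _]mulr1 -mulrBr ler_wpM2l ?powR_ge0//.
rewrite lerBrDr /powR gt_eqF//.
apply: le_trans (expR_ge1Dx _); rewrite addrC lerD2l mulNr -mulrN.
apply: ler_wpM2l; first exact: ltW.
rewrite lerNr; apply: le_trans (le_ln1Dx _) _ => //.
by rewrite ltrN2 invf_lt1// /x ltr1n.
Qed.

(** The term 1 is split off and the others telescope to at most 1/s. *)
Lemma sum_powR_bound (s : R) (n : nat) : 0 < s ->
  \sum_(i < n) (i.+1%:R) `^ (- (1 + s)) <= 1 + s^-1.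
Proof.
move=> s0; case: n => [|n]; first by rewrite big_ord0 addr_ge0 ?invr_ge0 1?ltW.
rewrite big_ord_recl /= powR1 lerD2l.
apply: (@le_trans _ _ (s^-1 * (1 - (n.+1%:R) `^ (- s)))); last first.
  by rewrite ler_piMr ?invr_ge0 1?ltW// gerBl powR_ge0.
rewrite ler_pdivlMl// mulr_sumr.
elim: n => [|n IHn]; first by rewrite big_ord0 powR1 subrr.
rewrite big_ord_recr /=; apply: le_trans (lerD IHn (powR_telescope n s0)) _.
by rewrite addrA subrK.
Qed.

(** A product of such weights in the two coordinates is the common majorant of all series below: its
    sum over a square factors, and b = 1 is the decay given by applying 1 - d^2 once in each
    variable. *)
Definition lweight (b : R) (n : int) : R := (1 + n%:~R ^+ 2) `^ (- b).

Lemma lweight_gt0 b n : 0 < lweight b n.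
Proof. by rewrite powR_gt0// ltr_wpDr ?sqr_ge0. Qed.

Lemma lweight_pos b (n : nat) : 0 < b ->
  lweight b n.+1%:Z <= (n.+1%:R) `^ (- (b *+ 2)).
Proof.
move=> b0; rewrite /lweight !powRN lef_pV2 ?posrE ?powR_gt0 ?ltr_wpDr ?sqr_ge0//.
have -> : (n.+1%:R : R) `^ (b *+ 2) = (n.+1%:R ^+ 2) `^ b.
  by rewrite -[b *+ 2]mulr_natl powRrM powR_mulrn.
apply: ge0_ler_powR; rewrite ?nnegrE ?sqr_ge0 ?addr_ge0 ?sqr_ge0//; first exact: ltW.
by rewrite lerDr.
Qed.

Lemma lweight_sum b N : 2^-1 < b ->
  \sum_(n <- zrange N) lweight b n <= 1 + 2 * (1 + (b *+ 2 - 1)^-1).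
Proof.
move=> b12; have b0 : 0 < b by lra.
have P : perm_eq (zrange N) (0 :: ([seq n.+1%:Z | n <- iota 0 N] ++
    [seq - n.+1%:Z | n <- iota 0 N])).
  apply: uniq_perm; first exact: zrange_uniq.
    rewrite /= mem_cat negb_or cat_uniq.
    rewrite (map_inj_uniq (f := fun n => n.+1%:Z)) ?iota_uniq; last by move=> m n [].
    rewrite (map_inj_uniq (f := fun n => - n.+1%:Z)) ?iota_uniq; last first.
      by move=> m n /oppr_inj [].
    rewrite andbT; apply/and3P; split.
    - by apply/andP; split; apply/mapP => -[n _]; lia.
    - by [].
    - by apply/hasPn => _ /mapP[n _ ->]; apply/mapP => -[m _]; lia.
  move=> n; rewrite mem_zrange inE mem_cat; apply/idP/or3P => [nN|].
    have [->|n0] := eqVneq n 0; first by constructor 1.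
    have [n1|n1] := lerP (0 : int) n.
    - constructor 2; apply/mapP; exists (absz n).-1; rewrite ?mem_iota; lia.
    - constructor 3; apply/mapP; exists (absz n).-1; rewrite ?mem_iota; lia.
  by case=> [/eqP->//|/mapP[m]|/mapP[m]]; rewrite mem_iota => mN ->; lia.
rewrite (perm_big _ P) /= big_cons big_cat /= !big_map.
have -> : \sum_(j <- iota 0 N) lweight b (- j.+1%:Z) =
    \sum_(j <- iota 0 N) lweight b j.+1%:Z.
  by apply: eq_bigr => j _; rewrite /lweight mulrNz sqrrN.
have -> : lweight b 0 = 1 by rewrite /lweight mulr0z expr0n addr0 powR1.
rewrite lerD2l -mulr2n -[X in X <= _]mulr_natl ler_wpM2l//.
apply: (@le_trans _ _ (\sum_(j <- iota 0 N) (j.+1%:R) `^ (- (b *+ 2)))).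
  by apply: ler_sum => j _; exact: lweight_pos.
have -> : b *+ 2 = 1 + (b *+ 2 - 1) by rewrite addrC subrK.
rewrite (addrC 1 (b *+ 2 - 1)) addrK.
have -> : iota 0 N = index_iota 0 N by rewrite /index_iota subn0.
rewrite big_mkord addrC; apply: sum_powR_bound; lra.
Qed.

Lemma lsummable_lweight b : 2^-1 < b ->
  lsummable (fun k => lweight b k.1 * lweight b k.2).
Proof.
move=> b12; pose c := 1 + 2 * (1 + (b *+ 2 - 1)^-1).
exists (c * c) => A uA; have [N AN] := box_exhaust A.
apply: (@le_trans _ _ (\sum_(k <- box N) lweight b k.1 * lweight b k.2)).
  under eq_bigr do rewrite ger0_norm ?mulr_ge0 1?ltW ?lweight_gt0//.
  apply: ler_sum_subset; rewrite ?box_uniq// => k.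
  by rewrite mulr_ge0 1?ltW ?lweight_gt0.
rewrite /box big_allpairs_dep /=.
under eq_bigr do rewrite -mulr_sumr.
rewrite -mulr_suml; apply: ler_pM; try exact: lweight_sum.
all: by apply: sumr_ge0 => i _; rewrite ltW ?lweight_gt0.
Qed.

Definition lnorm2 (k : int * int) : R := k.1%:~R ^+ 2 + k.2%:~R ^+ 2.

Lemma lnorm2E k : enorm (lattice k : plane R) ^+ 2 = lnorm2 k.
Proof. by rewrite sqr_sqrtr /dotp /lattice/= -!expr2// addr_ge0 ?sqr_ge0. Qed.

Lemma lnorm2_ge0 k : 0 <= lnorm2 k.
Proof. by rewrite addr_ge0 ?sqr_ge0. Qed.

Lemma lnorm2_eq0 k : (lnorm2 k == 0) = (k == 0).
Proof.
case: k => a b; rewrite /lnorm2 paddr_eq0 ?sqr_ge0//= !sqrf_eq0 !intr_eq0.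
by [].
Qed.

Lemma lnorm2_ge1 k : k != 0 -> 1 <= lnorm2 k.
Proof.
move=> k0; have : 0 < lnorm2 k by rewrite lt_def lnorm2_eq0 k0 lnorm2_ge0.
rewrite /lnorm2 -!rmorphXn -rmorphD /= -[0]/(0%:~R) -[1]/(1%:~R) ltr_int ler_int.
by rewrite gtz0_ge1.
Qed.

Lemma lnorm2_opp k : lnorm2 (- k) = lnorm2 k.
Proof. by rewrite /lnorm2 /= !mulrNz !sqrrN. Qed.

(** Since |k|^2 >= 1, each of 1 + k_1^2 and 1 + k_2^2 is at most 2 |k|^2, so their product is at
    most 4 |k|^4. *)
Lemma lnorm2_powR_le b k : 0 <= b -> k != 0 ->
  lnorm2 k `^ (- (b *+ 2)) <= 4 `^ b * (lweight b k.1 * lweight b k.2).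
Proof.
move=> b0 k0; have k1 := lnorm2_ge1 k0; have k00 := lt_le_trans ltr01 k1.
set u := 1 + k.1%:~R ^+ 2 : R; set v := 1 + k.2%:~R ^+ 2 : R.
have u0 : 0 < u by rewrite ltr_wpDr ?sqr_ge0.
have v0 : 0 < v by rewrite ltr_wpDr ?sqr_ge0.
rewrite /lweight -/u -/v -powRM; [|exact: ltW|exact: ltW].
rewrite !powRN -lef_pV2 ?posrE ?invr_gt0 ?mulr_gt0 ?invr_gt0 ?powR_gt0 ?mulr_gt0//.
rewrite invfM !invrK ler_pdivrMl ?powR_gt0//.
rewrite -[b *+ 2]mulr_natl powRrM powR_mulrn ?lnorm2_ge0// -powRM ?sqr_ge0//.
apply: ge0_ler_powR; rewrite ?nnegrE ?(mulr_ge0 (ltW u0) (ltW v0)) ?mulr_ge0 ?sqr_ge0 ?lnorm2_ge0//.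
have -> : 4 * lnorm2 k ^+ 2 = (2 * lnorm2 k) * (2 * lnorm2 k) by ring.
apply: ler_pM; rewrite ?(ltW u0) ?(ltW v0)// /u /v; move: k1; rewrite /lnorm2.
all: have := sqr_ge0 (k.1%:~R : R); have := sqr_ge0 (k.2%:~R : R); lra.
Qed.

Lemma lsummable_powR_norm (s : R) : 2 < s ->
  lsummable (fun k => if k == 0 then 0 else (enorm (lattice k : plane R) `^ s)^-1).
Proof.
(* With b = s/4 the comparison bounds |k|^{-4b} = |k|^{-s}, and s > 2 becomes the condition b > 1/2
   for the weights to be summable. *)
move=> s2; pose b := s / 4; have b2 : 2^-1 < b by rewrite /b; lra.
apply: lsummable_le (lsummableZ (4 `^ b) (lsummable_lweight b2)) => k.
case: ifPn => k0; first by rewrite normr0 !mulr_ge0 ?powR_ge0 1?ltW ?lweight_gt0.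
rewrite ger0_norm ?invr_ge0 ?powR_ge0//.
apply: le_trans (lnorm2_powR_le _ k0); last by rewrite /b; lra.
rewrite powRN lef_pV2 ?posrE ?powR_gt0 ?sqrtr_gt0//.
- have -> : s = 2 * (b *+ 2) by rewrite /b; field.
  by rewrite powRrM powR_mulrn ?sqrtr_ge0// lnorm2E.
- by rewrite (lt_le_trans ltr01)// lnorm2_ge1.
- by rewrite (lt_le_trans ltr01)// lnorm2_ge1.
Qed.

End lattice_sums.

(** * Haar measure of the torus *)

Section change_of_variables.
Context d1 d2 (X : measurableType d1) (Y : measurableType d2) (R : realType).
Variables (mu : {measure set X -> \bar R}) (nu : {measure set Y -> \bar R}).
Variables (phi : X -> Y) (mphi : measurable_fun setT phi) (c : {nonneg R}).
Hypothesis nuE : forall A, measurable A ->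
  nu A = ((c%:num)%:E * mu (phi @^-1` A))%E.
Let mphi_mixin := isMeasurableFun.Build _ _ _ _ _ mphi.
Let phi' : {mfun X >-> Y} := HB.pack phi mphi_mixin.

(** Here nu is c times the image of mu under phi. The constant is the Jacobian for affine maps and
    dilations, and 1 for reflections and for the law of a pair of random variables. *)
Lemma ge0_integral_image (D : set Y) (f : Y -> \bar R) : measurable D ->
  measurable_fun D f -> (forall y, D y -> (0 <= f y)%E) ->
  (\int[nu]_(y in D) f y = (c%:num)%:E * \int[mu]_(x in phi @^-1` D) f (phi x))%E.
Proof.
move=> mD mf f0.
rewrite (eq_measure_integral (mscale c (pushforward mu phi'))); last first.
  by move=> A mA _; rewrite nuE.
rewrite ge0_integral_mscale//; congr (_ * _)%E.
rewrite ge0_integral_pushforward// => y; rewrite inE; exact: f0.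
Qed.

End change_of_variables.

Section affine.
Context {R : realType}.
Notation leb := (@lebesgue_measure R).

Definition affine (a b : R) : measurableTypeR R -> measurableTypeR R :=
  fun t => a * t + b.

Lemma measurable_affine (a b : R) : measurable_fun setT (affine a b).
Proof. by apply: measurable_funD => //; exact: measurable_funM. Qed.

Lemma lebesgue_affine (a b : R) (a0 : 0 <= a) (A : set (measurableTypeR R)) :
  a != 0 -> measurable A ->
  leb A = (a%:E * leb (affine a b @^-1` A))%E.
Proof.
move=> an0 mA; have a1 : 0 < a by rewrite lt_def an0.
pose phi : {mfun measurableTypeR R >-> measurableTypeR R} :=
  HB.pack (affine a b)
   (isMeasurableFun.Build _ _ _ _ _ (measurable_affine a b)).
apply: (lebesgue_measure_unique (mu := mscale (NngNum a0) (pushforward leb phi))) => //.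
move=> _ [[x y]] _ <-; transitivity (a%:E * leb (affine a b @^-1` `]x, y]))%E; last by [].
have -> : affine a b @^-1` `]x, y]%classic = `](x - b) / a, (y - b) / a]%classic.
  apply/seteqP; split => t /=; rewrite /affine !in_itv/= ltr_pdivrMr// ler_pdivlMr//.
  by rewrite ltrBlDr lerBrDr [t * a]mulrC.
  by rewrite ltrBlDr lerBrDr [t * a]mulrC.
rewrite !lebesgue_measure_itv/= !lte_fin ltr_pM2r ?invr_gt0// ltrD2r.
case: ifPn => _; last by rewrite mule0.
by rewrite -!EFinB -EFinM; congr EFin; field.
Qed.

Lemma ge0_integral_affine (a b : R) (D : set (measurableTypeR R)) (f : measurableTypeR R -> \bar R) :
  0 < a -> measurable D -> measurable_fun D f -> (forall y, D y -> (0 <= f y)%E) ->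
  (\int[leb]_(y in D) f y =
   a%:E * \int[leb]_(t in affine a b @^-1` D) f (a * t + b)%R)%E.
Proof.
move=> a0 mD mf f0.
apply: (ge0_integral_image (c := NngNum (ltW a0)) (measurable_affine a b)) => //=.
by move=> A mA; apply: lebesgue_affine; rewrite ?gt_eqF// ltW.
Qed.

Lemma ge0_integral_opp (D : set (measurableTypeR R)) (f : measurableTypeR R -> \bar R) :
  measurable D -> measurable_fun D f -> (forall y, D y -> (0 <= f y)%E) ->
  (\int[leb]_(y in D) f y =
   \int[leb]_(t in (-%R : measurableTypeR R -> measurableTypeR R) @^-1` D) f (- t)%R)%E.
Proof.
move=> mD mf f0.
have H A : measurable A -> leb A =
    ((1%:nng%:num : R)%:E * leb ((-%R : measurableTypeR R -> measurableTypeR R) @^-1` A))%E.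
  by move=> mA; rewrite mul1e; apply/esym; exact: lebesgue_measureN.
rewrite (ge0_integral_image (phi := (-%R : measurableTypeR R -> measurableTypeR R)) _ H)//.
by rewrite mul1e.
Qed.

End affine.

(** * Integrals of periodic functions over one period *)

Section periodic_line.
Context {R : realType}.
Notation leb := (@lebesgue_measure R).
Variable h : measurableTypeR R -> \bar R.
Hypothesis mh : measurable_fun setT h.
Hypothesis h0 : forall t, (0 <= h t)%E.
Variables (p : R) (p0 : 0 < p).
Hypothesis ph : forall t, h (t + p)%R = h t.

Lemma periodic_int (n : int) t : h (t + n%:~R * p)%R = h t.
Proof.
have H m s : h (s + m%:R * p)%R = h s.
  elim: m s => [|m IH] s; first by rewrite mul0r addr0.
  by rewrite -natr1 mulrDl mul1r addrA ph IH.
case: n => n; first exact: H.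
rewrite NegzE mulrNz mulNr -[in RHS](subrK (n.+1%:R * p) t).
by rewrite -[LHS](H n.+1).
Qed.

Lemma integral_shift_period (n : int) (a b : R) :
  (\int[leb]_(t in `[a, b[) h t =
   \int[leb]_(t in `[(a + n%:~R * p)%R, (b + n%:~R * p)%R[) h t)%E.
Proof.
rewrite [RHS](@ge0_integral_affine _ 1 (n%:~R * p))//; last exact: measurable_funTS.
rewrite mul1e.
have -> : affine 1 (n%:~R * p) @^-1` `[a + n%:~R * p, b + n%:~R * p[ = `[a, b[%classic.
  apply/seteqP; split => t /=; rewrite /affine !in_itv/= mul1r lerD2r ltrD2r//.
by apply: eq_integral => t _; rewrite mul1r periodic_int.
Qed.

Lemma integral_itv_split (a c b : R) : a <= c -> c <= b ->
  (\int[leb]_(t in `[a, b[) h t =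
   \int[leb]_(t in `[a, c[) h t + \int[leb]_(t in `[c, b[) h t)%E.
Proof.
move=> ac cb; rewrite -ge0_integral_setU//; first last.
- by apply/disj_setPS => t [] /=; rewrite !in_itv/= => /andP[_ tc] /andP[ct _]; lra.
- exact: measurable_funTS.
congr integral; apply/seteqP; split => t /=; rewrite !in_itv/=.
  by case: (ltP t c) => tc /andP[-> ->]; [left|right].
by case=> /andP[h1 h2]; apply/andP; split; lra.
Qed.

Lemma integral_period (a : R) :
  (\int[leb]_(t in `[a, (a + p)%R[) h t = \int[leb]_(t in `[0%R, p[) h t)%E.
Proof.
(* Whole periods are removed to bring the left end to c in [0, p); then [c, c + p) is cut at p and
   its right piece is moved back onto [0, c). *)
pose n := Num.floor (a / p); pose c := a - n%:~R * p.
have /andP[c0 cp] : (0 <= c) && (c < p).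
  have /andP[n1 n2] := mem_rg1_floor (a / p).
  move: n1 n2; rewrite -/n ler_pdivlMr// ltr_pdivrMr// mulrDl mul1r /c.
  by move=> *; apply/andP; split; lra.
have -> : a = c + n%:~R * p by rewrite /c subrK.
rewrite [(c + _ + p)%R]addrAC -integral_shift_period.
rewrite (@integral_itv_split _ p)//; [|exact: ltW|lra].
rewrite (@integral_itv_split 0 c p)//; last exact: ltW.
rewrite addeC; congr (_ + _)%E.
by rewrite (integral_shift_period 1 0) mul1r add0r.
Qed.

Lemma integral_reflect_period (a : R) :
  (\int[leb]_(t in `[0%R, p[) h (a - t)%R = \int[leb]_(t in `[0%R, p[) h t)%E.
Proof.
rewrite -(integral_period (a - p)) subrK.
have mha : measurable_fun setT (fun t : measurableTypeR R => h (affine 1 a t)).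
  by apply: measurableT_comp => //; exact: measurable_affine.
rewrite [RHS](@ge0_integral_affine _ 1 a)//; last exact: measurable_funTS.
rewrite mul1e.
have -> : affine 1 a @^-1` `[a - p, a[ = `[- p, 0[%classic.
  apply/seteqP; split => t /=; rewrite /affine !in_itv/= => /andP[h1 h2];
  apply/andP; split; lra.
(* Negation maps [0, p[ onto ]-p, 0], so the closed end has to change sides first; single points are
   null. *)
rewrite [RHS]integral_itv_bndo_bndc; last exact: (measurable_funTS mha).
rewrite -[RHS]integral_itv_obnd_cbnd; last exact: (measurable_funTS mha).
rewrite [RHS]ge0_integral_opp//; last exact: (measurable_funTS mha).
have -> : (-%R : measurableTypeR R -> measurableTypeR R) @^-1` `]- p, 0] = `[0, p[%classic.
  apply/seteqP; split => t /=; rewrite !in_itv/= => /andP[h1 h2]; apply/andP; split; lra.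
by apply: eq_integral => t _; rewrite mul1r addrC.
Qed.

End periodic_line.

(** * Haar measure as the product of two normalized circles *)

Section torus_measure.
Context {R : realType}.
Notation leb := (@lebesgue_measure R).
Notation T1 := (measurableTypeR R).
Notation T2 := (measurableTypeR R * measurableTypeR R)%type.

Lemma two_pi_gt0 : 0 < 2 * pi :> R.
Proof. by rewrite mulr_gt0 ?pi_gt0. Qed.

(** Normalized length of one period, taken on the closed segment; it differs from the half-open cell
    by a null set. *)
Definition circ := uniform_prob two_pi_gt0.
HB.instance Definition _ := Probability.on circ.

Lemma circ_setT : circ setT = 1%E.
Proof. exact: (@probability_setT _ _ _ (uniform_prob two_pi_gt0)). Qed.

Lemma ge0_integral_circ (f : T1 -> \bar R) :
  measurable_fun setT f -> (forall x, 0 <= f x)%E ->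
  (\int[circ]_x f x = (2 * pi)^-1%:E * \int[leb]_(x in `[0%R, (2 * pi)%R[) f x)%E.
Proof.
move=> mf f0; rewrite integral_uniform// subr0.
by rewrite integral_itv_bndo_bndc//; exact: measurable_funTS.
Qed.

Lemma circE (A : set T1) : measurable A ->
  circ A = ((2 * pi)^-1%:E * leb (A `&` `[0%R, (2 * pi)%R[))%E.
Proof.
move=> mA; have := @ge0_integral_circ (EFin \o \1_A).
rewrite integral_indic// setIT => ->//; last 2 first.
- exact/measurable_EFinP.
- by move=> x; rewrite lee_fin.
by rewrite integral_indic// setIC.
Qed.

(** The two measures agree on rectangles. The product form is what gives access to Fubini and to
    one-variable arguments. *)
Lemma haarE (A : set T2) : measurable A -> haar R A = (circ \x circ)%E A.
Proof.
move=> mA; apply/esym; apply: product_measure_unique => // {mA} A B mA mB /=.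
transitivity (((2 * pi) ^- 2)%:E * (leb \x leb)%E ((A `*` B) `&` @cell R))%E; first by [].
rewrite /cell -setXI product_measure1E/=; [|exact: measurableI..].
rewrite !circE// muleACA -EFinM; congr (_ * _)%E; congr EFin.
by rewrite expr2 invfM.
Qed.

Lemma integral_haar (f : T2 -> \bar R) :
  (\int[haar R]_z f z = \int[circ \x circ]_z f z)%E.
Proof. by apply: eq_measure_integral => A mA _; exact: haarE. Qed.

Lemma Rintegral_haar (f : T2 -> R) :
  Rintegral (haar R) setT f = Rintegral (circ \x circ)%E setT f.
Proof. by rewrite /Rintegral integral_haar. Qed.

Lemma haar_setT : haar R setT = 1%E.
Proof. rewrite haarE// -setXTT product_measure1E//.
by rewrite [X in (X * X)%E](_ : _ = 1%E) ?mule1//; exact: circ_setT. Qed.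

Lemma integrable_haarP (f : T2 -> \bar R) :
  (haar R).-integrable setT f <-> (circ \x circ)%E.-integrable setT f.
Proof.
split=> /integrableP[mf fy]; apply/integrableP; split => //.
- by rewrite -integral_haar.
- by rewrite integral_haar.
Qed.

Lemma bounded_integrable (f : T2 -> R) (M : R) : measurable_fun setT f ->
  (forall x, `|f x| <= M) -> (haar R).-integrable setT (EFin \o f).
Proof.
move=> mf fM; apply: (@le_integrable _ _ _ _ _ measurableT _ (cst M%:E)) => //.
- exact/measurable_EFinP.
- by move=> x _ /=; rewrite lee_fin; apply: le_trans (fM x) _; exact: ler_norm.
- apply/integrableP; split => //.
  by rewrite (eq_integral (cst `|M%:E|%E))// integral_cst// haar_setT mule1 ltry.
Qed.

Lemma bounded_integrable_circ (f : T1 -> R) (M : R) : measurable_fun setT f ->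
  (forall x, `|f x| <= M) -> circ.-integrable setT (EFin \o f).
Proof.
move=> mf fM; apply: (@le_integrable _ _ _ _ _ measurableT _ (cst M%:E)) => //.
- exact/measurable_EFinP.
- by move=> x _ /=; rewrite lee_fin; apply: le_trans (fM x) _; exact: ler_norm.
- apply/integrableP; split => //.
  by rewrite (eq_integral (cst `|M%:E|%E))// integral_cst//
    [X in (_ * X)%E](_ : _ = 1%E) ?mule1 ?ltry//; exact: circ_setT.
Qed.

Lemma ge0_integral_haar1 (f : T2 -> \bar R) : measurable_fun setT f ->
  (forall z, 0 <= f z)%E ->
  (\int[haar R]_z f z = \int[circ]_x \int[circ]_y f (x, y))%E.
Proof. by move=> mf f0; rewrite integral_haar (fubini_tonelli1 _ mf f0). Qed.

Lemma Rintegral_haar1 (f : T2 -> R) M : measurable_fun setT f ->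
  (forall x, `|f x| <= M) ->
  Rintegral (haar R) setT f =
  Rintegral circ setT (fun x => Rintegral circ setT (fun y => f (x, y))).
Proof.
move=> mf fM; have /integrable_haarP fi := bounded_integrable mf fM.
rewrite Rintegral_haar /Rintegral -integral12_prod_meas1//; congr fine.
apply: eq_integral => x _; rewrite /fubini_F fineK//.
apply: integrable_fin_num => //; apply: bounded_integrable_circ (M) _ _.
  exact: measurable_fun_pair2.
by move=> y; exact: fM.
Qed.

Lemma Rintegral_haar2 (f : T2 -> R) M : measurable_fun setT f ->
  (forall x, `|f x| <= M) ->
  Rintegral (haar R) setT f =
  Rintegral circ setT (fun y => Rintegral circ setT (fun x => f (x, y))).
Proof.
move=> mf fM; have /integrable_haarP fi := bounded_integrable mf fM.
rewrite Rintegral_haar /Rintegral -integral21_prod_meas1//; congr fine.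
apply: eq_integral => y _; rewrite /fubini_G fineK//.
apply: integrable_fin_num => //; apply: bounded_integrable_circ (M) _ _.
  exact: measurable_fun_pair1.
by move=> x; exact: fM.
Qed.

Lemma measurable_sub (a : R) : measurable_fun setT ((fun t => a - t) : T1 -> T1).
Proof. exact: measurable_funB. Qed.

Lemma circ_reflect (h : T1 -> \bar R) (a : R) : measurable_fun setT h ->
  (forall t, 0 <= h t)%E -> (forall t, h (t + 2 * pi)%R = h t) ->
  (\int[circ]_t h (a - t)%R = \int[circ]_t h t)%E.
Proof.
move=> mh h0 ph; rewrite !ge0_integral_circ//; last first.
  by apply: measurableT_comp => //; exact: measurable_sub.
by rewrite (integral_reflect_period mh h0 two_pi_gt0 ph).
Qed.

Lemma measurable_sub2 (x : R * R) : measurable_fun setT ((fun y => x - y) : T2 -> T2).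
Proof.
apply: measurable_fun_pair => //=.
- by apply: measurableT_comp (measurable_sub x.1) _.
- by apply: measurableT_comp (measurable_sub x.2) _.
Qed.

Lemma periodic1 {U : Type} (f : R * R -> U) : torus_periodic f ->
  forall s t, f (s + 2 * pi, t) = f (s, t).
Proof.
move=> pf s t; rewrite -(pf (s, t) (1, 0)); congr f.
by rewrite /lattice /=; congr (_, _) => /=; rewrite /GRing.scale/= ?mulr1 ?mulr0 ?addr0.
Qed.

Lemma periodic2 {U : Type} (f : R * R -> U) : torus_periodic f ->
  forall s t, f (s, t + 2 * pi) = f (s, t).
Proof.
move=> pf s t; rewrite -(pf (s, t) (0, 1)); congr f.
by rewrite /lattice /=; congr (_, _) => /=; rewrite /GRing.scale/= ?mulr1 ?mulr0 ?addr0.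
Qed.

(** One coordinate at a time: the inner variable is reflected for each fixed outer one, then the
    partial integral, itself periodic, is reflected in the outer variable. *)
Lemma ge0_haar_reflect (f : T2 -> \bar R) (x : R * R) : measurable_fun setT f ->
  (forall z, 0 <= f z)%E -> torus_periodic f ->
  (\int[haar R]_y f (x - y)%R = \int[haar R]_y f y)%E.
Proof.
move=> mf f0 pf; rewrite !ge0_integral_haar1//; last first.
  by apply: measurableT_comp => //; exact: measurable_sub2.
have E s : (\int[circ]_t f (s, x.2 - t)%R = \int[circ]_t f (s, t))%E.
  apply: (circ_reflect (h := fun t => f (s, t))) => //.
    exact: measurable_fun_pair2.
  by move=> t; exact: periodic2.
transitivity (\int[circ]_s \int[circ]_t f ((x.1 - s)%R, t))%E.
  by apply: eq_integral => s _; exact: (E (x.1 - s)).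
apply: (circ_reflect (h := fun s => \int[circ]_t f (s, t))%E).
- exact: (measurable_fun_fubini_tonelli_F f).
- by move=> s; exact: integral_ge0.
- by move=> s; apply: eq_integral => t _; exact: periodic1.
Qed.

(** Moves the shift in a convolution from one factor to the other. *)
Lemma haar_reflect (f : T2 -> R) (x : R * R) : measurable_fun setT f ->
  torus_periodic f ->
  Rintegral (haar R) setT (fun y => f (x - y)) = Rintegral (haar R) setT f.
Proof.
move=> mf pf; have mf' : measurable_fun setT (EFin \o f) by exact/measurable_EFinP.
rewrite /Rintegral integralE [in RHS]integralE; congr (fine (_ - _)).
- rewrite -[RHS](@ge0_haar_reflect _ x)//.
  + by apply: eq_integral => y _; rewrite !funeposE.
  + exact: measurable_funepos.
  + by move=> z m; rewrite !funeposE /= pf.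
- rewrite -[RHS](@ge0_haar_reflect _ x)//.
  + by apply: eq_integral => y _; rewrite !funenegE.
  + exact: measurable_funeneg.
  + by move=> z m; rewrite !funenegE /= pf.
Qed.

End torus_measure.

(** * Measurability of continuous functions on the plane *)

Section plane_measurability.
Context {R : realType}.
Notation T1 := (measurableTypeR R).
Notation T2 := (measurableTypeR R * measurableTypeR R)%type.

(** Rounding down to a multiple of 1/(n + 1). A continuous f is the pointwise limit of f composed
    with the rounding, which is constant on countably many rectangles. *)
Definition grid (n : nat) (t : R) : R := (Num.floor (n.+1%:R * t))%:~R / n.+1%:R.

Lemma grid_dist n t : `|t - grid n t| <= n.+1%:R^-1.
Proof.
have n0 : 0 < n.+1%:R :> R by rewrite ltr0n.
have /andP[h1 h2] := mem_rg1_floor (n.+1%:R * t).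
rewrite /grid; set z := (_)%:~R in h1 h2 *.
have -> : t - z / n.+1%:R = (n.+1%:R * t - z) / n.+1%:R.
  by rewrite mulrBl [_ * t]mulrC mulfK// gt_eqF.
rewrite normrM [X in _ * X]ger0_norm ?invr_ge0 ?ler0n//.
rewrite -[leRHS]mul1r ler_wpM2r ?invr_ge0 ?ler0n// ger0_norm ?subr_ge0//.
by rewrite lerBlDr addrC ltW.
Qed.

Lemma grid_cvg t : (fun n => grid n t) @ \oo --> t.
Proof.
apply/cvgrPdist_le => e e0.
have /cvgrPdist_le/(_ _ e0)[N _ HN] := @cvg_harmonic R.
exists N => // n /= Nn; apply: le_trans (grid_dist n t) _.
by have := HN n Nn; rewrite sub0r normrN ger0_norm ?invr_ge0.
Qed.

Lemma grid_pair_cvg (a b : R) :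
  (fun n => (grid n a, grid n b)) @ \oo --> ((a, b) : R * R).
Proof.
apply/cvg_ballP => e e0.
have /cvg_ballP/(_ _ e0) ha := @grid_cvg a.
have /cvg_ballP/(_ _ e0) hb := @grid_cvg b.
by apply: filterS2 ha hb => n; split.
Qed.

(** Nothing is asked of f: each preimage is a countable union of products of half-open strips. *)
Lemma measurable_grid_comp n (f : R * R -> R) :
  measurable_fun setT ((fun x => f (grid n x.1, grid n x.2)) : T2 -> R).
Proof.
move=> _ B mB; rewrite setTI.
pose strip (i : int) : set T1 := [set t | Num.floor (n.+1%:R * t) = i].
have mstrip i : measurable (strip i).
  have n0 : 0 < n.+1%:R :> R by rewrite ltr0n.
  rewrite (_ : strip i = `[i%:~R / n.+1%:R, (i + 1)%:~R / n.+1%:R[%classic).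
    exact: measurable_itv.
  apply/seteqP; split => t; rewrite /strip /= in_itv/= ler_pdivrMr// ltr_pdivlMr//.
    move=> <-; rewrite [t * _]mulrC; have := mem_rg1_floor (n.+1%:R * t).
    by rewrite /= intrD.
  rewrite [t * _]mulrC => ti; apply: floor_def.
  by move: ti; rewrite intrD.
pose val (k : int * int) : R := f (k.1%:~R / n.+1%:R, k.2%:~R / n.+1%:R).
rewrite (_ : _ @^-1` B = \bigcup_(k : int * int) (if val k \in B then
    strip k.1 `*` strip k.2 else set0)).
  apply: countable_bigcupT_measurable; first exact: countableP.
  by move=> k; case: ifP => // _; apply: measurableX.
apply/seteqP; split => [x /= Bx|x [k _]].
  exists (Num.floor (n.+1%:R * x.1), Num.floor (n.+1%:R * x.2)) => //.
  by rewrite /val /= mem_set.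
by case: ifPn => // /set_mem kB [i1 i2]; rewrite /grid /= i1 i2.
Qed.

Lemma continuous_measurable2 (f : R * R -> R) :
  continuous f -> measurable_fun setT (f : T2 -> R).
Proof.
move=> cf; apply: (measurable_fun_cvg (h := fun n x => f (grid n x.1, grid n x.2))).
  by move=> n; exact: measurable_grid_comp.
move=> [a b] _ /=; have := @grid_pair_cvg a b.
by move=> /(continuous_cvg _ (cf (a, b))).
Qed.

Lemma dotp_continuous (k : R * R) : continuous (dotp k : R * R -> R).
Proof.
move=> x; rewrite /dotp; apply: cvgD; apply: cvgMr; [exact: cvg_fst|exact: cvg_snd].
Qed.

Lemma cos_dotp_continuous (k : R * R) (c : R) : continuous (fun x : R * R => cos (dotp k x + c)).
Proof.
move=> x; apply: (continuous_comp (f := fun x => dotp k x + c)).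
  by apply: cvgD; [exact: dotp_continuous|exact: cvg_cst].
exact: continuous_cos.
Qed.

Lemma sin_dotp_continuous (k : R * R) (c : R) : continuous (fun x : R * R => sin (dotp k x + c)).
Proof.
move=> x; apply: (continuous_comp (f := fun x => dotp k x + c)).
  by apply: cvgD; [exact: dotp_continuous|exact: cvg_cst].
exact: continuous_sin.
Qed.

Lemma dotpDr (k x y : R * R) : dotp k (x + y) = dotp k x + dotp k y.
Proof. by rewrite /dotp /= ; ring. Qed.

Lemma dotpNr (k x : R * R) : dotp k (- x) = - dotp k x.
Proof. by rewrite /dotp /=; ring. Qed.

Lemma dotpNl (k x : R * R) : dotp (- k) x = - dotp k x.
Proof. by rewrite /dotp /=; ring. Qed.

Lemma dotpDl (k l x : R * R) : dotp (k + l) x = dotp k x + dotp l x.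
Proof. by rewrite /dotp /=; ring. Qed.

Lemma latticeD (k l : int * int) : lattice (k + l) = lattice k + lattice l :> R * R.
Proof. by rewrite /lattice /= !intrD. Qed.

Lemma latticeN (k : int * int) : lattice (- k) = - lattice k :> R * R.
Proof. by rewrite /lattice /= !mulrNz. Qed.

Lemma lattice0 : lattice 0 = 0 :> R * R.
Proof. by []. Qed.

Lemma measurable_cos_dotp (k : R * R) (c : R) :
  measurable_fun setT ((fun x => cos (dotp k x + c)) : T2 -> R).
Proof. exact: (continuous_measurable2 (@cos_dotp_continuous k c)). Qed.

Lemma measurable_sin_dotp (k : R * R) (c : R) :
  measurable_fun setT ((fun x => sin (dotp k x + c)) : T2 -> R).
Proof. exact: (continuous_measurable2 (@sin_dotp_continuous k c)). Qed.

End plane_measurability.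

Section Rintegral_facts.
Context d (T : measurableType d) (R : realType) (mu : {measure set T -> \bar R}).

Lemma integrable_bigsum (I : Type) (s : seq I) (F : I -> T -> R) :
  (forall i, mu.-integrable setT (EFin \o F i)) ->
  mu.-integrable setT (EFin \o (fun x => \sum_(i <- s) F i x)).
Proof.
move=> iF; rewrite [X in integrable _ _ X](_ : _ =
    fun x => (\sum_(i <- s) (F i x)%:E)%E); first by apply: integrable_sum => // i _; exact: iF.
by apply/funext => x /=; rewrite sumEFin.
Qed.

Lemma Rintegral_bigsum (I : Type) (s : seq I) (F : I -> T -> R) :
  (forall i, mu.-integrable setT (EFin \o F i)) ->
  Rintegral mu setT (fun x => \sum_(i <- s) F i x) =
  \sum_(i <- s) Rintegral mu setT (F i).
Proof.
move=> iF; elim: s => [|i s IH].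
  rewrite big_nil (@eq_Rintegral _ _ _ _ _ (cst 0)); last by move=> x _; rewrite big_nil.
  by rewrite /Rintegral integral0.
rewrite big_cons -IH -RintegralD//; last exact: integrable_bigsum.
by apply: eq_Rintegral => x _; rewrite big_cons.
Qed.

Lemma integrable_mul_bounded (f g : T -> R) (M : R) :
  mu.-integrable setT (EFin \o f) -> measurable_fun setT g ->
  (forall x, `|g x| <= M) ->
  mu.-integrable setT (EFin \o (fun x => f x * g x)).
Proof.
move=> fi mg gM; have mf : measurable_fun setT f by apply/measurable_EFinP/(measurable_int mu).
apply: (@le_integrable _ _ _ _ _ measurableT _ (fun x => (M * `|f x|)%:E)) => //.
- by apply/measurable_EFinP; exact: measurable_funM.
- move=> x _; rewrite /= lee_fin normrM mulrC.
  apply: le_trans (ler_norm _); apply: ler_wpM2r => //.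
- under eq_fun do rewrite EFinM.
  by apply: integrableZl => //; exact: (integrable_abse fi).
Qed.

End Rintegral_facts.

(** * Periodicity of cosine and sine, real integrals over the circle *)

Section orthogonality.
Context {R : realType}.
Notation leb := (@lebesgue_measure R).
Notation T1 := (measurableTypeR R).
Notation T2 := (measurableTypeR R * measurableTypeR R)%type.

Lemma cos_add_2pi (t : R) (n : int) : cos (t + n%:~R * (2 * pi)) = cos t.
Proof.
have H2 s : cos (s + 2 * pi) = cos s :> R by rewrite mulr_natl cosD2pi.
have H m s : cos (s + m%:R * (2 * pi)) = cos s :> R.
  elim: m s => [|m IH] s; first by rewrite mul0r addr0.
  by rewrite -natr1 mulrDl mul1r addrA H2 IH.
case: n => n; first exact: H.
rewrite NegzE mulrNz mulNr -[in RHS](subrK (n.+1%:R * (2 * pi)) t).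
by rewrite -[LHS](H n.+1).
Qed.

Lemma sin_add_2pi (t : R) (n : int) : sin (t + n%:~R * (2 * pi)) = sin t.
Proof.
by rewrite -[LHS]cosBpihalf addrAC cos_add_2pi cosBpihalf.
Qed.

Lemma Rintegral_circ (f : T1 -> R) M : measurable_fun setT f ->
  (forall t, `|f t| <= M) ->
  Rintegral circ setT f = (2 * pi)^-1 * Rintegral leb `[0, 2 * pi] f.
Proof.
move=> mf fM.
have mf' : measurable_fun setT (EFin \o f) by exact/measurable_EFinP.
have bnd (g : T1 -> \bar R) : measurable_fun setT g -> (forall t, 0 <= g t)%E ->
    (forall t, g t <= M%:E)%E ->
    (\int[leb]_(t in `[0%R, (2 * pi)%R]) g t)%E \is a fin_num.
  move=> mg g0 gM; rewrite ge0_fin_numE ?integral_ge0//.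
  apply: (@le_lt_trans _ _ (\int[leb]_(t in `[0%R, (2 * pi)%R]) (cst M%:E) t)%E).
    by apply: ge0_le_integral => //; exact: measurable_funTS.
  rewrite integral_cst// [X in (_ * X)%E](_ : _ = (2 * pi)%:E) -?EFinM ?ltry//.
  have := @lebesgue_measure_itv R `[0, 2 * pi]; rewrite /= lte_fin two_pi_gt0 => ->.
  by rewrite -EFinB subr0.
have fp : (\int[leb]_(t in `[0%R, (2 * pi)%R]) (EFin \o f)^\+ t)%E \is a fin_num.
  apply: bnd => //; first exact: measurable_funepos.
  move=> t; rewrite funeposE ge_max /= !lee_fin.
  have := fM t; rewrite ler_norml => /andP[h1 h2]; apply/andP; split; first lra.
  exact: le_trans (fM t).
have fn : (\int[leb]_(t in `[0%R, (2 * pi)%R]) (EFin \o f)^\- t)%E \is a fin_num.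
  apply: bnd => //; first exact: measurable_funeneg.
  move=> t; rewrite funenegE ge_max /= !lee_fin.
  have := fM t; rewrite ler_norml => /andP[h1 h2]; apply/andP; split; first lra.
  exact: le_trans (fM t).
rewrite /Rintegral integralE [in RHS]integralE.
rewrite !integral_uniform//; [|exact: measurable_funeneg|exact: measurable_funepos].
rewrite subr0 -muleBr//; last by rewrite fin_num_adde_defl// fin_numN.
by rewrite fineM// fin_numB; apply/andP.
Qed.

End orthogonality.

(** * Fourier inversion by Fejer means *)

Section fundamental_theorem.
Context {R : realType}.
Notation leb := (@lebesgue_measure R).
Notation T1 := (measurableTypeR R).
Notation T2 := (measurableTypeR R * measurableTypeR R)%type.

Lemma is_derive_continuous (F : R -> R) (x d : R) : is_derive x 1 F d -> {for x, continuous F}.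
Proof. by case=> dF _; apply/differentiable_continuous/derivable1_diffP. Qed.

Lemma FTC_itv (F f : R -> R) (a b : R) : a < b -> continuous f ->
  (forall t : R, is_derive t 1 F (f t)) ->
  Rintegral leb `[a, b] f = F b - F a.
Proof.
move=> ab cf dF.
have cF : continuous F by move=> t; exact: is_derive_continuous.
rewrite /Rintegral (@continuous_FTC2 _ f F)//.
- exact: continuous_subspaceT.
- split; first by move=> t _; exact: ex_derive.
  + by apply: cvg_at_right_filter; exact: cF.
  + by apply: cvg_at_left_filter; exact: cF.
- by move=> t _; rewrite derive1E derive_val.
Qed.

Lemma is_derive_lin (r c t : R) : is_derive t 1 (fun t : R => r * t + c) r.
Proof.
have -> : (fun t : R => r * t + c) = (r \*: id) + cst c by [].
by apply: is_derive_eq; rewrite addr0 /GRing.scale/= mulr1.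
Qed.

Lemma is_derive_cos_lin (r c t : R) :
  is_derive t 1 (fun t : R => cos (r * t + c)) (- sin (r * t + c) * r).
Proof.
have := is_derive_lin r c t.
exact: (@is_derive1_comp _ cos (fun t => r * t + c) t _ _ (is_derive_cos _)).
Qed.

Lemma is_derive_sin_lin (r c t : R) :
  is_derive t 1 (fun t : R => sin (r * t + c)) (cos (r * t + c) * r).
Proof.
have := is_derive_lin r c t.
exact: (@is_derive1_comp _ sin (fun t => r * t + c) t _ _ (is_derive_sin _)).
Qed.

(** Integration by parts with the boundary terms kept: over a period they cancel, and for compact
    support they vanish. *)
Lemma Rintegral_parts_cos (g g' : R -> R) (r c a b : R) : a < b ->
  (forall t : R, is_derive t 1 g (g' t)) -> continuous g' ->
  Rintegral leb `[a, b] (fun t => g' t * cos (r * t + c) - r * (g t * sin (r * t + c))) =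
  g b * cos (r * b + c) - g a * cos (r * a + c).
Proof.
move=> ab dg cg'.
have cg t : {for t, continuous g} by exact: is_derive_continuous.
have cc t : {for t, continuous (fun t : R => cos (r * t + c))}.
  exact: (is_derive_continuous (is_derive_cos_lin r c t)).
have cs t : {for t, continuous (fun t : R => sin (r * t + c))}.
  exact: (is_derive_continuous (is_derive_sin_lin r c t)).
apply: (@FTC_itv (g * (fun t => cos (r * t + c)))) => //.
- move=> t; apply: cvgB; first by apply: cvgM; [exact: cg'|exact: cc].
  by apply: cvgMr; apply: cvgM; [exact: cg|exact: cs].
- move=> t; apply: (is_derive_eq (is_deriveM (dg t) (is_derive_cos_lin r c t))).
  change (g t * (- sin (r * t + c) * r) + cos (r * t + c) * g' t =
    g' t * cos (r * t + c) - r * (g t * sin (r * t + c))); ring.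
Qed.

Lemma Rintegral_circ_cos (n : int) (c : R) :
  Rintegral circ setT (fun t => cos (n%:~R * t + c)) = (n == 0)%:R * cos c.
Proof.
have [->|n0] := eqVneq n 0.
  rewrite (@eq_Rintegral _ _ _ _ _ (cst (cos c))); last by move=> t _; rewrite mul0r add0r.
  by rewrite Rintegral_cst// [X in _ * fine X](_ : _ = 1%E) ?mulr1 ?mul1r//; exact: circ_setT.
have cc : continuous (fun t : R => cos (n%:~R * t + c)).
  by move=> t; exact: (is_derive_continuous (is_derive_cos_lin _ _ t)).
rewrite (@Rintegral_circ _ _ 1); last 2 first.
- exact: continuous_measurable_fun.
- by move=> t; rewrite ler_norml cos_geN1 cos_le1.
have nR : n%:~R != 0 :> R by rewrite intr_eq0.
have dF (t : R) : is_derive t 1 (n%:~R^-1 \*: (fun t : R => sin (n%:~R * t + c)))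
    (cos (n%:~R * t + c)).
  have d2 := is_derive_sin_lin n%:~R c t.
  by apply: (is_derive_eq (is_deriveZ n%:~R^-1 d2)); rewrite /GRing.scale/=; field.
rewrite mul0r (FTC_itv two_pi_gt0 cc dF) /= mulr0 add0r.
by rewrite [n%:~R * _ + c]addrC sin_add_2pi subrr mulr0.
Qed.

Lemma cos_norm_le1 (t : R) : `|cos t| <= 1.
Proof. by rewrite ler_norml cos_geN1 cos_le1. Qed.

Lemma sin_norm_le1 (t : R) : `|sin t| <= 1.
Proof. by rewrite ler_norml sin_geN1 sin_le1. Qed.

(** The free phase c makes this cover the sine as well. *)
Lemma Rintegral_haar_cos (k : int * int) (c : R) :
  Rintegral (haar R) setT (fun y => cos (dotp (lattice k) y + c)) = (k == 0)%:R * cos c.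
Proof.
rewrite (@Rintegral_haar1 _ _ 1); last 2 first.
- exact: measurable_cos_dotp.
- by move=> y; exact: cos_norm_le1.
transitivity (Rintegral circ setT (fun x => (k.2 == 0)%:R * cos (k.1%:~R * x + c))).
  apply: eq_Rintegral => x _; rewrite -Rintegral_circ_cos; apply: eq_Rintegral => y _.
  by rewrite /dotp /= addrA [_ + k.2%:~R * y]addrC.
rewrite RintegralZl//; last first.
  apply: (bounded_integrable_circ (M := 1)); last by move=> ?; exact: cos_norm_le1.
  apply: continuous_measurable_fun => t.
  exact: (is_derive_continuous (is_derive_cos_lin _ _ t)).
rewrite Rintegral_circ_cos mulrA -natrM mulnb andbC.
by case: k => a b.
Qed.

End fundamental_theorem.

(** * Fejer kernels and the convergence of Fejer means *)

Section fejer.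
Context {R : realType}.
Notation T2 := (measurableTypeR R * measurableTypeR R)%type.

(* The real part of \hat f(k) e^{ik.x}; for real f the imaginary parts at k and
   -k cancel, so that these modes still sum up to f. *)
Definition fmode (k : int * int) (f : R * R -> R) (x : R * R) : R :=
  Rintegral (haar R) setT (fun y => f y * cos (dotp (lattice k) (x - y))).

(** The squared modulus of the sum of e^{int} over n < N, that is N times the Fejer kernel. Its mean
    over a period is N, not 1, so the means below carry a factor N^{-2}. *)
Definition fejer (N : nat) (t : R) : R :=
  (\sum_(n < N) cos (n%:R * t)) ^+ 2 + (\sum_(n < N) sin (n%:R * t)) ^+ 2.

Lemma fejer_ge0 N t : 0 <= fejer N t.
Proof. by rewrite addr_ge0 ?sqr_ge0. Qed.

Lemma fejerE N t : fejer N t = \sum_(n < N) \sum_(m < N) cos ((m%:R - n%:R) * t).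
Proof.
rewrite /fejer !expr2 !mulr_suml -big_split /=; apply: eq_bigr => n _.
rewrite !mulr_sumr -big_split /=; apply: eq_bigr => m _.
by rewrite mulrBl cosB; ring.
Qed.

Lemma sin_antisym N t : \sum_(n < N) \sum_(m < N) sin ((m%:R - n%:R) * t) = 0 :> R.
Proof.
set s := LHS; suff : s = - s by move=> ?; lra.
rewrite {1}/s exchange_big /= -sumrN; apply: eq_bigr => n _.
rewrite -sumrN; apply: eq_bigr => m _.
by rewrite -sinN -mulNr opprB.
Qed.

(* With S = \sum_(n < N) e^{int}, this is |1 - e^{it}|^2 |S|^2 = |1 - e^{iNt}|^2. *)
Lemma fejer_off_diagonal N t : fejer N t * (1 - cos t) = 1 - cos (N%:R * t).
Proof.
set A := \sum_(n < N) cos (n%:R * t); set B := \sum_(n < N) sin (n%:R * t).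
(* Real and imaginary parts of the geometric sum identity S (1 - e^{it}) = 1 - e^{iNt}, with S = A +
   iB. *)
have H : A * (1 - cos t) + B * sin t = 1 - cos (N%:R * t) /\
    B * (1 - cos t) - A * sin t = - sin (N%:R * t).
  rewrite /A /B; elim: N {A B} => [|N [IH1 IH2]].
    by rewrite !big_ord0 !mul0r cos0 sin0; split; ring.
  have -> : N.+1%:R * t = N%:R * t + t by rewrite -natr1 mulrDl mul1r.
    rewrite !big_ord_recr /= cosD sinD; split.
  - by rewrite !mulrDl addrACA IH1; ring.
  - by rewrite !mulrDl opprD addrACA IH2; ring.
have := cos2Dsin2 t; have := cos2Dsin2 (N%:R * t).
have [H1 H2] := H; rewrite /fejer -/A -/B => e1 e2.
have : (A * (1 - cos t) + B * sin t) ^+ 2 + (B * (1 - cos t) - A * sin t) ^+ 2 =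
  (1 - cos (N%:R * t)) ^+ 2 + (- sin (N%:R * t)) ^+ 2 by rewrite H1 H2.
move: (cos t) (sin t) (cos (N%:R * t)) (sin (N%:R * t)) e1 e2 => c s cN sN e1 e2 e3.
have : (A ^+ 2 + B ^+ 2) * ((1 - c) ^+ 2 + s ^+ 2) = (1 - cN) ^+ 2 + sN ^+ 2.
  by rewrite -[sN ^+ 2]sqrrN -e3; ring.
have -> : sN ^+ 2 = 1 - cN ^+ 2 by lra.
have -> : s ^+ 2 = 1 - c ^+ 2 by lra.
have -> : (1 - c) ^+ 2 + (1 - c ^+ 2) = 2 * (1 - c) by ring.
have -> : (1 - cN) ^+ 2 + (1 - cN ^+ 2) = 2 * (1 - cN) by ring.
move=> h; lra.
Qed.

Lemma fejer_off_diagonal_le N t : fejer N t * (1 - cos t) <= 2.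
Proof. by rewrite fejer_off_diagonal; have := cos_geN1 (N%:R * t); lra. Qed.

(** Expanding the cosine of the sum also yields products of sines; these add up to 0 because the
    sine is antisymmetric under the exchange of m and n. *)
Lemma fejer2E N a b : fejer N a * fejer N b =
  \sum_(n < N) \sum_(m < N) \sum_(n' < N) \sum_(m' < N)
    cos ((m%:R - n%:R) * a + (m'%:R - n'%:R) * b).
Proof.
under [RHS]eq_bigr do under eq_bigr do under eq_bigr do under eq_bigr do rewrite cosD.
transitivity (\sum_(n < N) \sum_(m < N) (cos ((m%:R - n%:R) * a) * fejer N b)).
  by rewrite fejerE mulr_suml; apply: eq_bigr => n _; rewrite mulr_suml.
apply: eq_bigr => n _; apply: eq_bigr => m _.
under eq_bigr do rewrite sumrB.
rewrite sumrB; under eq_bigr do rewrite -mulr_sumr.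
rewrite -mulr_sumr -fejerE; under [X in _ = _ - X]eq_bigr do rewrite -mulr_sumr.
by rewrite -mulr_sumr sin_antisym mulr0 subr0.
Qed.

Definition fejer2 (N : nat) (z : R * R) : R := fejer N z.1 * fejer N z.2.

(** The square [0, N)^2 translated by -n. Writing the Fejer kernel as a sum over n of plain sums
    over windows replaces the triangular coefficients by a counting of windows. *)
Definition window (N : nat) (n : nat * nat) : seq (int * int) :=
  [seq ((m.1%:Z - n.1%:Z, m.2%:Z - n.2%:Z) : int * int) |
     m <- [seq (a, b) | a <- iota 0 N, b <- iota 0 N]].

Definition square (N : nat) : seq (nat * nat) :=
  [seq (a, b) | a <- iota 0 N, b <- iota 0 N].

Lemma window_uniq N n : uniq (window N n).
Proof.
rewrite map_inj_uniq; first by apply: allpairs_uniq; rewrite ?iota_uniq// => -[? ?] [].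
by move=> [a b] [c d] /= [] /addIr [->] /addIr [->].
Qed.

Lemma fejer2_window N z : fejer2 N z =
  \sum_(n <- square N) \sum_(k <- window N n) cos (dotp (lattice k) z).
Proof.
rewrite /fejer2 fejer2E /square big_allpairs_dep /=.
rewrite -[X in iota 0 X]subn0 -/(index_iota 0 N) big_mkord; apply: eq_bigr => n _.
rewrite big_mkord exchange_big; apply: eq_bigr => n' _ /=.
rewrite /window big_map big_allpairs_dep /=.
rewrite -[X in iota 0 X]subn0 -/(index_iota 0 N) big_mkord; apply: eq_bigr => m _.
rewrite big_mkord; apply: eq_bigr => m' _ /=.
by rewrite /dotp /lattice /= !rmorphB /= !pmulrn.
Qed.

(** If n is at distance at least M from the border of the square, then n + k stays in [0, N)^2 for
    every k in the box, and n + k is the required witness. *)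
Lemma window_box M N n : (M <= n.1)%N -> (n.1 + M < N)%N -> (M <= n.2)%N ->
  (n.2 + M < N)%N -> {subset box M <= window N n}.
Proof.
case: n => [n n'] /= h1 h2 h3 h4 [k k']; rewrite mem_box /= => /andP[kM kM'].
apply/mapP; exists (absz (n%:Z + k), absz (n'%:Z + k')); last by congr (_, _) => /=; lia.
by apply/allpairsP; exists (absz (n%:Z + k), absz (n'%:Z + k')); split; rewrite //= mem_iota; lia.
Qed.

Lemma sum_lt_le (M N : nat) : (\sum_(i < N) (i < M) <= M)%N.
Proof.
suff : (\sum_(i < N) (i < M) <= minn M N)%N by move/leq_trans; apply; exact: geq_minl.
elim: N => [|N IH]; first by rewrite big_ord0.
by rewrite big_ord_recr /=; move: (\sum_(i < N) (i < M))%N IH => s IH; case: (ltnP N M) => h /=; lia.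
Qed.

Lemma sum_ge_le (M N : nat) : (\sum_(i < N) (N <= i + M) <= M)%N.
Proof.
have H c : (\sum_(i < N) (c <= i) <= N - c)%N.
  elim: N => [|N IH]; first by rewrite big_ord0.
  by rewrite big_ord_recr /=; move: (\sum_(i < N) (c <= i))%N IH => s IH; case: (leqP c N) => h /=; lia.
apply: (@leq_trans (N - (N - M))); last lia.
by apply: leq_trans (H (N - M)%N); apply: leq_sum => i _; lia.
Qed.

Lemma sum_square (f : nat -> nat -> R) N :
  \sum_(n <- square N) f n.1 n.2 = \sum_(i < N) \sum_(j < N) f i j.
Proof.
rewrite /square big_allpairs_dep /= -[X in iota 0 X]subn0 -/(index_iota 0 N).
by rewrite big_mkord; apply: eq_bigr => i _; rewrite big_mkord.
Qed.

(** A window containing [box M] has a sum within eps/2 of the limit. The others have n within M of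
    the border of the square; there are O(M N) of them among N^2, each with an error at most B. *)
Lemma window_mean (e : int * int -> R) : lsummable e -> forall eps : R, 0 < eps ->
  exists N0, forall N, (N0 <= N)%N ->
  `|(N%:R ^- 2) * (\sum_(n <- square N) \sum_(k <- window N n) e k) - lsum e| <= eps.
Proof.
move=> se eps eps0; have eps20 : 0 < eps / 2 by lra.
have [M HM] := lsum_net se eps20; have [B0 HB0] := se.
pose B := B0 + `|lsum e|.
have HB A : uniq A -> `|\sum_(k <- A) e k - lsum e| <= B.
  move=> uA; apply: le_trans (ler_normB _ _) _; rewrite lerD2r.
  exact: le_trans (ler_norm_sum _ _ _) (HB0 A uA).
have B_ge0 : 0 <= B by apply: le_trans (HB [::] _).
(* Counts the ends of [0, N) to which the index is too close. Its sum over the indices is at most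
   2M, which gives the 4 B M N of the total error. *)
pose bad N n : R := ((n < M)%N + (N <= n + M)%N)%:R.
have key N n : n \in square N ->
    `|\sum_(k <- window N n) e k - lsum e| <= eps / 2 + B * (bad N n.1 + bad N n.2).
  move=> nN; have [/and4P[a b c d]|nbad] :=
      boolP [&& M <= n.1, n.1 + M < N, M <= n.2 & n.2 + M < N]%N.
    apply: (@le_trans _ _ (eps / 2)).
      by apply: HM; [exact: window_uniq|exact: window_box].
    by rewrite lerDl mulr_ge0// addr_ge0// /bad ler0n.
  apply: le_trans (HB _ (window_uniq N n)) _.
  apply: (@le_trans _ _ (B * (bad N n.1 + bad N n.2))); last by rewrite lerDr ltW.
  rewrite ler_peMr// /bad -natrD ler1n; move: nbad; lia.
have sumbad N : \sum_(n < N) bad N n <= (M + M)%:R.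
  rewrite -natr_sum ler_nat big_split /=.
  by apply: leq_add; [exact: sum_lt_le|exact: sum_ge_le].
have total N : \sum_(n <- square N) `|\sum_(k <- window N n) e k - lsum e| <=
    N%:R ^+ 2 * (eps / 2) + 4 * B * M%:R * N%:R.
  apply: (@le_trans _ _ (\sum_(n <- square N) (eps / 2 + B * (bad N n.1 + bad N n.2)))).
    by rewrite big_seq [leRHS]big_seq; apply: ler_sum => n; exact: key.
  rewrite (sum_square (fun i j => eps / 2 + B * (bad N i + bad N j))).
  have := sumbad N; rewrite natrD; set b := \sum_(n < N) bad N n => hb.
  rewrite (eq_bigr (fun i : 'I_N => N%:R * (eps / 2 + B * bad N i) + B * b)); last first.
    move=> i _; rewrite (eq_bigr (fun j : 'I_N => (eps / 2 + B * bad N i) + B * bad N j)).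
      by rewrite big_split /= sumr_const card_ord -mulr_sumr mulr_natl.
    by move=> j _; rewrite mulrDr addrA.
  rewrite big_split /= sumr_const card_ord -mulr_sumr big_split /= sumr_const card_ord.
  rewrite -mulr_sumr -/b -[eps / 2 *+ N]mulr_natl -[B * b *+ N]mulr_natl.
  have -> : N%:R * (N%:R * (eps / 2) + B * b) + N%:R * (B * b) =
     N%:R ^+ 2 * (eps / 2) + 2 * B * N%:R * b by ring.
  rewrite lerD2l.
  have -> : 4 * B * M%:R * N%:R = 2 * B * N%:R * (M%:R + M%:R) by ring.
  by apply: ler_wpM2l => //; rewrite !mulr_ge0.
pose c := 4 * B * M%:R.
have c0 : 0 <= c by rewrite !mulr_ge0.
(* Beyond this N the linear term c N is at most N^2 eps/2. *)
exists (Num.truncn (c / (eps / 2))).+1 => N HN.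
have N0 : 0 < N%:R :> R by rewrite ltr0n; exact: leq_ltn_trans HN.
have NN0 : N%:R ^+ 2 != 0 :> R by rewrite expf_neq0 ?gt_eqF.
have -> : lsum e = N%:R ^- 2 * \sum_(n <- square N) lsum e.
  rewrite big_const_seq count_predT size_allpairs size_iota iter_addr_0.
  by rewrite -[lsum e *+ _]mulr_natl natrM -expr2 mulrA mulVf ?mul1r.
rewrite -mulrBr -sumrB normrM ger0_norm ?invr_ge0 ?sqr_ge0//.
rewrite ler_pdivrMl ?exprn_gt0//.
apply: le_trans (ler_norm_sum _ _ _) _; apply: le_trans (total N) _.
have -> : N%:R ^+ 2 * eps = N%:R ^+ 2 * (eps / 2) + N%:R * (N%:R * (eps / 2)) by field.
rewrite lerD2l -/c mulrC; apply: ler_wpM2l; first exact: ltW.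
rewrite -ler_pdivrMr//; apply/ltW; apply: lt_le_trans (truncnS_gt _) _.
by rewrite ler_nat.
Qed.

Lemma measurable_fmode_kernel (k : int * int) (x : R * R) :
  measurable_fun setT ((fun y => cos (dotp (lattice k) (x - y))) : T2 -> R).
Proof.
have := @measurable_cos_dotp R (- lattice k) (dotp (lattice k) x).
by congr measurable_fun; apply/funext => y; rewrite dotpDr dotpNl dotpNr addrC.
Qed.

Lemma integrable_fmode (f : T2 -> R) k x : (haar R).-integrable setT (EFin \o f) ->
  (haar R).-integrable setT (EFin \o (fun y => f y * cos (dotp (lattice k) (x - y)))).
Proof.
move=> fi; apply: (integrable_mul_bounded (M := 1)) => //.
- exact: measurable_fmode_kernel.
- by move=> y; exact: cos_norm_le1.
Qed.

Lemma fmode_fejer (f : T2 -> R) N x : (haar R).-integrable setT (EFin \o f) ->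
  Rintegral (haar R) setT (fun y => f y * fejer2 N (x - y)) =
  \sum_(n <- square N) \sum_(k <- window N n) fmode k f x.
Proof.
move=> fi; transitivity (Rintegral (haar R) setT (fun y => \sum_(n <- square N)
    \sum_(k <- window N n) (f y * cos (dotp (lattice k) (x - y))))).
  apply: eq_Rintegral => y _; rewrite fejer2_window mulr_sumr.
  by apply: eq_bigr => n _; rewrite mulr_sumr.
rewrite Rintegral_bigsum; last first.
  by move=> n; apply: integrable_bigsum => k; exact: integrable_fmode.
apply: eq_bigr => n _; rewrite Rintegral_bigsum// => k.
exact: integrable_fmode.
Qed.

Lemma integrable_cst_haar (c : R) : (haar R).-integrable setT (EFin \o (cst c : T2 -> R)).
Proof. exact: (bounded_integrable (M := `|c|)). Qed.

Lemma fmode1 k x : fmode k (cst 1) x = (k == 0)%:R.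
Proof.
transitivity (Rintegral (haar R) setT
    (fun y => cos (dotp (lattice (- k)) y + dotp (lattice k) x))).
  by apply: eq_Rintegral => y _; rewrite mul1r dotpDr dotpNr latticeN dotpNl addrC.
rewrite Rintegral_haar_cos oppr_eq0.
by case: eqVneq => [->|_]; rewrite ?mul0r// lattice0 /dotp /= !mul0r addr0 cos0 mulr1.
Qed.

Lemma integrable_fejer2 N x : (haar R).-integrable setT (EFin \o (fun y : T2 => fejer2 N (x - y))).
Proof.
rewrite (_ : (fun y => _) = (fun y => \sum_(n <- square N)
    \sum_(k <- window N n) (cst 1 y * cos (dotp (lattice k) (x - y))))).
  apply: integrable_bigsum => n; apply: integrable_bigsum => k; apply: integrable_fmode.
  exact: integrable_cst_haar.
apply/funext => y; rewrite fejer2_window; apply: eq_bigr => n _.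
by apply: eq_bigr => k _; rewrite mul1r.
Qed.

(** Only the mode k = 0 has a nonzero mean, and each of the N^2 windows contains it once. *)
Lemma fejer2_mass N x : Rintegral (haar R) setT (fun y => fejer2 N (x - y)) = N%:R ^+ 2.
Proof.
transitivity (Rintegral (haar R) setT (fun y => cst 1 y * fejer2 N (x - y))).
  by apply: eq_Rintegral => y _; rewrite mul1r.
rewrite fmode_fejer; last exact: integrable_cst_haar.
under eq_bigr do under eq_bigr do rewrite fmode1.
transitivity (\sum_(n <- square N) 1 : R).
  rewrite big_seq [RHS]big_seq; apply: eq_bigr => n nN.
  rewrite (bigD1_seq 0) ?window_uniq//=; last first.
    by apply/mapP; exists n => //; rewrite !subrr.
  by rewrite big1 ?addr0// => k /negbTE ->.
rewrite big_const_seq count_predT size_allpairs size_iota iter_addr_0.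
by rewrite -[1 *+ _]/(_%:R) natrM expr2.
Qed.

Lemma measurable_fejer2 N x : measurable_fun setT ((fun y => fejer2 N (x - y)) : T2 -> R).
Proof.
exact: (iffLR (measurable_EFinP _ _) (measurable_int (haar R) (integrable_fejer2 N x))).
Qed.

(** The one-variable kernel in the coordinate selected by j, treated through frequencies with the
    other coordinate 0. It is what remains of [fejer2] once a factor 1 - cos has absorbed the kernel
    of the other variable. *)
Lemma fejer_axis (N : nat) (j : bool) (x : R * R) :
  let p := fun z : R * R => if j then z.1 else z.2 in
  (haar R).-integrable setT (EFin \o (fun y : T2 => fejer N (p (x - y)))) /\
  Rintegral (haar R) setT (fun y => fejer N (p (x - y))) = N%:R.
Proof.
move=> p; pose k (n m : nat) : int * int :=
  if j then (m%:Z - n%:Z, 0) else (0, m%:Z - n%:Z).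
have E y : fejer N (p (x - y)) =
    \sum_(n <- iota 0 N) \sum_(m <- iota 0 N) (cst 1 y * cos (dotp (lattice (k n m)) (x - y))).
  rewrite fejerE -[X in iota 0 X]subn0 -/(index_iota 0 N) big_mkord.
  apply: eq_bigr => n _; rewrite big_mkord; apply: eq_bigr => m _.
  rewrite mul1r /p /k /dotp /lattice; case: j {p k} => /=.
  - by rewrite mul0r addr0 rmorphB /= !pmulrn.
  - by rewrite mul0r add0r rmorphB /= !pmulrn.
have EE : (fun y : T2 => fejer N (p (x - y))) = (fun y : T2 => \sum_(n <- iota 0 N)
    \sum_(m <- iota 0 N) (cst 1 y * cos (dotp (lattice (k n m)) (x - y)))).
  by apply/funext => y; exact: E.
have I n m : (haar R).-integrable setT
    (EFin \o (fun y : T2 => cst 1 y * cos (dotp (lattice (k n m)) (x - y)))).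
  by apply: integrable_fmode; exact: integrable_cst_haar.
rewrite EE; split; first by apply: integrable_bigsum => n; apply: integrable_bigsum.
rewrite Rintegral_bigsum; last by move=> n; apply: integrable_bigsum.
rewrite (eq_bigr (fun n => \sum_(m <- iota 0 N) (m == n)%:R)); last first.
  move=> n _; rewrite Rintegral_bigsum//; apply: eq_bigr => m _.
  rewrite -/(fmode _ _ _) fmode1 /k; case: j {p k E EE I}; rewrite -pair_eqE /pair_eq/=;
  by rewrite ?andbT subr_eq0 eqz_nat.
transitivity (\sum_(n <- iota 0 N) 1 : R).
  rewrite big_seq [RHS]big_seq; apply: eq_bigr => n nN.
  rewrite (bigD1_seq n) ?iota_uniq//= eqxx big1 ?addr0// => m /negbTE ->//.
by rewrite big_const_seq count_predT size_iota iter_addr_0.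
Qed.

(** Each term M (1 - cos) consumes the kernel of its variable, by F_N(t) (1 - cos t) <= 2, and
    leaves a mass of order N instead of N^2. *)
Lemma cos_le_dist (N : nat) (x y : R * R) (a M : R) (d : R) : 0 <= M ->
  `|d| <= a + M * (1 - cos (x - y).1) + M * (1 - cos (x - y).2) ->
  `|d * fejer2 N (x - y)| <=
    a * fejer2 N (x - y) + 2 * M * (fejer N (x - y).1 + fejer N (x - y).2).
Proof.
move=> M0 dM; rewrite normrM [X in _ * X]ger0_norm; last by rewrite mulr_ge0 ?fejer_ge0.
apply: le_trans (ler_wpM2r _ dM) _; first by rewrite mulr_ge0 ?fejer_ge0.
rewrite /fejer2; set u := (x - y).1; set v := (x - y).2.
have h1 := fejer_off_diagonal_le N u; have h2 := fejer_off_diagonal_le N v.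
have p1 := fejer_ge0 N u; have p2 := fejer_ge0 N v.
move: (fejer N u) (fejer N v) (1 - cos u) (1 - cos v) h1 h2 p1 p2 => p q c c'.
move=> h1 h2 p1 p2.
have -> : (a + M * c + M * c') * (p * q) =
  a * (p * q) + (M * ((p * c) * q) + M * (p * (q * c'))) by ring.
have -> : 2 * M * (p + q) = M * (2 * q) + M * (p * 2) by ring.
rewrite lerD2l; apply: lerD; apply: ler_wpM2l => //; first exact: ler_wpM2r.
exact: ler_wpM2l.
Qed.

(* The Fejer means of f at x are averages of windows of the Fourier series, hence
   tend to its sum; they tend to f x since F_N(t) (1 - cos t) <= 2. *)
Lemma fourier_inversion (f : T2 -> R) (x : R * R) :
  (haar R).-integrable setT (EFin \o f) ->
  lsummable (fun k => fmode k f x) ->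
  (forall eps : R, 0 < eps -> exists2 M, 0 <= M & forall y : R * R,
     `|f y - f x| <= eps + M * (1 - cos (x - y).1) + M * (1 - cos (x - y).2)) ->
  lsum (fun k => fmode k f x) = f x.
Proof.
move=> fi sf loc; apply/eqP; rewrite -subr_eq0 -normr_eq0 eq_le normr_ge0 andbT.
apply/ler_addgt0Pl => eps eps0; rewrite addr0.
have e3 : 0 < eps / 3 by lra.
have [N0 HN0] := window_mean sf e3.
have [M M0 HM] := loc _ e3.
(* With N >= 4M/(eps/3) the remaining error 2M (N + N) is at most N^2 eps/3. *)
pose N := maxn N0 (Num.truncn (4 * M / (eps / 3))).+1.
have N1 : 0 < N%:R :> R by rewrite ltr0n /N; lia.
have := HN0 N (leq_maxl _ _); rewrite -fmode_fejer//.
set S := lsum _; set I := Rintegral _ _ _ => HI.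
suff : `|N%:R ^- 2 * I - f x| <= eps / 3 + eps / 3.
  by move: HI; rewrite !ler_norml => /andP[? ?] /andP[? ?]; apply/andP; split; lra.
have fF : (haar R).-integrable setT (EFin \o (fun y => f y * fejer2 N (x - y))).
  (* A crude bound for fixed N, from at most N terms of modulus 1 in each sum. *)
  apply: (integrable_mul_bounded (M := (N%:R ^+ 2 + N%:R ^+ 2) * (N%:R ^+ 2 + N%:R ^+ 2))) => //.
    exact: measurable_fejer2.
  have B t : `|fejer N t| <= N%:R ^+ 2 + N%:R ^+ 2.
    rewrite ger0_norm ?fejer_ge0// /fejer.
    have sq (a : R) : `|a| <= N%:R -> a ^+ 2 <= N%:R ^+ 2.
      by move=> aN; rewrite -[a ^+ 2]ger0_norm ?sqr_ge0// normrX ler_sqr ?nnegrE.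
    apply: lerD; apply: sq; apply: le_trans (ler_norm_sum _ _ _) _.
      apply: le_trans (_ : \sum_(i < N) 1 <= _).
        by apply: ler_sum => i _; exact: cos_norm_le1.
      by rewrite sumr_const card_ord.
    apply: le_trans (_ : \sum_(i < N) 1 <= _).
      by apply: ler_sum => i _; exact: sin_norm_le1.
    by rewrite sumr_const card_ord.
  by move=> y; rewrite normrM; apply: ler_pM.
have fxF : (haar R).-integrable setT (EFin \o (fun y : T2 => f x * fejer2 N (x - y))).
  under [X in integrable _ _ X]eq_fun do rewrite /= EFinM.
  by apply: integrableZl => //; exact: integrable_fejer2.
have -> : N%:R ^- 2 * I - f x =
    N%:R ^- 2 * Rintegral (haar R) setT (fun y => (f y - f x) * fejer2 N (x - y)).
  have -> : Rintegral (haar R) setT (fun y => (f y - f x) * fejer2 N (x - y)) =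
      I - f x * N%:R ^+ 2.
    rewrite -(fejer2_mass N x) -RintegralZl//; last exact: integrable_fejer2.
    by rewrite -RintegralB//; apply: eq_Rintegral => y _; rewrite mulrBl.
  by rewrite mulrBr; congr (_ - _); rewrite mulrCA mulVf ?mulr1// expf_neq0 ?gt_eqF.
rewrite normrM ger0_norm ?invr_ge0 ?sqr_ge0// ler_pdivrMl ?exprn_gt0//.
have [i1 m1] := fejer_axis N true x; have [i2 m2] := fejer_axis N false x.
have diffF : (haar R).-integrable setT (EFin \o (fun y => (f y - f x) * fejer2 N (x - y))).
  have -> : EFin \o (fun y => (f y - f x) * fejer2 N (x - y)) =
     ((EFin \o (fun y => (f y * fejer2 N (x - y))%R)) \-
      (EFin \o (fun y : T2 => (f x * fejer2 N (x - y))%R)))%E.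
    by apply/funext => y /=; rewrite -EFinB mulrBl.
  exact: integrableB.
have ZI (g : T2 -> R) c : (haar R).-integrable setT (EFin \o g) ->
    (haar R).-integrable setT (EFin \o (fun y => c * g y)).
  by move=> gi; under [X in integrable _ _ X]eq_fun do rewrite /= EFinM; exact: integrableZl.
have DI (g h : T2 -> R) : (haar R).-integrable setT (EFin \o g) ->
    (haar R).-integrable setT (EFin \o h) ->
    (haar R).-integrable setT (EFin \o (fun y => g y + h y)).
  by move=> gi hi; under [X in integrable _ _ X]eq_fun do rewrite /= EFinD; exact: integrableD.
have i12 := DI _ _ i1 i2; have F2 := integrable_fejer2 N x.
apply: le_trans (le_normr_Rintegral _ diffF) _ => //.
apply: (@le_trans _ _ (Rintegral (haar R) setT (fun y =>
   eps / 3 * fejer2 N (x - y) + 2 * M * (fejer N (x - y).1 + fejer N (x - y).2)))).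
  apply: le_Rintegral => //.
  - by have := integrable_abse diffF.
  - by apply: (DI (fun y => eps / 3 * fejer2 N (x - y))); exact: ZI.
  - by move=> y _; apply: cos_le_dist => //; exact: HM.
rewrite RintegralD//; [|exact: (ZI (fun y => fejer2 N (x - y)))|exact: (ZI _ _ i12)].
rewrite RintegralZl// (RintegralZl _ _ i12)// fejer2_mass (RintegralD _ i1 i2)//.
rewrite [X in _ * (X + _)]m1 [X in _ * (_ + X)]m2.
have -> : N%:R ^+ 2 * (eps / 3 + eps / 3) = eps / 3 * N%:R ^+ 2 + N%:R * (N%:R * (eps / 3)) by ring.
rewrite lerD2l.
have -> : 2 * M * (N%:R + N%:R) = N%:R * (4 * M) by ring.
apply: ler_wpM2l; first exact: ltW.
rewrite -ler_pdivrMr//; apply/ltW; apply: lt_le_trans (truncnS_gt _) _.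
by rewrite ler_nat leq_maxr.
Qed.

End fejer.

(** * Periodic continuous functions: boundedness and local control *)

Section periodic_functions.
Context {R : realType}.
Notation T1 := (measurableTypeR R).
Notation T2 := (measurableTypeR R * measurableTypeR R)%type.

Lemma fundamental_shift (t : R) : exists n : int, `|t + n%:~R * (2 * pi)| <= pi.
Proof.
have p0 := @two_pi_gt0 R; have pi0 := @pi_gt0 R.
have /andP[h1 h2] := mem_rg1_floor ((t + pi) / (2 * pi)).
exists (- Num.floor ((t + pi) / (2 * pi))); set z := Num.floor _ in h1 h2 *.
move: h1 h2; rewrite ler_pdivlMr// ltr_pdivrMr// mulrDl mul1r mulrNz mulNr => h1 h2.
by rewrite ler_norml; apply/andP; split; lra.
Qed.

Lemma periodic_shift {U : Type} (f : R * R -> U) (x : R * R) (m n : int) :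
  torus_periodic f -> f (x.1 + m%:~R * (2 * pi), x.2 + n%:~R * (2 * pi)) = f x.
Proof.
move=> pf; rewrite -(pf x (m, n)); congr f; rewrite /lattice /= /GRing.scale /=.
by rewrite -[RHS]/((_, _)) /=; congr (_, _); rewrite [_ * (2 * pi)]mulrC.
Qed.

(** Shifting y by the lattice brings both coordinates of x - y into [-pi, pi]. Either both are
    smaller than e and continuity at x applies, or one of them has 1 - cos >= 1 - cos e, and M =
    2B/(1 - cos e) makes its term exceed the trivial bound 2B. *)
Lemma periodic_local_bound (f : R * R -> R) (B : R) (x : R * R) :
  torus_periodic f -> (forall y, `|f y| <= B) -> {for x, continuous f} ->
  forall eps : R, 0 < eps -> exists2 M, 0 <= M & forall y : R * R,
     `|f y - f x| <= eps + M * (1 - cos (x - y).1) + M * (1 - cos (x - y).2).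
Proof.
move=> pf fB cf eps eps0.
have pi0 := @pi_gt0 R.
have /cvgrPdist_le/(_ _ eps0)/nbhs_ballP[d /= d0 Hd] := cf.
pose e := Num.min (d / 2) (pi / 2).
have e0 : 0 < e by rewrite lt_min !divr_gt0.
have ed : e < d by rewrite gt_min; apply/orP; left; lra.
have epi : e < pi by rewrite gt_min; apply/orP; right; lra.
have ce : cos e < 1.
  by rewrite -cos0 ltr_cos ?in_itv/= ?lexx ?ltW.
have B0 : 0 <= B by exact: le_trans (fB x).
pose M := 2 * B / (1 - cos e).
have M0 : 0 <= M by rewrite /M mulr_ge0 ?invr_ge0 ?mulr_ge0 ?subr_ge0// ltW.
have far t : e <= `|t| -> `|t| <= pi -> cos t <= cos e.
  move=> et tpi; have -> : cos t = cos `|t| by case: (ger0P t) => // _; rewrite cosN.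
  move: et; rewrite le_eqVlt => /orP[/eqP<-//|et]; apply/ltW.
  by rewrite ltr_cos// in_itv/= ?normr_ge0 ?(ltW epi) ?(ltW e0).
have c1 (t : R) : 0 <= 1 - cos t by rewrite subr_ge0 cos_le1.
exists M => // y0.
have [m hm] := fundamental_shift (y0.1 - x.1).
have [n hn] := fundamental_shift (y0.2 - x.2).
pose y : R * R := (y0.1 + m%:~R * (2 * pi), y0.2 + n%:~R * (2 * pi)).
have -> : f y0 = f y by rewrite /y periodic_shift.
have -> : cos (x - y0).1 = cos (x - y).1.
  rewrite -(cos_add_2pi (x - y0).1 (- m)); congr cos => /=.
  by rewrite mulrNz mulNr opprD addrA.
have -> : cos (x - y0).2 = cos (x - y).2.
  rewrite -(cos_add_2pi (x - y0).2 (- n)); congr cos => /=.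
  by rewrite mulrNz mulNr opprD addrA.
have u1 : `|(x - y).1| <= pi by rewrite distrC /= addrAC.
have u2 : `|(x - y).2| <= pi by rewrite distrC /= addrAC.
have t1 : 0 <= M * (1 - cos (x - y).1) by rewrite mulr_ge0.
have t2 : 0 <= M * (1 - cos (x - y).2) by rewrite mulr_ge0.
have big (t : R) : e <= `|t| -> `|t| <= pi -> 2 * B <= M * (1 - cos t).
  move=> h1 h2; apply: (@le_trans _ _ (M * (1 - cos e))).
    by rewrite /M mulfVK// subr_eq0 gt_eqF.
  by apply: ler_wpM2l => //; rewrite lerD2l lerN2; exact: far.
have f2B : `|f y - f x| <= 2 * B.
  by apply: le_trans (ler_normB _ _) _; rewrite mulr_natl mulr2n lerD.
have [n1|f1] := ltP `|(x - y).1| e; last by have := big _ f1 u1; lra.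
have [n2|f2] := ltP `|(x - y).2| e; last by have := big _ f2 u2; lra.
have : `|f x - f y| <= eps.
  by apply: Hd; split; rewrite /ball /=; [exact: lt_trans n1 ed|exact: lt_trans n2 ed].
by rewrite distrC => h; lra.
Qed.

Lemma periodic_continuous_bounded (f : R * R -> R) : continuous f ->
  torus_periodic f -> exists M : R, forall x, `|f x| <= M.
Proof.
move=> cf pf.
have cK : compact (`[- pi, pi]%classic `*` `[- pi, pi]%classic : set (R * R)).
  by apply: compact_setX; exact: segment_compact.
have cfK : compact (f @` (`[- pi, pi]%classic `*` `[- pi, pi]%classic)).
  by apply: continuous_compact => //; exact: continuous_subspaceT.
have /compact_bounded[M [Mr HM]] := cfK.
exists (M + 1) => x.
have [m hm] := fundamental_shift x.1; have [n hn] := fundamental_shift x.2.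
rewrite -(periodic_shift x m n pf); apply: HM; first by rewrite ltrDl.
exists (x.1 + m%:~R * (2 * pi), x.2 + n%:~R * (2 * pi)) => //.
by split; rewrite /= in_itv/= -ler_norml.
Qed.

End periodic_functions.

(** * Decay of the Fourier coefficients of test functions *)

Section partial_derivatives.
Context {R : realType}.

Lemma pair_cvg (T : Type) (F : set_system T) (FF : Filter F) (f g : T -> R) (a b : R) :
  f @ F --> a -> g @ F --> b -> (fun t => (f t, g t)) @ F --> ((a, b) : R * R).
Proof.
move=> /cvg_ballP fa /cvg_ballP gb; apply/cvg_ballP => e e0.
by apply: filterS2 (fa _ e0) (gb _ e0) => t; split.
Qed.

Notation T1 := (measurableTypeR R).
Notation T2 := (measurableTypeR R * measurableTypeR R)%type.

Lemma slice_derive0 (f : R * R -> R) (x y : R) :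
  derivable f (x, y) (unit_dir 0) ->
  is_derive x 1 (fun t : R => f (t, y)) (partial 0 f (x, y)).
Proof.
have E : (fun h : R => h^-1 *: ((f \o shift (x, y)) (h *: unit_dir 0) - f (x, y))) =
    (fun h : R => h^-1 *: (((fun t : R => f (t, y)) \o shift x) (h *: 1) - f (x, y))).
  apply/funext => h /=; congr (_ *: (f _ - _)).
  by rewrite /unit_dir /shift /= -[LHS]/((_, _)) /= /GRing.scale /= mulr0 add0r.
move=> df; apply: DeriveDef.
  by move: df; rewrite /derivable E.
by rewrite /partial /derive E.
Qed.

Lemma slice_derive1 (f : R * R -> R) (x y : R) :
  derivable f (x, y) (unit_dir 1) ->
  is_derive y 1 (fun t : R => f (x, t)) (partial 1 f (x, y)).
Proof.
have E : (fun h : R => h^-1 *: ((f \o shift (x, y)) (h *: unit_dir 1) - f (x, y))) =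
    (fun h : R => h^-1 *: (((fun t : R => f (x, t)) \o shift y) (h *: 1) - f (x, y))).
  apply/funext => h /=; congr (_ *: (f _ - _)).
  by rewrite /unit_dir /shift /= -[LHS]/((_, _)) /= /GRing.scale /= mulr0 add0r.
move=> df; apply: DeriveDef.
  by move: df; rewrite /derivable E.
by rewrite /partial /derive E.
Qed.

Lemma continuous_slice0 (f : R * R -> R) (y : R) : continuous f ->
  continuous (fun t : R => f (t, y)).
Proof.
move=> cf t; apply: (continuous_comp (f := fun t : R => (t, y))); last exact: cf.
by apply: pair_cvg; [exact: cvg_id|exact: cvg_cst].
Qed.

Lemma continuous_slice1 (f : R * R -> R) (x : R) : continuous f ->
  continuous (fun t : R => f (x, t)).
Proof.
move=> cf t; apply: (continuous_comp (f := fun t : R => (x, t))); last exact: cf.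
by apply: pair_cvg; [exact: cvg_cst|exact: cvg_id].
Qed.

Lemma partial_periodic (i : 'I_2) (f : R * R -> R) : torus_periodic f ->
  torus_periodic (partial i f).
Proof.
move=> pf x m; rewrite /partial /derive.
set s := (2 * pi) *: _.
have -> : (fun h : R => h^-1 *: ((f \o shift (x + s)) (h *: unit_dir i) - f (x + s))) =
    (fun h : R => h^-1 *: ((f \o shift x) (h *: unit_dir i) - f x)) => //.
by apply/funext => h /=; rewrite /shift /= addrA !pf.
Qed.

Lemma circ_parts_cos (g g' : R -> R) (n : int) (c : R) :
  (forall t : R, is_derive t 1 g (g' t)) -> continuous g' ->
  (forall t, g (t + 2 * pi) = g t) ->
  (exists M, forall t, `|g t| <= M) -> (exists M, forall t, `|g' t| <= M) ->
  Rintegral circ setT (fun t => g' t * cos (n%:~R * t + c)) =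
  n%:~R * Rintegral circ setT (fun t => g t * sin (n%:~R * t + c)).
Proof.
move=> dg cg' pg [M gM] [M' gM'].
have cg : continuous g by move=> t; exact: is_derive_continuous.
have cc : continuous (fun t : R => cos (n%:~R * t + c)).
  by move=> t; exact: (is_derive_continuous (is_derive_cos_lin _ _ t)).
have cs : continuous (fun t : R => sin (n%:~R * t + c)).
  by move=> t; exact: (is_derive_continuous (is_derive_sin_lin _ _ t)).
have m1 : measurable_fun setT ((fun t => g' t * cos (n%:~R * t + c)) : T1 -> R).
  by apply: measurable_funM; exact: continuous_measurable_fun.
have m2 : measurable_fun setT ((fun t => g t * sin (n%:~R * t + c)) : T1 -> R).
  by apply: measurable_funM; exact: continuous_measurable_fun.
have b1 (t : R) : `|g' t * cos (n%:~R * t + c)| <= M'.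
  rewrite normrM -[M']mulr1; apply: ler_pM => //; exact: cos_norm_le1.
have b2 (t : R) : `|g t * sin (n%:~R * t + c)| <= M.
  rewrite normrM -[M]mulr1; apply: ler_pM => //; exact: sin_norm_le1.
have i1 := bounded_integrable_circ m1 b1; have i2 := bounded_integrable_circ m2 b2.
apply/eqP; rewrite -subr_eq0 -RintegralZl// -RintegralB//; last first.
  by under [X in integrable _ _ X]eq_fun do rewrite /= EFinM; exact: integrableZl.
rewrite (@Rintegral_circ _ _ (M' + `|n%:~R| * M)); last 2 first.
- by apply: measurable_funB => //; exact: measurable_funM.
- move=> t; apply: le_trans (ler_normB _ _) _; apply: lerD => //.
  by rewrite normrM ler_wpM2l.
rewrite Rintegral_parts_cos//; last exact: two_pi_gt0.
rewrite mulr0 add0r -[2 * pi]add0r pg [n%:~R * _ + c]addrC add0r cos_add_2pi.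
by rewrite subrr mulr0.
Qed.

(** Fubini in the order that puts the differentiated variable innermost; the rest of the phase is a
    constant for the one-variable formula. *)
Lemma haar_parts_cos (f : R * R -> R) (i : 'I_2) (k : int * int) (c : R) :
  continuous f -> torus_periodic f -> (forall x, derivable f x (unit_dir i)) ->
  continuous (partial i f) ->
  Rintegral (haar R) setT (fun x => partial i f x * cos (dotp (lattice k) x + c)) =
  (if i == 0 then k.1 else k.2)%:~R *
  Rintegral (haar R) setT (fun x => f x * sin (dotp (lattice k) x + c)).
Proof.
move=> cf pf df cdf; have pdf := partial_periodic i pf.
have [M fM] := periodic_continuous_bounded cf pf.
have [M' dfM] := periodic_continuous_bounded cdf pdf.
have m1 : measurable_fun setT ((fun x => partial i f x * cos (dotp (lattice k) x + c)) : T2 -> R).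
  by apply: measurable_funM; [exact: continuous_measurable2|exact: measurable_cos_dotp].
have m2 : measurable_fun setT ((fun x => f x * sin (dotp (lattice k) x + c)) : T2 -> R).
  by apply: measurable_funM; [exact: continuous_measurable2|exact: measurable_sin_dotp].
have b1 x : `|partial i f x * cos (dotp (lattice k) x + c)| <= M'.
  rewrite normrM -[M']mulr1; apply: ler_pM => //; exact: cos_norm_le1.
have b2 x : `|f x * sin (dotp (lattice k) x + c)| <= M.
  rewrite normrM -[M]mulr1; apply: ler_pM => //; exact: sin_norm_le1.
have hi := bounded_integrable m2 b2.
pose r : int := if i == 0 then k.1 else k.2.
rewrite -/r -RintegralZl//.
have m3 : measurable_fun setT ((fun x => r%:~R * (f x * sin (dotp (lattice k) x + c))) : T2 -> R).
  exact: measurable_funM.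
have b3 x : `|r%:~R * (f x * sin (dotp (lattice k) x + c))| <= `|r%:~R| * M.
  by rewrite normrM ler_wpM2l.
case: (eqVneq i 0) => [i0|i0].
- subst i; rewrite (Rintegral_haar2 m1 b1) (Rintegral_haar2 m3 b3).
  apply: eq_Rintegral => y _.
  transitivity (Rintegral circ setT (fun x => partial 0 f (x, y) * cos (k.1%:~R * x + (k.2%:~R * y + c)))).
    by apply: eq_Rintegral => x _; rewrite /dotp /= addrA.
  have D (t : R) : is_derive t 1 (fun t => f (t, y)) (partial 0 f (t, y)) by exact: slice_derive0.
  rewrite (circ_parts_cos _ _ D)//; first last.
  + by exists M'.
  + by exists M.
  + by move=> t; exact: periodic1.
  + exact: continuous_slice0.
  rewrite RintegralZl//; last first.
    exact: (bounded_integrable_circ (measurable_fun_pair1 y m2) (fun x => b2 (x, y))).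
  by congr (_ * _); apply: eq_Rintegral => x _; rewrite /dotp /= addrA.
- have i1 : i = 1 by apply/val_inj; move: i0; case: (i) => -[|[|[]]].
  subst i; rewrite (Rintegral_haar1 m1 b1) (Rintegral_haar1 m3 b3).
  apply: eq_Rintegral => x _.
  transitivity (Rintegral circ setT (fun y => partial 1 f (x, y) * cos (k.2%:~R * y + (k.1%:~R * x + c)))).
    by apply: eq_Rintegral => y _; rewrite /dotp /= addrA [k.2%:~R * _ + _]addrC.
  have D (t : R) : is_derive t 1 (fun t => f (x, t)) (partial 1 f (x, t)) by exact: slice_derive1.
  rewrite (circ_parts_cos _ _ D)//; first last.
  + by exists M'.
  + by exists M.
  + by move=> t; exact: periodic2.
  + exact: continuous_slice1.
  rewrite RintegralZl//; last first.
    exact: (bounded_integrable_circ (measurable_fun_pair2 x m2) (fun y => b2 (x, y))).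
  by congr (_ * _); apply: eq_Rintegral => y _; rewrite /dotp /= addrA [k.2%:~R * _ + _]addrC.
Qed.

Lemma haar_parts_sin (f : R * R -> R) (i : 'I_2) (k : int * int) (c : R) :
  continuous f -> torus_periodic f -> (forall x, derivable f x (unit_dir i)) ->
  continuous (partial i f) ->
  Rintegral (haar R) setT (fun x => partial i f x * sin (dotp (lattice k) x + c)) =
  - ((if i == 0 then k.1 else k.2)%:~R *
  Rintegral (haar R) setT (fun x => f x * cos (dotp (lattice k) x + c))).
Proof.
move=> cf pf df cdf; have := haar_parts_cos k (c - pi / 2) cf pf df cdf.
have -> : (fun x => partial i f x * cos (dotp (lattice k) x + (c - pi / 2))) =
    (fun x => partial i f x * sin (dotp (lattice k) x + c)).
  by apply/funext => x; rewrite addrA cosBpihalf.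
have -> : (fun x => f x * sin (dotp (lattice k) x + (c - pi / 2))) =
    (fun x => -1 * (f x * cos (dotp (lattice k) x + c))).
  by apply/funext => x; rewrite addrA sinBpihalf mulrN mulN1r.
move=> ->; rewrite RintegralZl ?mulN1r ?mulrN//.
have [M fM] := periodic_continuous_bounded cf pf.
apply: (bounded_integrable (M := M)).
  by apply: measurable_funM; [exact: continuous_measurable2|exact: measurable_cos_dotp].
by move=> x; rewrite normrM -[M]mulr1; apply: ler_pM => //; exact: cos_norm_le1.
Qed.

Lemma smooth_continuous (f : R * R -> R) : smooth f -> continuous f.
Proof. by move=> /(_ [::]) []. Qed.

Lemma smooth_derivable (f : R * R -> R) i x : smooth f -> derivable f x (unit_dir i).
Proof. by move=> /(_ [::]) []. Qed.

Lemma smooth_partial (f : R * R -> R) i : smooth f -> smooth (partial i f).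
Proof. by move=> sf s; have := sf (rcons s i); rewrite foldr_rcons. Qed.

Lemma test_partial (f : R * R -> R) i : test_function f -> test_function (partial i f).
Proof. by move=> [pf sf]; split; [exact: partial_periodic|exact: smooth_partial]. Qed.

Lemma fmodeE (k : int * int) (f : R * R -> R) (x : R * R) :
  fmode k f x = Rintegral (haar R) setT
    (fun y => f y * cos (dotp (lattice k) y - dotp (lattice k) x)).
Proof.
by apply: eq_Rintegral => y _; rewrite dotpDr dotpNr -cosN opprB.
Qed.

Lemma fmode_partial2 (f : R * R -> R) (i : 'I_2) k x : test_function f ->
  fmode k (partial i (partial i f)) x =
  - ((if i == 0 then k.1 else k.2)%:~R ^+ 2 * fmode k f x).
Proof.
move=> tf; have [pf sf] := tf; have [pdf sdf] := test_partial i tf.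
rewrite !fmodeE haar_parts_cos//; first last.
- exact/smooth_continuous/smooth_partial.
- by move=> y; exact: smooth_derivable.
- exact: smooth_continuous.
rewrite haar_parts_sin//; first last.
- exact: smooth_continuous.
- by move=> y; exact: smooth_derivable.
- exact: smooth_continuous.
by rewrite mulrN mulrA -expr2.
Qed.

Lemma test_integrable (f : R * R -> R) : test_function f ->
  (haar R).-integrable setT (EFin \o (f : T2 -> R)).
Proof.
move=> [pf /smooth_continuous cf]; have [M fM] := periodic_continuous_bounded cf pf.
exact: (bounded_integrable (continuous_measurable2 cf) fM).
Qed.

Lemma fmode_norm (f : T2 -> R) k x : (haar R).-integrable setT (EFin \o f) ->
  `|fmode k f x| <= Rintegral (haar R) setT (fun y => `|f y|).
Proof.
move=> fi; have gi := integrable_fmode k x fi.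
apply: le_trans (le_normr_Rintegral _ gi) _ => //; apply: le_Rintegral => //.
- exact: (integrable_abse gi).
- exact: (integrable_abse fi).
- by move=> y _; rewrite normrM -[leRHS]mulr1; apply: ler_wpM2l => //; exact: cos_norm_le1.
Qed.

(** The product expands into the modes of the four terms of (1 - d_1^2)(1 - d_2^2) f, where u is a
    mode of f at the frequency (a, b). *)
Lemma helmholtz_norm_le (u a b i0 i1 i2 i12 : R) :
  `|u| <= i0 -> `|- (a ^+ 2 * u)| <= i1 -> `|- (b ^+ 2 * u)| <= i2 ->
  `|- (b ^+ 2 * - (a ^+ 2 * u))| <= i12 ->
  `|u * ((1 + a ^+ 2) * (1 + b ^+ 2))| <= i0 + i1 + i2 + i12.
Proof.
move=> h0 h1 h2 h12.
have -> : u * ((1 + a ^+ 2) * (1 + b ^+ 2)) =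
  u - (- (a ^+ 2 * u)) - (- (b ^+ 2 * u)) + - (b ^+ 2 * - (a ^+ 2 * u)) by ring.
apply: le_trans (ler_normD _ _) _; apply: lerD => //.
apply: le_trans (ler_normB _ _) _; apply: lerD => //.
by apply: le_trans (ler_normB _ _) _; apply: lerD.
Qed.

(** The constant is the sum of the L^1 norms of f, its two pure second derivatives and the mixed
    fourth one, since a mode is bounded by the L^1 norm. *)
Lemma test_fmode_decay (f : R * R -> R) : test_function f ->
  exists M : R, forall k x, `|fmode k f x| <= M * (lweight 1 k.1 * lweight 1 k.2).
Proof.
move=> tf; pose I (g : T2 -> R) := Rintegral (haar R) setT (fun y => `|g y|).
have t1 := test_partial 0 (test_partial 0 tf).
have t2 := test_partial 1 (test_partial 1 tf).
have t12 := test_partial 1 (test_partial 1 t1).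
exists (I f + I (partial 0 (partial 0 f)) + I (partial 1 (partial 1 f)) +
  I (partial 1 (partial 1 (partial 0 (partial 0 f))))) => k x.
set a : R := k.1%:~R; set b : R := k.2%:~R.
have a0 : 0 < 1 + a ^+ 2 by rewrite ltr_wpDr ?sqr_ge0.
have b0 : 0 < 1 + b ^+ 2 by rewrite ltr_wpDr ?sqr_ge0.
rewrite /lweight -/a -/b !powRN !powRr1 ?(ltW a0) ?(ltW b0)// -invfM.
rewrite ler_pdivlMr ?mulr_gt0//.
have e1 : fmode k (partial 0 (partial 0 f)) x = - (a ^+ 2 * fmode k f x).
  exact: fmode_partial2.
have e2 : fmode k (partial 1 (partial 1 f)) x = - (b ^+ 2 * fmode k f x).
  exact: fmode_partial2.
have e12 : fmode k (partial 1 (partial 1 (partial 0 (partial 0 f)))) x =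
    - (b ^+ 2 * - (a ^+ 2 * fmode k f x)).
  by rewrite -e1; exact: fmode_partial2.
have h0 : `|fmode k f x| <= I f by exact: fmode_norm (test_integrable tf).
have h1 : `|fmode k (partial 0 (partial 0 f)) x| <= I (partial 0 (partial 0 f)).
  exact: fmode_norm (test_integrable t1).
have h2 : `|fmode k (partial 1 (partial 1 f)) x| <= I (partial 1 (partial 1 f)).
  exact: fmode_norm (test_integrable t2).
have h12 := fmode_norm k x (test_integrable t12); rewrite -/(I _) in h12.
rewrite -[X in _ * X <= _]ger0_norm ?(mulr_ge0 (ltW a0) (ltW b0))// -normrM.
rewrite e1 in h1; rewrite e2 in h2; rewrite e12 in h12.
exact: (helmholtz_norm_le h0 h1 h2 h12).
Qed.



End partial_derivatives.

(** * The Leray projection and the Stokes operator in Fourier series *)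

Section series_of_functions.
Context d (T : measurableType d) (R : realType) (mu : {measure set T -> \bar R}).
Implicit Types (F : int * int -> T -> R) (g h : T -> R).

Lemma integrable_scale (f : T -> R) (c : R) : mu.-integrable setT (EFin \o f) ->
  mu.-integrable setT (EFin \o (fun x => c * f x)).
Proof.
by move=> fi; under [X in integrable _ _ X]eq_fun do rewrite EFinM; exact: integrableZl.
Qed.

Lemma measurable_lsum F : (forall k, measurable_fun setT (F k)) ->
  (forall x, lsummable (F ^~ x)) -> measurable_fun setT (fun x => lsum (F ^~ x)).
Proof.
move=> mF sF; apply: (measurable_fun_cvg (h := fun N x => \sum_(k <- box N) F k x)).
  by move=> N; exact: measurable_sum.
by move=> x _; exact: lsum_cvg.
Qed.

(** Dominated convergence along the sums over squares, which are what g has to dominate. *)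
Lemma lsum_dominated F g : (forall k, mu.-integrable setT (EFin \o F k)) ->
  (forall x, lsummable (F ^~ x)) -> mu.-integrable setT (EFin \o g) ->
  (forall N x, `|\sum_(k <- box N) F k x| <= g x) ->
  mu.-integrable setT (EFin \o (fun x => lsum (F ^~ x))) /\
  lsum (fun k => Rintegral mu setT (F k)) = Rintegral mu setT (fun x => lsum (F ^~ x)).
Proof.
move=> iF sF ig Fg.
have mF k : measurable_fun setT (F k) by apply/measurable_EFinP/(measurable_int mu).
have iS N : mu.-integrable setT (EFin \o (fun x => \sum_(k <- box N) F k x)).
  exact: integrable_bigsum.
have [] := @dominated_convergence _ _ _ mu setT measurableT
  (fun N => EFin \o (fun x => \sum_(k <- box N) F k x))
  (EFin \o (fun x => lsum (F ^~ x))) (EFin \o g).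
- by move=> N; exact: (measurable_int mu).
- by apply/measurable_EFinP; exact: measurable_lsum.
- by apply: aeW => x _ /=; apply/cvg_EFin; [exact: nearW|exact: lsum_cvg].
- exact: ig.
- by apply: aeW => x N _; rewrite /= lee_fin.
move=> iL _ cv; split => //; apply: lsum_unique.
have fL := integrable_fin_num measurableT iL.
move: cv; rewrite -(fineK fL) => /fine_cvgP[_].
by under [X in _ -> X @ _ --> _]eq_fun do rewrite -Rintegral_bigsum//.
Qed.

(** Termwise integration of a normally convergent series against a function h that is only
    integrable, such as a component of K or of an L^2 field. *)
Lemma lsum_integral F h (b : int * int -> R) : lsummable b ->
  (forall k, measurable_fun setT (F k)) -> (forall k x, `|F k x| <= b k) ->
  mu.-integrable setT (EFin \o h) ->
  mu.-integrable setT (EFin \o (fun x => lsum (F ^~ x) * h x)) /\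
  lsum (fun k => Rintegral mu setT (fun x => F k x * h x)) =
  Rintegral mu setT (fun x => lsum (F ^~ x) * h x).
Proof.
move=> sb mF Fb ih.
have E x : lsum (F ^~ x) * h x = lsum (fun k => F k x * h x).
  rewrite mulrC -lsumZ; last by apply: lsummable_le sb => k; exact: Fb.
  by congr lsum; apply/funext => k; rewrite mulrC.
have -> : (fun x => lsum (F ^~ x) * h x) = (fun x => lsum (fun k => F k x * h x)).
  by apply/funext.
apply: (@lsum_dominated (fun k x => F k x * h x) (fun x => lsum b * `|h x|)).
- move=> k; under [X in integrable _ _ X]eq_fun do rewrite mulrC.
  exact: (integrable_mul_bounded ih (mF k) (Fb k)).
- move=> x; under [X in lsummable X]eq_fun do rewrite mulrC.
  by apply: lsummableZ; apply: lsummable_le sb => k; exact: Fb.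
- under [X in integrable _ _ X]eq_fun do rewrite EFinM.
  by apply: integrableZl => //; exact: (integrable_abse ih).
- move=> N x; rewrite -mulr_suml normrM ler_wpM2r//.
  by apply: lsum_norm_box => // k; exact: Fb.
Qed.

End series_of_functions.

(** * Real Fourier coefficients and the Leray symbol *)

Section fourier_coefficients.
Context {R : realType}.
Notation T2 := (measurableTypeR R * measurableTypeR R)%type.
Implicit Types (f g h : T2 -> R) (k : int * int).

Definition coscoef k f : R := Rintegral (haar R) setT (fun y => f y * cos (dotp (lattice k) y)).
Definition sincoef k f : R := Rintegral (haar R) setT (fun y => f y * sin (dotp (lattice k) y)).
(** With \hat f(k) = [coscoef k f] - i [sincoef k f], this is the real part of \hat f(k) times the
    conjugate of \hat g(k). The imaginary part is odd in k and drops out of Parseval sums. *)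
Definition copair k f g : R := coscoef k f * coscoef k g + sincoef k f * sincoef k g.

Lemma measurable_cosk k : measurable_fun setT ((fun y => cos (dotp (lattice k) y)) : T2 -> R).
Proof.
have := measurable_cos_dotp (lattice k : R * R) 0.
by congr measurable_fun; apply/funext => y; rewrite addr0.
Qed.

Lemma measurable_sink k : measurable_fun setT ((fun y => sin (dotp (lattice k) y)) : T2 -> R).
Proof.
have := measurable_sin_dotp (lattice k : R * R) 0.
by congr measurable_fun; apply/funext => y; rewrite addr0.
Qed.

Lemma integrable_cosk f k : (haar R).-integrable setT (EFin \o f) ->
  (haar R).-integrable setT (EFin \o (fun y => f y * cos (dotp (lattice k) y))).
Proof.
move=> fi; apply: (integrable_mul_bounded (M := 1)) => //; first exact: measurable_cosk.
by move=> y; exact: cos_norm_le1.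
Qed.

Lemma integrable_sink f k : (haar R).-integrable setT (EFin \o f) ->
  (haar R).-integrable setT (EFin \o (fun y => f y * sin (dotp (lattice k) y))).
Proof.
move=> fi; apply: (integrable_mul_bounded (M := 1)) => //; first exact: measurable_sink.
by move=> y; exact: sin_norm_le1.
Qed.

Lemma Rintegral_lin2 (f g : T2 -> R) (a b : R) :
  (haar R).-integrable setT (EFin \o f) -> (haar R).-integrable setT (EFin \o g) ->
  Rintegral (haar R) setT (fun y => a * f y + b * g y) =
  a * Rintegral (haar R) setT f + b * Rintegral (haar R) setT g.
Proof.
move=> fi gi; have Z (c : R) (u : T2 -> R) : (haar R).-integrable setT (EFin \o u) ->
    (haar R).-integrable setT (EFin \o (fun y => c * u y)).
  by move=> ui; under [X in integrable _ _ X]eq_fun do rewrite EFinM; exact: integrableZl.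
by rewrite (RintegralD measurableT (Z a _ fi) (Z b _ gi)) !RintegralZl.
Qed.

Lemma fmode_coef f k x : (haar R).-integrable setT (EFin \o f) ->
  fmode k f x = coscoef k f * cos (dotp (lattice k) x) + sincoef k f * sin (dotp (lattice k) x).
Proof.
move=> fi; rewrite [X in X + _]mulrC [X in _ + X]mulrC -Rintegral_lin2//; first last.
- exact: integrable_sink.
- exact: integrable_cosk.
by apply: eq_Rintegral => y _; rewrite dotpDr dotpNr cosB; ring.
Qed.

Lemma measurable_fmode f k : (haar R).-integrable setT (EFin \o f) ->
  measurable_fun setT (fmode k f : T2 -> R).
Proof.
move=> fi; rewrite (_ : fmode k f = fun x =>
  coscoef k f * cos (dotp (lattice k) x) + sincoef k f * sin (dotp (lattice k) x)).
  by apply: measurable_funD; apply: measurable_funM => //;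
    [exact: measurable_cosk|exact: measurable_sink].
by apply/funext => x; exact: fmode_coef.
Qed.

Lemma Rintegral_fmode f h k : (haar R).-integrable setT (EFin \o f) ->
  (haar R).-integrable setT (EFin \o h) ->
  Rintegral (haar R) setT (fun x => fmode k f x * h x) = copair k f h.
Proof.
move=> fi hi; rewrite /copair -Rintegral_lin2//; first last.
- exact: integrable_sink.
- exact: integrable_cosk.
by apply: eq_Rintegral => y _; rewrite fmode_coef//; ring.
Qed.

Lemma torus_shift_dotp k x m : dotp (lattice k) (x + (2 * pi) *: lattice m) =
  dotp (lattice k) x + (k.1 * m.1 + k.2 * m.2)%:~R * (2 * pi) :> R.
Proof.
rewrite dotpDr; congr (_ + _); rewrite /dotp /lattice /= /GRing.scale /=.
by rewrite intrD !intrM; ring.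
Qed.

Lemma fmode_periodic k f : torus_periodic (fmode k f).
Proof.
move=> x m; apply: eq_Rintegral => y _; congr (_ * _).
by rewrite addrAC torus_shift_dotp cos_add_2pi.
Qed.

Lemma coscoef1 k : coscoef k (cst 1) = (k == 0)%:R.
Proof.
rewrite /coscoef -[RHS]mulr1 -[X in _ * X]cos0 -Rintegral_haar_cos.
by apply: eq_Rintegral => y _; rewrite mul1r addr0.
Qed.

Lemma sincoef1 k : sincoef k (cst 1) = 0.
Proof.
have := @Rintegral_haar_cos R k (- (pi / 2)).
rewrite cosN cos_pihalf mulr0 => <-.
by apply: eq_Rintegral => y _; rewrite mul1r cosBpihalf.
Qed.

Lemma sincoef0 f : sincoef 0 f = 0.
Proof.
rewrite /sincoef -[RHS](@Rintegral_set0 _ _ _ (haar R) (fun=> 0)) Rintegral_set0.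
rewrite (@eq_Rintegral _ _ _ _ _ (cst 0)); first by rewrite /Rintegral integral0.
by move=> y _; rewrite /dotp /= !mul0r addr0 sin0 mulr0.
Qed.

Lemma coscoef0 f : coscoef 0 f = Rintegral (haar R) setT f.
Proof.
by apply: eq_Rintegral => y _; rewrite /dotp /= !mul0r addr0 cos0 mulr1.
Qed.

Definition kcoord k (i : 'I_2) : R := (if i == 0 then k.1 else k.2)%:~R.

Lemma coscoef_partial f i k : test_function f ->
  coscoef k (partial i f) = kcoord k i * sincoef k f.
Proof.
move=> [pf sf]; have := @haar_parts_cos R f i k 0 (smooth_continuous sf) pf
  (fun x => smooth_derivable sf) (smooth_continuous (smooth_partial i sf)).
rewrite /coscoef /sincoef /kcoord.
under [X in X = _ -> _]eq_Rintegral do rewrite addr0.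
by under [X in _ = _ * X -> _]eq_Rintegral do rewrite addr0.
Qed.

Lemma sincoef_partial f i k : test_function f ->
  sincoef k (partial i f) = - (kcoord k i * coscoef k f).
Proof.
move=> [pf sf]; have := @haar_parts_sin R f i k 0 (smooth_continuous sf) pf
  (fun x => smooth_derivable sf) (smooth_continuous (smooth_partial i sf)).
rewrite /coscoef /sincoef /kcoord.
under [X in X = _ -> _]eq_Rintegral do rewrite addr0.
by under [X in _ = - (_ * X) -> _]eq_Rintegral do rewrite addr0.
Qed.

Lemma lnorm2_kcoord k : lnorm2 k = \sum_(i : 'I_2) kcoord k i ^+ 2 :> R.
Proof. by rewrite big_ord_recl big_ord1. Qed.

Lemma leray_symbolE k i j : leray_symbol k i j =
  (i == j)%:R - kcoord k i * kcoord k j / lnorm2 k :> R.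
Proof.
rewrite /leray_symbol !mxE big_ord1 !mxE -lnorm2E mulrC; congr (_ - _ / _).
by rewrite /kcoord /lattice/=; do 2 case: ifP.
Qed.

Lemma leray_symbol_opp k i j : leray_symbol (- k) i j = leray_symbol k i j :> R.
Proof.
rewrite !leray_symbolE lnorm2_opp; congr (_ - _ / _); rewrite /kcoord /=.
by do 2 case: ifP; rewrite !mulrNz mulrNN.
Qed.

Lemma ord2P (P : 'I_2 -> Prop) : P 0 -> P 1 -> forall i, P i.
Proof.
move=> P0 P1 i; have [->//|i0] := eqVneq i 0; have -> // : i = 1.
by apply/val_inj; move: i0; case: (i) => -[|[|[]]].
Qed.

(** k^T P_k = 0: the range of P_k is orthogonal to k, which makes the projected series
    divergence-free. *)
Lemma kcoord_leray k j : k != 0 -> \sum_i kcoord k i * leray_symbol k i j = 0 :> R.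
Proof.
move=> k0; have l0 : lnorm2 k != 0 :> R by rewrite lnorm2_eq0.
rewrite big_ord_recl big_ord1 !leray_symbolE.
elim/ord2P: j; rewrite /lnorm2 /kcoord /= in l0 *;
  move: (k.1%:~R : R) (k.2%:~R : R) l0 => a b l0; field => //.
Qed.

(** After clearing the denominator, the entries are controlled by (k_1 - k_2)^2 >= 0 and (k_1 +
    k_2)^2 >= 0. *)
Lemma leray_norm_le1 k i j : k != 0 -> `|leray_symbol k i j| <= 1 :> R.
Proof.
move=> k0; have := lnorm2_ge1 k0 : 1 <= (lnorm2 k : R).
rewrite leray_symbolE; set p := kcoord k i * kcoord k j; set c := (i == j)%:R.
move=> l1; have l0 : 0 < lnorm2 k :> R by exact: lt_le_trans ltr01 l1.
have -> : c - p / lnorm2 k = (c * lnorm2 k - p) / lnorm2 k by field; rewrite gt_eqF.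
rewrite normrM [X in _ * X]ger0_norm ?invr_ge0 ?(ltW l0)// ler_pdivrMr// mul1r {l0 l1}.
have ab1 := sqr_ge0 (k.1%:~R - k.2%:~R : R); have ab2 := sqr_ge0 (k.1%:~R + k.2%:~R : R).
have a2 := sqr_ge0 (k.1%:~R : R); have b2 := sqr_ge0 (k.2%:~R : R).
rewrite ler_norml /c /p /lnorm2 {c p}; elim/ord2P: i; elim/ord2P: j; rewrite /kcoord /=;
  move: (k.1%:~R : R) (k.2%:~R : R) ab1 ab2 a2 b2 => a b ab1 ab2 a2 b2;
  apply/andP; split; nra.
Qed.

End fourier_coefficients.

(** * Fourier multipliers composed with the Leray projection *)

Section leray_series.
Context {R : realType}.
Notation T2 := (measurableTypeR R * measurableTypeR R)%type.
Implicit Types (v h : vfield R) (k : int * int).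

Definition leray_mode (v : vfield R) k (i : 'I_2) (x : R * R) : R :=
  \sum_j leray_symbol k i j * fmode k (component v j) x.

(** One construction for two fields: w = 1 off the origin gives the projection of v on H, and w =
    |k|^{-2s} gives (-A)^{-s} applied to it. *)
Definition leray_series (w : int * int -> R) (v : vfield R) : vfield R :=
  fun x => \col_i lsum (fun k => w k * leray_mode v k i x).

Lemma test_field_integrable v i : test_field v ->
  (haar R).-integrable setT (EFin \o (component v i : T2 -> R)).
Proof. by move=> tv; exact: test_integrable. Qed.

Lemma haar_fin_setT : haar R setT \is a fin_num.
Proof. by rewrite haar_setT. Qed.

Lemma L2_integrable (f : T2 -> R) : L2_function f ->
  (haar R).-integrable setT (EFin \o f).
Proof. by move=> [_] /(Lfun_subset12 haar_fin_setT)/Lfun1_integrable. Qed.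

Lemma bounded_L2 (f : T2 -> R) (M : R) : torus_periodic f -> measurable_fun setT f ->
  (forall x, `|f x| <= M) -> L2_function f.
Proof.
move=> pf mf fM; split => //; rewrite inE; apply/andP; split; first by rewrite inE.
have E x : (`|(EFin \o f) x| `^ 2 = (f x ^+ 2)%:E)%E.
  rewrite -[LHS]/((`|f x|%:E `^ 2)%E) poweR_EFin; congr EFin.
  by rewrite (powR_mulrn 2)// real_normK// num_real.
rewrite inE /= /finite_norm unlock poweR_lty//.
apply: (@le_lt_trans _ _ (\int[haar R]_x (cst (M ^+ 2)%:E) x)%E); last first.
  by rewrite integral_cst//= haar_setT mule1 ltry.
apply: ge0_le_integral => //.
- by move=> x _; exact: poweR_ge0.
- under eq_fun do rewrite E.
  by apply/measurable_EFinP; apply: measurable_funX.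
- move=> x _; rewrite E /= lee_fin -real_normK ?num_real// ler_sqr ?nnegrE//.
  exact: le_trans (fM x).
Qed.

Variables (w : int * int -> R) (v : vfield R).
Hypotheses (w1 : forall k, `|w k| <= 1) (w0 : w 0 = 0) (tv : test_field v).

Lemma leray_mode_bound : exists2 b, lsummable b & forall k i x, `|w k * leray_mode v k i x| <= b k.
Proof.
have [M0 HM0] := test_fmode_decay (tv 0); have [M1 HM1] := test_fmode_decay (tv 1).
exists (fun k => (M0 + M1) * (lweight 1 k.1 * lweight 1 k.2)).
  by apply: lsummableZ; apply: lsummable_lweight; lra.
move=> k i x; have h0 := HM0 k x; have h1 := HM1 k x.
have [k0|k0] := eqVneq k 0.
  rewrite k0 w0 mul0r normr0 -k0 mulrDl.
  by apply: addr_ge0; [exact: le_trans h0|exact: le_trans h1].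
rewrite normrM -[leRHS]mul1r; apply: ler_pM => //.
rewrite /leray_mode big_ord_recl big_ord1 mulrDl.
have -> : lift ord0 ord0 = 1 :> 'I_2 by exact/val_inj.
apply: le_trans (ler_normD _ _) _; apply: lerD; rewrite normrM -[leRHS]mul1r.
- by apply: ler_pM => //; exact: leray_norm_le1.
- by apply: ler_pM => //; exact: leray_norm_le1.
Qed.

Lemma measurable_leray_mode k i : measurable_fun setT (leray_mode v k i : T2 -> R).
Proof.
apply: measurable_sum => j; apply: measurable_funM => //; apply: measurable_fmode.
exact: test_field_integrable.
Qed.

Lemma leray_series_bounded i : exists M : R, forall x, `|component (leray_series w v) i x| <= M.
Proof.
have [b sb wb] := leray_mode_bound; exists (lsum b) => x.
by rewrite /component mxE; apply: lsum_norm => // k.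
Qed.

Lemma measurable_leray_series i :
  measurable_fun setT (component (leray_series w v) i : T2 -> R).
Proof.
have [b sb wb] := leray_mode_bound.
rewrite (_ : component _ _ = fun x => lsum (fun k => w k * leray_mode v k i x)).
  apply: (@measurable_lsum _ _ _ (fun k (x : T2) => w k * leray_mode v k i x)) => [k|x].
    by apply: measurable_funM => //; exact: measurable_leray_mode.
  by apply: lsummable_le sb => k; exact: wb.
by apply/funext => x; rewrite /component mxE.
Qed.

Lemma leray_series_periodic : torus_periodic (leray_series w v).
Proof.
move=> x m; apply/matrixP => i j; rewrite !mxE; congr lsum; apply/funext => k.
by congr (_ * _); apply: eq_bigr => l _; rewrite fmode_periodic.
Qed.

Lemma leray_series_L2 : L2_field (leray_series w v).
Proof.
move=> i; have [M HM] := leray_series_bounded i; apply: bounded_L2 HM.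
- by move=> x m; rewrite /component leray_series_periodic.
- exact: measurable_leray_series.
Qed.

Lemma leray_mode_pairing k i (h : T2 -> R) : (haar R).-integrable setT (EFin \o h) ->
  Rintegral (haar R) setT (fun x => w k * leray_mode v k i x * h x) =
  w k * \sum_j leray_symbol k i j * copair k (component v j) h.
Proof.
move=> ih; have iv j := test_field_integrable j tv.
have I j : (haar R).-integrable setT (EFin \o (fun x => fmode k (component v j) x * h x)).
  under [X in integrable _ _ X]eq_fun do rewrite mulrC.
  apply: (integrable_mul_bounded (M := Rintegral (haar R) setT (fun y => `|component v j y|))) => //.
    exact: measurable_fmode.
  by move=> x; exact: fmode_norm.
transitivity (Rintegral (haar R) setT (fun x => \sum_j (w k * leray_symbol k i j) *
    (fmode k (component v j) x * h x))).
  apply: eq_Rintegral => x _; rewrite /leray_mode mulr_sumr mulr_suml; apply: eq_bigr => j _; ring.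
rewrite Rintegral_bigsum; last first.
  by move=> j; exact: integrable_scale.
by rewrite mulr_sumr; apply: eq_bigr => j _; rewrite RintegralZl// Rintegral_fmode// mulrA.
Qed.

(** A Parseval formula in which all the decay comes from the test field v, so that h may be any
    integrable function. *)
Lemma leray_series_pairing i (h : T2 -> R) : (haar R).-integrable setT (EFin \o h) ->
  Rintegral (haar R) setT (fun x => component (leray_series w v) i x * h x) =
  lsum (fun k => w k * \sum_j leray_symbol k i j * copair k (component v j) h).
Proof.
move=> ih; have [b sb wb] := leray_mode_bound.
have [_] := @lsum_integral _ _ _ (haar R) (fun k (x : T2) => w k * leray_mode v k i x) h b sb
  (fun k => measurable_funM (measurable_cst _ ) (measurable_leray_mode k i)) (fun k => wb k i) ih.
move=> E; transitivity (Rintegral (haar R) setT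
    (fun x => lsum (fun k => w k * leray_mode v k i x) * h x)).
  by apply: eq_Rintegral => x _; rewrite /component mxE.
by rewrite -E; congr lsum; apply/funext => k; exact: leray_mode_pairing.
Qed.

Lemma leray_pairing_summable i (h : T2 -> R) : (haar R).-integrable setT (EFin \o h) ->
  lsummable (fun k => w k * \sum_j leray_symbol k i j * copair k (component v j) h).
Proof.
move=> ih; have [b sb wb] := leray_mode_bound.
apply: lsummable_le (lsummableZ (Rintegral (haar R) setT (fun x => `|h x|)) sb) => k.
have mw : measurable_fun setT ((fun x => w k * leray_mode v k i x) : T2 -> R).
  by apply: measurable_funM => //; exact: measurable_leray_mode.
have I : (haar R).-integrable setT (EFin \o (fun x => w k * leray_mode v k i x * h x)).
  under [X in integrable _ _ X]eq_fun do rewrite mulrC.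
  exact: (integrable_mul_bounded ih mw (wb k i)).
rewrite -leray_mode_pairing//; apply: le_trans (le_normr_Rintegral _ I) _ => //.
have ia := integrable_abse ih.
rewrite mulrC -RintegralZl//; apply: le_Rintegral => //.
- exact: (integrable_abse I).
- exact: (integrable_scale _ ia).
- by move=> x _; rewrite normrM ler_wpM2r.
Qed.

Lemma leray_series_inner (h : vfield R) :
  (forall i, (haar R).-integrable setT (EFin \o (component h i : T2 -> R))) ->
  inner (leray_series w v) h =
  lsum (fun k => w k * \sum_i \sum_j leray_symbol k i j * copair k (component v j) (component h i)).
Proof.
move=> ih.
have I i : (haar R).-integrable setT (EFin \o (fun x => component (leray_series w v) i x * component h i x)).
  under [X in integrable _ _ X]eq_fun do rewrite mulrC.
  have [M HM] := leray_series_bounded i.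
  exact: (integrable_mul_bounded (ih i) (measurable_leray_series i) HM).
rewrite /inner Rintegral_bigsum// big_ord_recl big_ord1 !leray_series_pairing//.
rewrite -lsumD; [|exact: leray_pairing_summable..].
by congr lsum; apply/funext => k; rewrite -mulrDr [X in _ = _ * X]big_ord_recl big_ord1.
Qed.

End leray_series.

(** * Trigonometric test functions *)

Section trigonometric_tests.
Context {R : realType}.
Notation T2 := (measurableTypeR R * measurableTypeR R)%type.

(** The family is stable under partial derivatives, which rescale a and shift c by pi/2; smoothness
    follows by induction on the list of derivatives. Letting c vary extracts both real coefficients
    from a weak identity. *)
Definition wave (k : int * int) (a c : R) : R * R -> R :=
  fun x => a * cos (dotp (lattice k) x + c).

Lemma wave_derive k a c i x : derivable (wave k a c) x (unit_dir i) /\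
  partial i (wave k a c) x = wave k (a * kcoord k i) (c + pi / 2) x.
Proof.
pose g (t : R) := a * cos (kcoord k i * t + (dotp (lattice k) x + c)).
have E : (fun h : R => h^-1 *: ((wave k a c \o shift x) (h *: unit_dir i) - wave k a c x)) =
    (fun h : R => h^-1 *: ((g \o shift 0) (h *: 1) - g 0)).
  apply/funext => h /=; rewrite /wave /g /= mulr0 add0r addr0.
  congr (_ *: (a * cos _ - _)); rewrite dotpDr -addrA; congr (_ + _).
  clear g; by elim/ord2P: i; rewrite /dotp /unit_dir /kcoord /lattice /= /GRing.scale /=; ring.
have dg : is_derive (0 : R) 1 g (a * (- sin (dotp (lattice k) x + c) * kcoord k i)).
  have d0 := is_derive_cos_lin (kcoord k i) (dotp (lattice k) x + c) (0 : R).
  by have := is_deriveZ a d0; rewrite /GRing.scale /= mulr0 add0r.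
split; first by rewrite /derivable E; exact: ex_derive.
rewrite /partial /derive E -[LHS]/('D_1 g 0) derive_val /wave addrA cosDpihalf; ring.
Qed.

Lemma partial_wave k a c i : partial i (wave k a c) = wave k (a * kcoord k i) (c + pi / 2).
Proof. by apply/funext => x; have [] := wave_derive k a c i x. Qed.

Lemma wave_test k a c : test_function (wave k a c).
Proof.
split=> [x m|s]; first by rewrite /wave torus_shift_dotp addrAC cos_add_2pi.
have [a' [c' ->]] : exists a' c', foldr partial (wave k a c) s = wave k a' c'.
  elim: s => [|i s [a' [c' IH]]] /=; first by exists a, c.
  by rewrite IH partial_wave; exists (a' * kcoord k i), (c' + pi / 2).
split; last by move=> i x; have [] := wave_derive k a' c' i x.
by move=> x; apply: cvgMr; exact: cos_dotp_continuous.
Qed.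

Lemma Rintegral_wave (f : T2 -> R) k a c : (haar R).-integrable setT (EFin \o f) ->
  Rintegral (haar R) setT (fun x => f x * wave k a c x) =
  a * (cos c * coscoef k f - sin c * sincoef k f).
Proof.
move=> fi; rewrite -mulNr -Rintegral_lin2//; first last.
- exact: integrable_sink.
- exact: integrable_cosk.
rewrite -RintegralZl//; last first.
  rewrite (_ : (fun y => _) = (fun y => f y * cos (dotp (lattice k) y + c))).
    apply: (integrable_mul_bounded (M := 1)) => //; first exact: measurable_cos_dotp.
    by move=> y; exact: cos_norm_le1.
  by apply/funext => y; rewrite cosD; ring.
by apply: eq_Rintegral => y _; rewrite /wave cosD; ring.
Qed.

End trigonometric_tests.

(** * Fourier coefficients of solenoidal fields and of Stokes eigenfields *)

Section solenoidal_fields.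
Context {R : realType}.
Notation T2 := (measurableTypeR R * measurableTypeR R)%type.

Lemma wave_bounded k (a c : R) x : `|wave k a c x| <= `|a|.
Proof. by rewrite normrM -[leRHS]mulr1 ler_wpM2l// cos_norm_le1. Qed.

Lemma integrable_wave (f : T2 -> R) k a c : (haar R).-integrable setT (EFin \o f) ->
  (haar R).-integrable setT (EFin \o (fun x => f x * wave k a c x)).
Proof.
move=> fi; apply: (integrable_mul_bounded (M := `|a|)) => //.
  by apply: measurable_funM => //; exact: measurable_cos_dotp.
by move=> x; exact: wave_bounded.
Qed.

Variables (h : vfield R) (sh : solenoidal h).

Lemma solenoidal_integrable i : (haar R).-integrable setT (EFin \o (component h i : T2 -> R)).
Proof. exact: L2_integrable (solenoidal_L2 sh i). Qed.

Lemma solenoidal_coef0 i : coscoef 0 (component h i) = 0 /\ sincoef 0 (component h i) = 0.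
Proof. by rewrite coscoef0 sincoef0 (solenoidal_mean0 sh). Qed.

(** The weak divergence tested against cos(k.x + c): the derivative shifts the phase to c + pi/2,
    and the values 0 and pi/2 of the shifted phase isolate the cosine and the sine coefficients. *)
Lemma solenoidal_coef k : \sum_i kcoord k i * coscoef k (component h i) = 0 /\
  \sum_i kcoord k i * sincoef k (component h i) = 0.
Proof.
have H c : cos (c + pi / 2) * \sum_i kcoord k i * coscoef k (component h i) -
    sin (c + pi / 2) * \sum_i kcoord k i * sincoef k (component h i) = 0.
  rewrite !mulr_sumr -sumrB.
  transitivity (Rintegral (haar R) setT
    (fun x => \sum_i component h i x * partial i (wave k 1 c) x)); last first.
    exact: solenoidal_div0 sh _ (wave_test k 1 c).
  under eq_Rintegral do under eq_bigr do rewrite partial_wave mul1r.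
  rewrite Rintegral_bigsum; last by move=> i; exact: integrable_wave (solenoidal_integrable i).
  by apply: eq_bigr => i _; rewrite Rintegral_wave; [ring|exact: solenoidal_integrable].
split.
- by have := H (- (pi / 2)); rewrite addNr cos0 sin0 mul1r mul0r subr0.
- have := H 0; rewrite add0r cos_pihalf sin_pihalf mul0r mul1r sub0r => /eqP.
  by rewrite oppr_eq0 => /eqP.
Qed.

(** P_k acts as the identity on coefficients orthogonal to k; the correction term contains k.\hat
    h(k) = 0. *)
Lemma solenoidal_leray k (f : T2 -> R) j : k != 0 ->
  \sum_i leray_symbol k i j * copair k f (component h i) = copair k f (component h j).
Proof.
move=> k0; have [c0 s0] := solenoidal_coef k.
under eq_bigr do rewrite leray_symbolE mulrBl.
rewrite sumrB [X in _ - X](_ : _ = 0) ?subr0.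
  rewrite (bigD1 j)//= eqxx mul1r big1 ?addr0// => i /negbTE ->.
  by rewrite mul0r.
transitivity (kcoord k j / lnorm2 k * (coscoef k f * \sum_i kcoord k i * coscoef k (component h i) +
   sincoef k f * \sum_i kcoord k i * sincoef k (component h i))).
  rewrite !mulr_sumr -big_split mulr_sumr /=; apply: eq_bigr => i _; rewrite /copair; ring.
by rewrite c0 s0 !mulr0 addr0 mulr0.
Qed.

(** Moving both weak derivatives onto a wave shows that the coefficients of the Laplacian are -|k|^2
    times those of h, while the eigenvalue equation makes them -lambda times those of h. *)
Lemma stokes_eigen_coef (lambda : R) k j : stokes h (fun x => - lambda *: h x) ->
  (lnorm2 k - lambda) * coscoef k (component h j) = 0 /\
  (lnorm2 k - lambda) * sincoef k (component h j) = 0.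
Proof.
move=> [_ _ /(_ j) [_ [df [ddf [Hdf Hddf ae]]]]].
have ih := solenoidal_integrable j.
have iddf i : (haar R).-integrable setT (EFin \o (ddf i i : T2 -> R)).
  by have [H _] := Hddf i i; exact: L2_integrable.
have H c : (lnorm2 k - lambda) *
    (cos c * coscoef k (component h j) - sin c * sincoef k (component h j)) = 0.
  have E i : Rintegral (haar R) setT (fun x => ddf i i x * wave k 1 c x) =
      - (kcoord k i ^+ 2 * Rintegral (haar R) setT (fun x => component h j x * wave k 1 c x)).
    have [_ w1] := Hdf i; have [_ w2] := Hddf i i.
    have := w1 _ (test_partial i (wave_test k 1 c)).
    rewrite (w2 _ (wave_test k 1 c)) opprK => <-.
    (* Two derivatives shift the phase by pi/2 + pi/2 = pi, whence the sign. *)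
    rewrite !partial_wave !Rintegral_wave// -addrA -splitr cosDpi sinDpi; ring.
  have : Rintegral (haar R) setT (fun x => component (fun x => - lambda *: h x) j x * wave k 1 c x) =
      Rintegral (haar R) setT (fun x => \sum_i ddf i i x * wave k 1 c x).
    have mw : measurable_fun setT (wave k 1 c : T2 -> R).
      by apply: measurable_funM => //; exact: measurable_cos_dotp.
    congr fine; apply: ae_eq_integral => //.
    - apply/measurable_EFinP; apply: measurable_funM => //.
      rewrite (_ : component _ _ = fun x => - lambda * component h j x); last first.
        by apply/funext => x; rewrite /component mxE.
      apply: measurable_funM => //; apply/measurable_EFinP.
      exact: (measurable_int (haar R) ih).
    - apply/measurable_EFinP.
      apply: measurable_sum => i; apply: measurable_funM => //; apply/measurable_EFinP.
      exact: (measurable_int (haar R) (iddf i)).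
    - case: ae => A [mA A0 sA]; exists A; split => // x nx; apply: sA => /= E0.
      by apply: nx => _ /=; rewrite E0 mulr_suml.
  rewrite Rintegral_bigsum; last by move=> i; exact: integrable_wave.
  under [X in _ = X -> _]eq_bigr do rewrite E.
  have -> : (fun x => component (fun x => - lambda *: h x) j x * wave k 1 c x) =
     (fun x => - lambda * (component h j x * wave k 1 c x)).
    by apply/funext => x; rewrite [RHS]mulrA; congr (_ * _); rewrite /component mxE.
  rewrite RintegralZl//; last exact: integrable_wave.
  rewrite sumrN -mulr_suml -lnorm2_kcoord Rintegral_wave// !mul1r => e.
  by rewrite mulrBl; move: e; rewrite mulNr => /oppr_inj ->; rewrite subrr.
split.
- by have := H 0; rewrite cos0 sin0 mul1r mul0r subr0.
- have := H (pi / 2); rewrite cos_pihalf sin_pihalf mul0r mul1r sub0r mulrN => /eqP.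
  by rewrite oppr_eq0 => /eqP.
Qed.

End solenoidal_fields.

(** * Leray projection and fractional Stokes powers of a test field *)

Section solenoidal_gaussian_field.
Context {R : realType}.
Notation T2 := (measurableTypeR R * measurableTypeR R)%type.
Implicit Types (v h e : vfield R).

Lemma lsum_cst0 : lsum (fun=> 0) = 0 :> R.
Proof. by apply: lsum_odd => k; rewrite oppr0. Qed.

Definition nonzero_weight (k : int * int) : R := (k != 0)%:R.

(** The eigenvalue |k|^2 of -A to the power -s; the value 0 at the origin reflects that fields of H
    have mean zero. *)
Definition spectral_weight (s : R) (k : int * int) : R :=
  if k == 0 then 0 else lnorm2 k `^ (- s).

Lemma nonzero_weight_le1 k : `|nonzero_weight k| <= 1.
Proof. by rewrite /nonzero_weight ger0_norm ?ler0n//; case: eqP. Qed.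

Lemma nonzero_weight0 : nonzero_weight 0 = 0.
Proof. by rewrite /nonzero_weight eqxx. Qed.

Lemma spectral_weight_le1 s k : 0 <= s -> `|spectral_weight s k| <= 1.
Proof.
move=> s0; rewrite /spectral_weight; case: ifPn => k0; first by rewrite normr0.
rewrite ger0_norm ?powR_ge0// powRN invf_le1; last first.
  by rewrite powR_gt0// (lt_le_trans ltr01)// lnorm2_ge1.
have l1 : 1 <= lnorm2 k :> R by rewrite lnorm2_ge1.
apply: (@le_trans _ _ (1 `^ s)); first by rewrite powR1.
by apply: ge0_ler_powR; rewrite ?nnegrE// (le_trans _ l1).
Qed.

Lemma spectral_weight0 s : spectral_weight s 0 = 0.
Proof. by rewrite /spectral_weight eqxx. Qed.

(** Pairing with a constant sees only the mode k = 0, which w removes; pairing with the gradient of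
    phi produces k^T P_k = 0 in every other mode. *)
Lemma leray_series_solenoidal (w : int * int -> R) v : (forall k, `|w k| <= 1) -> w 0 = 0 ->
  test_field v -> solenoidal (leray_series w v).
Proof.
move=> w1 w0 tv; split.
- exact: leray_series_L2.
- move=> i; transitivity (Rintegral (haar R) setT
    (fun x => component (leray_series w v) i x * cst 1 x)).
    by apply: eq_Rintegral => x _; rewrite mulr1.
  rewrite leray_series_pairing//; last exact: integrable_cst_haar.
  rewrite -[RHS]lsum_cst0.
  congr lsum; apply/funext => k; have [->|k0] := eqVneq k 0; first by rewrite w0 mul0r.
  rewrite big1 ?mulr0// => j _.
  by rewrite /copair coscoef1 sincoef1 (negbTE k0) !mulr0 addr0 mulr0.
- move=> phi tphi.
  have ip i : (haar R).-integrable setT (EFin \o (partial i phi : T2 -> R)).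
    by apply: test_integrable; exact: test_partial.
  have := leray_series_inner w1 w0 tv (h := fun x => \col_i partial i phi x).
  have E i : component (fun x => \col_i partial i phi x) i = partial i phi.
    by apply/funext => x; rewrite /component mxE.
  rewrite /inner => H.
  transitivity (Rintegral (haar R) setT (fun x => \sum_i component (leray_series w v) i x *
     component (fun x => \col_i partial i phi x) i x)).
    by apply: eq_Rintegral => x _; apply: eq_bigr => i _; rewrite E.
  rewrite H; last by move=> i; rewrite E.
  rewrite -[RHS]lsum_cst0.
  congr lsum; apply/funext => k; have [->|k0] := eqVneq k 0; first by rewrite w0 mul0r.
  rewrite exchange_big /= big1 ?mulr0// => j _.
  transitivity ((\sum_i kcoord k i * leray_symbol k i j) *
    (coscoef k (component v j) * sincoef k phi - sincoef k (component v j) * coscoef k phi)).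
    rewrite mulr_suml; apply: eq_bigr => i _.
    by rewrite E /copair coscoef_partial// sincoef_partial//; ring.
  by rewrite kcoord_leray// mul0r.
Qed.

Lemma leray_series_inner_solenoidal (w : int * int -> R) v h :
  (forall k, `|w k| <= 1) -> w 0 = 0 -> test_field v -> solenoidal h ->
  inner (leray_series w v) h =
  lsum (fun k => w k * \sum_j copair k (component v j) (component h j)).
Proof.
move=> w1 w0 tv sh; rewrite leray_series_inner//; last exact: solenoidal_integrable.
congr lsum; apply/funext => k; have [->|k0] := eqVneq k 0; first by rewrite w0 !mul0r.
by congr (_ * _); rewrite exchange_big; apply: eq_bigr => j _; exact: solenoidal_leray.
Qed.

Lemma test_fourier_series (f : R * R -> R) x : test_function f ->
  lsum (fun k => fmode k f x) = f x.
Proof.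
move=> tf; have [pf /smooth_continuous cf] := tf.
have [M HM] := test_fmode_decay tf; have [B fB] := periodic_continuous_bounded cf pf.
apply: (fourier_inversion (f := f)).
- exact: test_integrable.
- apply: lsummable_le (_ : lsummable (fun k => M * (lweight 1 k.1 * lweight 1 k.2))) => //.
  by apply: lsummableZ; apply: lsummable_lweight; lra.
- exact: periodic_local_bound fB (cf x).
Qed.

(** The Fourier series of the smooth factor converges normally to it, so it can be integrated
    termwise against h. *)
Lemma test_pairing (f : R * R -> R) (h : T2 -> R) : test_function f ->
  (haar R).-integrable setT (EFin \o h) ->
  lsummable (fun k => copair k f h) /\
  Rintegral (haar R) setT (fun x => f x * h x) = lsum (fun k => copair k f h).
Proof.
move=> tf ih; have [M HM] := test_fmode_decay tf; have fi := test_integrable tf.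
pose b k : R := M * (lweight 1 k.1 * lweight 1 k.2).
have sb : lsummable b by apply: lsummableZ; apply: lsummable_lweight; lra.
split.
- apply: lsummable_le (lsummableZ (Rintegral (haar R) setT (fun x => `|h x|)) sb) => k.
  have I : (haar R).-integrable setT (EFin \o (fun x => fmode k f x * h x)).
    under [X in integrable _ _ X]eq_fun do rewrite mulrC.
    exact: (integrable_mul_bounded ih (measurable_fmode k fi) (HM k)).
  have ia := integrable_abse ih.
  rewrite -Rintegral_fmode//; apply: le_trans (le_normr_Rintegral _ I) _ => //.
  rewrite mulrC -RintegralZl//; apply: le_Rintegral => //.
  + exact: (integrable_abse I).
  + exact: (integrable_scale _ ia).
  + by move=> x _; rewrite normrM ler_wpM2r.
- have [_ E] := lsum_integral sb (fun k => measurable_fmode k fi) HM ih.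
  transitivity (Rintegral (haar R) setT (fun x => lsum (fun k => fmode k f x) * h x)).
    by apply: eq_Rintegral => x _; rewrite test_fourier_series.
  by rewrite -E; congr lsum; apply/funext => k; rewrite Rintegral_fmode.
Qed.

Lemma inner_integrable (v h : vfield R) i : test_field v ->
  (haar R).-integrable setT (EFin \o (component h i : T2 -> R)) ->
  (haar R).-integrable setT (EFin \o (fun x => component v i x * component h i x)).
Proof.
move=> tv ih; have [pf /smooth_continuous cf] := tv i.
have [B fB] := periodic_continuous_bounded cf pf.
under [X in integrable _ _ X]eq_fun do rewrite mulrC.
exact: (integrable_mul_bounded ih (continuous_measurable2 cf) fB).
Qed.

(** Against a solenoidal h, both v and its series pair to the same sum over k <> 0: P_k drops out on
    the coefficients of h, and the mode 0 of h is zero. *)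
Lemma test_leray_projection v : test_field v ->
  leray_projection v (leray_series nonzero_weight v).
Proof.
move=> tv; split.
- move=> i; have [pf /smooth_continuous cf] := tv i.
  have [B fB] := periodic_continuous_bounded cf pf.
  exact: bounded_L2 pf (continuous_measurable2 cf) fB.
- exact: leray_series_solenoidal nonzero_weight_le1 nonzero_weight0 tv.
- move=> h sh; have ih := solenoidal_integrable sh.
  rewrite (leray_series_inner_solenoidal nonzero_weight_le1 nonzero_weight0)//.
  rewrite /inner Rintegral_bigsum; last by move=> i; exact: inner_integrable.
  have P i := test_pairing (tv i) (ih i).
  rewrite big_ord_recl big_ord1 !(P _).2 -lsumD; [|exact: (P _).1..].
  congr lsum; apply/funext => k; rewrite big_ord_recl big_ord1.
  have [->|k0] := eqVneq k 0; last by rewrite /nonzero_weight k0 mul1r.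
  have Z i : copair 0 (component v i) (component h i) = 0.
    have [c0 s0] := solenoidal_coef0 sh i.
    by rewrite /copair c0 s0 !mulr0 addr0.
  by rewrite !Z addr0 mulr0.
Qed.

(** Mode by mode against an eigenfield: either |k|^2 = lambda and the weight is lambda^{-s}, or the
    eigenfield has no coefficient at k. *)
Lemma test_stokes_power (s : R) v : 0 <= s -> test_field v ->
  stokes_power s (leray_series nonzero_weight v) (leray_series (spectral_weight s) v).
Proof.
move=> s0 tv; split.
- exact: leray_series_solenoidal nonzero_weight_le1 nonzero_weight0 tv.
- exact: (leray_series_solenoidal (fun k => spectral_weight_le1 k s0) (spectral_weight0 s) tv).
move=> lambda e se; have [she _ _] := se.
rewrite (leray_series_inner_solenoidal nonzero_weight_le1 nonzero_weight0)//.
rewrite (leray_series_inner_solenoidal (fun k => spectral_weight_le1 k s0) (spectral_weight0 s))//.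
rewrite -lsumZ.
  congr lsum; apply/funext => k; rewrite /nonzero_weight /spectral_weight.
  have [k0|k0] := eqVneq k 0; first by rewrite /= !mul0r mulr0.
  rewrite mul1r; have [->//|kl] := eqVneq (lnorm2 k) lambda.
  rewrite big1 ?mulr0// => j _; have [c0 s1] := stokes_eigen_coef she k j se.
  have nz : lnorm2 k - lambda != 0 by rewrite subr_eq0.
  move/eqP: c0; rewrite mulf_eq0 (negbTE nz) /= => /eqP c0.
  move/eqP: s1; rewrite mulf_eq0 (negbTE nz) /= => /eqP s1.
  by rewrite /copair c0 s1 !mulr0 addr0.
have ih := solenoidal_integrable she.
have P i := (test_pairing (tv i) (ih i)).1.
apply: lsummable_le (lsummableD (lsummable_normr (P 0)) (lsummable_normr (P 1))) => k.
rewrite normrM -[leRHS]mul1r; apply: ler_pM => //; first exact: nonzero_weight_le1.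
rewrite big_ord_recl big_ord1 (_ : lift ord0 ord0 = 1); last exact/val_inj.
exact: ler_normD.
Qed.

End solenoidal_gaussian_field.

(** * The covariance kernel of the fractional Gaussian field *)

Section covariance_of_the_gaussian_field.
Context {R : realType}.
Notation T2 := (measurableTypeR R * measurableTypeR R)%type.

(* The coefficients are even in k, so only the cosines survive in the sum of
   |k|^{-2s} P_k e^{ik.x}. *)
Definition sfgf_kernel (s : R) (x : R * R) : 'M[R]_2 :=
  \matrix_(i, j) lsum (fun k => spectral_weight s k * leray_symbol k i j * cos (dotp (lattice k) x)).

Lemma spectral_weightE (s : R) k : k != 0 ->
  spectral_weight s k = (enorm (lattice k : R * R) `^ (2 * s))^-1.
Proof.
move=> k0; rewrite /spectral_weight (negbTE k0) powRN powRrM powR_mulrn ?sqrtr_ge0//.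
by rewrite lnorm2E.
Qed.

Lemma lsummable_spectral_weight (s : R) : 1 < s -> lsummable (spectral_weight s).
Proof.
move=> s1; have s2 : 2 < 2 * s by lra.
apply: lsummable_le (lsummable_powR_norm s2) => k; case: eqVneq => k0.
  by rewrite /spectral_weight k0 eqxx normr0.
by rewrite spectral_weightE// ger0_norm// invr_ge0 powR_ge0.
Qed.

Lemma kernel_coef_norm (s : R) k i j : 
  `|spectral_weight s k * leray_symbol k i j| <= spectral_weight s k.
Proof.
have [->|k0] := eqVneq k 0; first by rewrite spectral_weight0 mul0r normr0.
rewrite normrM ger0_norm; last by rewrite /spectral_weight (negbTE k0) powR_ge0.
rewrite ler_piMr ?leray_norm_le1//.
by rewrite /spectral_weight (negbTE k0) powR_ge0.
Qed.

Variables (s : R) (s1 : 1 < s).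

Lemma kernel_convolution (w : vfield R) i j x : test_field w ->
  (haar R).-integrable setT (EFin \o (fun x' : T2 => sfgf_kernel s (x - x') i j * component w j x')) /\
  Rintegral (haar R) setT (fun x' => sfgf_kernel s (x - x') i j * component w j x') =
  lsum (fun k => spectral_weight s k * (leray_symbol k i j * fmode k (component w j) x)).
Proof.
move=> tw; have iw := test_field_integrable j tw.
pose F k (x' : T2) : R := spectral_weight s k * leray_symbol k i j * cos (dotp (lattice k) (x - x')).
have mF k : measurable_fun setT (F k).
  by apply: measurable_funM => //; exact: measurable_fmode_kernel.
have Fb k x' : `|F k x'| <= spectral_weight s k.
  apply: le_trans (kernel_coef_norm s k i j); rewrite normrM ler_piMr//.
  exact: cos_norm_le1.
have [I E] := lsum_integral (lsummable_spectral_weight s1) mF Fb iw.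
have EF : (fun x' => sfgf_kernel s (x - x') i j * component w j x') =
    (fun x' => lsum (F ^~ x') * component w j x').
  by apply/funext => x'; rewrite mxE.
rewrite EF; split=> //; rewrite -E; congr lsum; apply/funext => k.
rewrite mulrA -RintegralZl//; last exact: integrable_fmode.
by apply: eq_Rintegral => x' _; rewrite /F; ring.
Qed.

(** Convolution with the kernel multiplies the k-th mode of w by |k|^{-2s} P_k, so the inner
    integral is the weighted Leray series of w at x. *)
Lemma kernel_pairing (v w : vfield R) : test_field v -> test_field w ->
  Rintegral (haar R) setT (fun x => Rintegral (haar R) setT (fun x' =>
    ((v x)^T *m sfgf_kernel s (x - x') *m w x') 0 0)) =
  inner v (leray_series (spectral_weight s) w).
Proof.
move=> tv tw; apply: eq_Rintegral => x _.
have K i j := kernel_convolution i j x tw.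
transitivity (Rintegral (haar R) setT (fun x' => \sum_i \sum_j component v i x *
    (sfgf_kernel s (x - x') i j * component w j x'))).
  apply: eq_Rintegral => x' _; rewrite !mxE exchange_big; apply: eq_bigr => j _.
  rewrite !mxE mulr_suml; apply: eq_bigr => i _.
  by rewrite !mxE mulrA.
rewrite Rintegral_bigsum; last first.
  by move=> i; apply: integrable_bigsum => j; apply: integrable_scale; exact: (K i j).1.
apply: eq_bigr => i _; rewrite Rintegral_bigsum; last first.
  by move=> j; apply: integrable_scale; exact: (K i j).1.
under eq_bigr do rewrite RintegralZl ?(K i _).2 ?(K i _).1//.
rewrite -mulr_sumr; congr (_ * _); rewrite /component mxE.
have sK j : lsummable (fun k => spectral_weight s k * (leray_symbol k i j * fmode k (component w j) x)).
  have iw := test_field_integrable j tw.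
  apply: lsummable_le (lsummableZ (Rintegral (haar R) setT (fun y => `|component w j y|))
    (lsummable_spectral_weight s1)) => k.
  rewrite mulrA normrM mulrC; apply: ler_pM => //; first exact: fmode_norm.
  exact: kernel_coef_norm.
rewrite big_ord_recl big_ord1 -lsumD//; congr lsum; apply/funext => k.
by rewrite /leray_mode [in RHS]big_ord_recl big_ord1 mulrDr.
Qed.

Lemma innerC (v w : vfield R) : inner v w = inner w v.
Proof. by apply: eq_Rintegral => x _; apply: eq_bigr => i _; rewrite mulrC. Qed.

(** The covariance is prescribed only on the domain of (-A)^{-s}, so both test fields are first
    replaced, almost surely, by their projections on H. As (-A)^{-s} of the projection of w is
    solenoidal, the projection of v can then be undone in the inner product. *)
Lemma SFGF_covariance_function d' (T' : measurableType d') (P' : probability T' R)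
    (X : vfield R -> {RV P' >-> R}) : SFGF s X ->
  is_covariance_function X (fun x x' => sfgf_kernel s (x - x')).
Proof.
move=> [_ Xsol _ Xcov] v w tv tw.
have s0 : 0 <= s by exact: ltW (lt_trans ltr01 s1).
have [iX EX] := Xcov _ _ _ (test_stokes_power s0 tw)
  (ex_intro _ _ (test_stokes_power s0 tv)).
have lv := test_leray_projection tv; have lw := test_leray_projection tw.
set pv := leray_series nonzero_weight v in lv iX EX.
set pw := leray_series nonzero_weight w in lw iX EX.
have ae : ae_eq P' setT (fun t => (X v t * X w t)%:E) (fun t => (X pw t * X pv t)%:E).
  have [A [mA A0 sA]] := Xsol _ _ lv; have [B [mB B0 sB]] := Xsol _ _ lw.
  exists (A `|` B); split; first exact: measurableU.
    by rewrite null_set_setU.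
  move=> t nt; have [At|nA] := pselect (A t); [by left|right; apply: sB => /= Et].
  apply: nt => _; congr EFin; rewrite Et mulrC; congr (_ * _).
  by apply: contrapT => nE; apply: nA; exact: sA.
have m1 : measurable_fun setT (fun t => (X v t * X w t)%:E).
  by apply/measurable_EFinP; apply: measurable_funM; exact: measurable_funP.
have m2 : measurable_fun setT (fun t => (X pw t * X pv t)%:E).
  by apply/measurable_EFinP; apply: measurable_funM; exact: measurable_funP.
split.
  apply/integrableP; split => //.
  have /integrableP[_] := iX; congr (_ < _)%E; apply: ae_eq_integral => //.
  - exact: measurableT_comp.
  - exact: measurableT_comp.
  - by move: ae => [A [mA A0 sA]]; exists A; split => // t nt; apply: sA => /= E;
      apply: nt => _; rewrite E.
transitivity ('E_P'[fun t => (X pw t * X pv t)%R])%E.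
  by rewrite unlock; exact: ae_eq_integral.
apply: (etrans EX); congr EFin.
have [_ _ H] := lv.
have sol := leray_series_solenoidal (fun k => spectral_weight_le1 k s0) (spectral_weight0 s) tw.
rewrite (kernel_pairing tv tw) innerC -(H _ sol).
by [].
Qed.

End covariance_of_the_gaussian_field.

(** * Decay of the transform of the mollifier *)

Section real_change_of_variables.
Context d1 d2 (X : measurableType d1) (Y : measurableType d2) (R : realType).
Variables (mu : {measure set X -> \bar R}) (nu : {measure set Y -> \bar R}).
Variables (phi : X -> Y) (mphi : measurable_fun setT phi) (c : {nonneg R}).
Hypothesis nuE : forall A, measurable A ->
  nu A = ((c%:num)%:E * mu (phi @^-1` A))%E.

Lemma Rintegral_image (f : Y -> R) : mu.-integrable setT (EFin \o f \o phi) ->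
  measurable_fun setT f ->
  Rintegral nu setT f = c%:num * Rintegral mu setT (f \o phi).
Proof.
move=> fi mf; have mf' : measurable_fun setT (EFin \o f) by exact/measurable_EFinP.
have fin : (\int[mu]_x (f (phi x))%:E)%E \is a fin_num by exact: integrable_fin_num.
rewrite /Rintegral -[RHS](fineM (isT : (c%:num)%:E \is a fin_num) fin); congr fine.
have Ep : (\int[nu]_y (EFin \o f)^\+ y =
    (c%:num)%:E * \int[mu]_x (EFin \o f \o phi)^\+ x)%E.
  rewrite (ge0_integral_image mphi nuE measurableT (measurable_funepos mf'))//.
  by congr (_ * _)%E; apply: eq_integral => x _; rewrite ?funeposE.
have En : (\int[nu]_y (EFin \o f)^\- y =
    (c%:num)%:E * \int[mu]_x (EFin \o f \o phi)^\- x)%E.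
  rewrite (ge0_integral_image mphi nuE measurableT (measurable_funeneg mf'))//.
  by congr (_ * _)%E; apply: eq_integral => x _; rewrite ?funenegE.
transitivity (\int[nu]_y (EFin \o f)^\+ y - \int[nu]_y (EFin \o f)^\- y)%E.
  exact: integralE.
transitivity ((c%:num)%:E * (\int[mu]_x (EFin \o f \o phi)^\+ x -
    \int[mu]_x (EFin \o f \o phi)^\- x))%E; last by congr (_ * _)%E; rewrite -integralE.
have Fn : (\int[mu]_x (EFin \o f \o phi)^\- x)%E \is a fin_num.
  exact: integrable_neg_fin_num.
rewrite Ep En; move: Fn; move: (\int[mu]_x _)%E (\int[mu]_x _)%E => A B Fn.
by rewrite muleBr//; apply: fin_num_adde_defl; rewrite fin_numN.
Qed.

End real_change_of_variables.

Lemma ge0_integral_mscale_mrestr d (T : measurableType d) (R : realType)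
    (mu : {measure set T -> \bar R}) (c : {nonneg R}) (D : set T) (mD : measurable D)
    (f : T -> \bar R) : measurable_fun setT f -> (forall z, 0 <= f z)%E ->
  (\int[mscale c (mrestr mu mD)]_z f z = (c%:num)%:E * \int[mu]_(z in D) f z)%E.
Proof.
move=> mf f0; rewrite ge0_integral_mscale//; congr (_ * _)%E.
have mc : measurable (~` D) by exact: measurableC.
rewrite (ge0_negligible_integral mc)//; last by rewrite /= /mrestr setICl measure0.
rewrite setTD setCK; apply: eq_measure_integral => A mA Ac.
by rewrite /= /mrestr; congr (mu _); apply/setIidPl.
Qed.

(** * Integrals over the plane and integration by parts along an axis *)

Section plane_integral.
Context {R : realType}.
Notation leb := (@lebesgue_measure R).
Notation leb2 := (@lebesgue2 R).
Notation T1 := (measurableTypeR R).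
Notation T2 := (measurableTypeR R * measurableTypeR R)%type.

Definition dilate (a : R) (b : R * R) : T2 -> T2 := fun z => (a * z.1 + b.1, a * z.2 + b.2).

Lemma measurable_dilate a b : measurable_fun setT (dilate a b).
Proof.
apply: measurable_fun_pair => /=.
- by apply: measurableT_comp (measurable_affine a b.1) _.
- by apply: measurableT_comp (measurable_affine a b.2) _.
Qed.

Lemma lebesgue2_dilate (a : R) b (a0 : 0 < a) (A : set T2) : measurable A ->
  leb2 A = ((a ^+ 2)%:E * leb2 (dilate a b @^-1` A))%E.
Proof.
move=> mA.
pose phi : {mfun T2 >-> T2} :=
  HB.pack (dilate a b) (isMeasurableFun.Build _ _ _ _ _ (measurable_dilate a b)).
apply: (product_measure_unique (m' := mscale (NngNum (sqr_ge0 a)) (pushforward leb2 phi))) => // {mA}A B mA mB.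
transitivity ((a ^+ 2)%:E * (leb \x leb)%E ((affine a b.1 @^-1` A) `*` (affine a b.2 @^-1` B)))%E; first by [].
have mA' : measurable (affine a b.1 @^-1` A).
  by rewrite -[X in measurable X]setTI; exact: measurable_affine.
have mB' : measurable (affine a b.2 @^-1` B).
  by rewrite -[X in measurable X]setTI; exact: measurable_affine.
rewrite product_measure1E//; transitivity (leb A * leb B)%E; last by [].
have an0 : a != 0 by rewrite gt_eqF.
rewrite (lebesgue_affine b.1 (ltW a0) an0 mA) (lebesgue_affine b.2 (ltW a0) an0 mB).
by rewrite muleACA -EFinM -expr2.
Qed.

Lemma ge0_integral_dilate (a : R) b (a0 : 0 < a) (f : T2 -> \bar R) :
  measurable_fun setT f -> (forall z, 0 <= f z)%E ->
  (\int[leb2]_z f z = (a ^+ 2)%:E * \int[leb2]_z f (dilate a b z))%E.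
Proof.
move=> mf f0.
rewrite (ge0_integral_image (mu := leb2) (measurable_dilate a b) (c := NngNum (sqr_ge0 a)))//.
by move=> A mA; exact: lebesgue2_dilate.
Qed.

Lemma integrable_dilate (a : R) b (a0 : 0 < a) (f : T2 -> R) :
  leb2.-integrable setT (EFin \o f) -> leb2.-integrable setT (EFin \o f \o dilate a b).
Proof.
move=> /integrableP[mf fy]; apply/integrableP; split.
  by apply: (measurableT_comp mf); exact: measurable_dilate.
move: fy; rewrite (ge0_integral_dilate b a0)//; last exact: measurableT_comp.
rewrite !ltey; apply: contraNN => /eqP ->; rewrite gt0_muley// lte_fin.
by rewrite exprn_gt0.
Qed.

Lemma Rintegral_dilate (a : R) b (a0 : 0 < a) (f : T2 -> R) :
  leb2.-integrable setT (EFin \o f) ->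
  Rintegral leb2 setT f = a ^+ 2 * Rintegral leb2 setT (f \o dilate a b).
Proof.
move=> fi; apply: (@Rintegral_image _ _ _ _ _ _ _ _ (measurable_dilate a b) (NngNum (sqr_ge0 a))).
- by move=> A mA; exact: lebesgue2_dilate.
- exact: integrable_dilate.
- by apply/measurable_EFinP; exact: measurable_int fi.
Qed.

(** Support in a square rather than a disc, which suits Fubini. The strict inequalities describe an
    open set, so the property passes to partial derivatives. *)
Definition supported (rho : R) (g : R * R -> R) : Prop :=
  forall z, (rho < `|z.1|) || (rho < `|z.2|) -> g z = 0.

Lemma integrable_indic d (T : measurableType d) (mu : {measure set T -> \bar R}) (A : set T) :
  measurable A -> (mu A < +oo)%E -> mu.-integrable setT (EFin \o \1_A).
Proof.
move=> mA Ay; apply/integrableP; split; first exact/measurable_EFinP.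
rewrite (eq_integral (EFin \o \1_A)); first by rewrite integral_indic// setIT.
by move=> x _ /=; rewrite ger0_norm.
Qed.

Lemma lebesgue_segment_fin (a b : R) : (leb `[a, b]%classic < +oo)%E.
Proof.
have := @lebesgue_measure_itv R `[a, b] => /= ->.
by case: ifP => _ //; rewrite -EFinB ltry.
Qed.

Lemma supported_integrable (rho : R) (g : T2 -> R) (M : R) : measurable_fun setT g ->
  (forall z, `|g z| <= M) -> supported rho g -> leb2.-integrable setT (EFin \o g).
Proof.
move=> mg gM sg; pose B := (`[- rho, rho]%classic `*` `[- rho, rho]%classic) : set T2.
have mB : measurable B by apply: measurableX.
have iB : leb2.-integrable setT (EFin \o \1_B).
  apply: integrable_indic => //.
  pose I : set T1 := `[- rho, rho]%classic.
  have -> : leb2 B = (leb I * leb I)%E by exact: product_measure1E.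
  have If : (leb I < +oo)%E by exact: lebesgue_segment_fin.
  by rewrite lte_mul_pinfty// ge0_fin_numE.
have := integrable_mul_bounded iB mg gM.
congr integrable; apply/funext => z /=; congr EFin.
rewrite indicE; case: (boolP (z \in B)) => zB; first by rewrite mul1r.
rewrite mul0r sg//; apply: contraR zB; rewrite negb_or -!leNgt => /andP[h1 h2].
by rewrite inE; split; rewrite /= in_itv/= -ler_norml.
Qed.

Lemma supported_integrable1 (rho : R) (g : T1 -> R) (M : R) : measurable_fun setT g ->
  (forall t, `|g t| <= M) -> (forall t, rho < `|t| -> g t = 0) ->
  leb.-integrable setT (EFin \o g).
Proof.
move=> mg gM sg; pose B := `[- rho, rho]%classic : set T1.
have iB : leb.-integrable setT (EFin \o \1_B).
  by apply: integrable_indic; [exact: measurable_itv|exact: lebesgue_segment_fin].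
have := integrable_mul_bounded iB mg gM.
congr integrable; apply/funext => z /=; congr EFin.
rewrite indicE; case: (boolP (z \in B)) => zB; first by rewrite mul1r.
rewrite mul0r sg//; apply: contraR zB; rewrite -!leNgt => h1.
by rewrite inE /B /= in_itv/= -ler_norml.
Qed.

Lemma Rintegral_plane (rho : R) (g : T2 -> R) (M : R) : measurable_fun setT g ->
  (forall z, `|g z| <= M) -> supported rho g ->
  Rintegral leb2 setT g =
  Rintegral leb setT (fun y => Rintegral leb setT (fun x => g (x, y))).
Proof.
move=> mg gM sg; have gi := supported_integrable mg gM sg.
rewrite {1}/Rintegral -integral21_prod_meas1//; congr fine.
apply: eq_integral => y _; rewrite /fubini_G /Rintegral fineK//.
apply: integrable_fin_num => //; apply: (@supported_integrable1 rho _ M).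
- exact: measurable_fun_pair1.
- by move=> x; exact: gM.
- by move=> x hx; apply: sg; rewrite hx.
Qed.

Lemma supported_bounded (rho : R) (g : R * R -> R) : continuous g -> supported rho g ->
  exists M : R, forall z, `|g z| <= M.
Proof.
move=> cg sg; pose B := (`[- rho, rho]%classic `*` `[- rho, rho]%classic) : set (R * R).
have cK : compact B by apply: compact_setX; exact: segment_compact.
have cgK : compact (g @` B) by apply: continuous_compact => //; exact: continuous_subspaceT.
have /compact_bounded[M [Mr HM]] := cgK.
exists (`|M| + 1) => z.
have [/orP h|] := boolP ((rho < `|z.1|) || (rho < `|z.2|)).
  by rewrite sg ?normr0//; apply/orP.
rewrite negb_or -!leNgt => /andP[h1 h2]; apply: HM.
  by apply: le_lt_trans (ler_norm _) _; rewrite ltrDl.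
by exists z => //; split; rewrite /= in_itv/= -ler_norml.
Qed.

Lemma partial_supported rho i (g : R * R -> R) : supported rho g -> supported rho (partial i g).
Proof.
move=> sg z hz; rewrite /partial.
have -> : 'D_(unit_dir i) g z = 'D_(unit_dir i) (cst (0 : R)) z.
  apply: near_eq_derive; case/orP: hz => hz.
    near=> w; apply: sg; apply/orP; left; near: w.
    have : {for z, continuous (fun w : R * R => `|w.1|)}.
      by apply: continuous_comp; [exact: cvg_fst|exact: norm_continuous].
    by move/cvgr_gt; apply.
  near=> w; apply: sg; apply/orP; right; near: w.
  have : {for z, continuous (fun w : R * R => `|w.2|)}.
    by apply: continuous_comp; [exact: cvg_snd|exact: norm_continuous].
  by move/cvgr_gt; apply.
exact: derive_cst.
Unshelve. all: by end_near. Qed.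

(** The Fourier transform at (r, 0) with a phase. Radiality reduces all decay of \hat theta to this
    axis, hence to derivatives in the first variable. *)
Definition axis_transform (g : R * R -> R) (r c : R) : R :=
  Rintegral leb2 setT (fun z => g z * cos (r * z.1 + c)).

Lemma cos_axis_continuous (r c : R) : continuous (fun z : R * R => cos (r * z.1 + c)).
Proof.
have := @cos_dotp_continuous R (r, 0) c.
by under eq_fun do rewrite /dotp /= mul0r addr0.
Qed.

Lemma continuous_supported_integrable rho (g : R * R -> R) : continuous g -> supported rho g ->
  leb2.-integrable setT (EFin \o g).
Proof.
move=> cg sg; have [M gM] := supported_bounded cg sg.
by apply: supported_integrable gM sg; exact: continuous_measurable2.
Qed.

(** Fubini and integration by parts in the first variable. The sine that appears is a cosine of
    phase c - pi/2, so the family of transforms is closed under this step. *)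
Lemma axis_transform_partial (g : R * R -> R) (rho r c : R) : 0 < rho -> smooth g ->
  supported rho g ->
  axis_transform (partial 0 g) r c = r * axis_transform g r (c - pi / 2).
Proof.
move=> rho0 smg sg.
have cg := smooth_continuous smg.
have cdg := smooth_continuous (smooth_partial 0 smg).
have sdg := partial_supported 0 sg.
pose f1 z := partial 0 g z * cos (r * z.1 + c).
pose f2 z := g z * cos (r * z.1 + (c - pi / 2)).
have c1 : continuous f1 by move=> z; apply: cvgM; [exact: cdg|exact: cos_axis_continuous].
have c2 : continuous f2 by move=> z; apply: cvgM; [exact: cg|exact: cos_axis_continuous].
have s1 : supported rho f1 by move=> z /sdg; rewrite /f1 => ->; rewrite mul0r.
have s2 : supported rho f2 by move=> z /sg; rewrite /f2 => ->; rewrite mul0r.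
have i1 := continuous_supported_integrable c1 s1.
have i2 := continuous_supported_integrable c2 s2.
apply/eqP; rewrite -subr_eq0; apply/eqP; rewrite /axis_transform -RintegralZl//.
rewrite -RintegralB//; last exact: integrable_scale.
pose f z := f1 z - r * f2 z.
have cf : continuous f by move=> z; apply: cvgB; [exact: c1|apply: cvgMr; exact: c2].
have sf : supported rho f by move=> z hz; rewrite /f s1// s2// mulr0 subr0.
have [M fM] := supported_bounded cf sf.
rewrite (Rintegral_plane (g := f) _ fM sf); last exact: continuous_measurable2.
transitivity (Rintegral leb setT (fun y : T1 => 0)); last first.
  by rewrite Rintegral_cst ?mul0r.
apply: eq_Rintegral => y _.
(* The support condition says nothing at |t| = rho, so the boundary terms are taken at 2 rho. *)
have e1 t : 2 * rho <= `|t| -> g (t, y) = 0.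
  by move=> h; apply: sg; apply/orP; left => /=; lra.
transitivity (Rintegral leb `[- (2 * rho), 2 * rho] (fun x => f (x, y))).
  rewrite [RHS]Rintegral_mkcond; apply: eq_Rintegral => x _.
  rewrite patchE; case: ifPn => // xN; apply: sf; apply/orP; left => /=.
  rewrite ltNge; apply: contra xN => xr; rewrite inE /= in_itv/= -ler_norml; lra.
transitivity (Rintegral leb `[- (2 * rho), 2 * rho] (fun t =>
   partial 0 g (t, y) * cos (r * t + c) - r * (g (t, y) * sin (r * t + c)))).
  apply: eq_Rintegral => x _; rewrite /f /f1 /f2 /=; congr (_ - _ * (_ * _)).
  by rewrite addrA cosBpihalf.
have ab : - (2 * rho) < 2 * rho by lra.
have dg (t : R) : is_derive t 1 (fun t : R => g (t, y : R)) (partial 0 g (t, y : R)).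
  by apply: slice_derive0; exact: smooth_derivable smg.
apply: (etrans (Rintegral_parts_cos r c ab dg (continuous_slice0 (y := y) cdg))).
by rewrite !e1 ?mul0r ?subr0// ?normrN ler_norm.
Qed.

Lemma axis_transform_norm rho (g : R * R -> R) r c : continuous g -> supported rho g ->
  `|axis_transform g r c| <= Rintegral leb2 setT (fun z => `|g z|).
Proof.
move=> cg sg; have ig := continuous_supported_integrable cg sg.
have ii : leb2.-integrable setT (EFin \o (fun z : T2 => g z * cos (r * z.1 + c))).
  apply: integrable_mul_bounded ig _ (fun z => cos_norm_le1 _).
  by apply: continuous_measurable2; exact: cos_axis_continuous.
apply: le_trans (le_normr_Rintegral measurableT ii) _.
apply: le_Rintegral => //; [exact: integrable_norm|exact: integrable_norm|].
by move=> z _; rewrite normrM ler_piMr// cos_norm_le1.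
Qed.

(** Each power of r is traded for one derivative of g; the induction needs a bound uniform in c
    because each trade shifts the phase. *)
Lemma axis_transform_decay rho (g : R * R -> R) (n : nat) : 0 < rho -> smooth g ->
  supported rho g ->
  exists M : R, forall r c, `|r ^+ n * axis_transform g r c| <= M.
Proof.
move=> rho0; elim: n g => [|n IH] g smg sg.
  exists (Rintegral leb2 setT (fun z => `|g z|)) => r c; rewrite expr0 mul1r.
  exact: axis_transform_norm (smooth_continuous smg) sg.
have [M HM] := IH _ (smooth_partial 0 smg) (partial_supported 0 sg).
exists M => r c; rewrite exprSr -mulrA.
have -> : r * axis_transform g r c = axis_transform (partial 0 g) r (c + pi / 2).
  by rewrite (axis_transform_partial _ _ rho0 smg sg) addrK.
exact: HM.
Qed.

End plane_integral.

(** * Fourier series of the periodized mollifier and of the smoothed kernel *)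

Section unfolding.
Context {R : realType}.
Notation leb2 := (@lebesgue2 R).
Notation T2 := (measurableTypeR R * measurableTypeR R)%type.

Lemma Rintegral_mscale_mrestr d (T : measurableType d) (mu : {measure set T -> \bar R})
    (c : {nonneg R}) (D : set T) (mD : measurable D) (f : T -> R) :
  measurable_fun setT f -> mu.-integrable D (EFin \o f) ->
  Rintegral (mscale c (mrestr mu mD)) setT f = c%:num * Rintegral mu D f.
Proof.
move=> mf fi; have mf' : measurable_fun setT (EFin \o f) by exact/measurable_EFinP.
have fin : (\int[mu]_(x in D) (f x)%:E)%E \is a fin_num by exact: integrable_fin_num.
rewrite /Rintegral -[RHS](fineM (isT : (c%:num)%:E \is a fin_num) fin); congr fine.
have Ep := ge0_integral_mscale_mrestr mu c mD (measurable_funepos mf')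
  (funepos_ge0 (EFin \o f)).
have En := ge0_integral_mscale_mrestr mu c mD (measurable_funeneg mf')
  (funeneg_ge0 (EFin \o f)).
rewrite integralE Ep En [in RHS]integralE.
have Fn : (\int[mu]_(x in D) (EFin \o f)^\- x)%E \is a fin_num.
  exact: integrable_neg_fin_num.
move: Fn; move: (\int[mu]_(x in D) _)%E (\int[mu]_(x in D) _)%E => A B Fn.
by rewrite muleBr//; apply: fin_num_adde_defl; rewrite fin_numN.
Qed.

Lemma cell_integrable (f : T2 -> R) (M : R) : measurable_fun setT f ->
  (forall z, `|f z| <= M) -> leb2.-integrable (@cell R) (EFin \o f).
Proof.
move=> mf fM.
have cfin : (leb2 (@cell R) < +oo)%E.
  pose I : set (measurableTypeR R) := `[0, 2 * pi[%classic.
  have -> : leb2 (@cell R) = (lebesgue_measure I * lebesgue_measure I)%E.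
    exact: product_measure1E.
  have If : (lebesgue_measure I < +oo)%E.
    have := @lebesgue_measure_itv R `[0, 2 * pi[ => /= ->.
    by case: ifP => _ //; rewrite -EFinB ltry.
  by rewrite lte_mul_pinfty// ge0_fin_numE.
apply: measurable_bounded_integrable => //; first exact: measurable_cell.
  exact: measurable_funTS.
exists M; split; first exact: num_real.
by move=> y My z _; apply: le_trans (fM z) (ltW My).
Qed.

Lemma Rintegral_haar_cell (f : T2 -> R) (M : R) : measurable_fun setT f ->
  (forall z, `|f z| <= M) ->
  Rintegral (haar R) setT f = (2 * pi) ^- 2 * Rintegral leb2 (@cell R) f.
Proof.
move=> mf fM.
exact: (Rintegral_mscale_mrestr (NngNum (haar_weight_ge0 R)) (@measurable_cell R) mf
  (cell_integrable mf fM)).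
Qed.

Definition translate (m : int * int) (z : R * R) : R * R := z + (2 * pi) *: lattice m.

Lemma translate_dilate m : translate m = dilate 1 ((2 * pi) *: lattice m) :> (T2 -> T2).
Proof. by apply/funext => -[a b]; rewrite /translate /dilate /= !mul1r. Qed.

(** The only translate of the cell containing z has index floor(z_i / 2 pi) in each coordinate, and
    the bound on z puts this index in the box. *)
Lemma cell_tiling (N : nat) (z : R * R) :
  `|z.1| <= 2 * pi * N%:R -> `|z.2| <= 2 * pi * N%:R ->
  \sum_(m <- box N) \1_(@cell R) (z - (2 * pi) *: lattice m) = 1 :> R.
Proof.
have p0 := @two_pi_gt0 R; set p := 2 * pi in p0 *.
have fl t : `|t| <= p * N%:R -> (`|Num.floor (t / p)| <= N)%N /\
    forall n : int, (0 <= t - p * n%:~R < p) = (n == Num.floor (t / p)).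
  move=> tN; have /andP[h1 h2] := mem_rg1_floor (t / p).
  move: h1 h2; rewrite ler_pdivlMr// ltr_pdivrMr// => h1 h2.
  set f := Num.floor _ in h1 h2 *.
  have [t1 t2] : - (p * N%:R) <= t /\ t <= p * N%:R by apply/andP; rewrite -ler_norml.
  split.
    have a1 : - (N%:Z) - 1 < f.
      rewrite -(ltr_int R) rmorphB rmorphN /= -(ltr_pM2r p0).
      rewrite mulrDl mul1r in h2; rewrite mulrBl mul1r mulNr.
      have : p * N%:R = N%:~R * p by rewrite mulrC.
      lra.
    have a2 : f <= N%:Z.
      rewrite -(ler_int R) -(ler_pM2r p0).
      have : p * N%:R = N%:~R * p by rewrite mulrC.
      lra.
    lia.
  rewrite mulrDl mul1r in h2.
  move=> n; rewrite [p * _]mulrC; apply/idP/eqP => [/andP[n1 n2]|->].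
    have u1 : n < f + 1.
      by rewrite -(ltr_int R) rmorphD /= -(ltr_pM2r p0) mulrDl mul1r; lra.
    have u2 : f < n + 1.
      by rewrite -(ltr_int R) rmorphD /= -(ltr_pM2r p0) mulrDl mul1r; lra.
    lia.
  by apply/andP; split; lra.
move=> /fl[b1 e1] /fl[b2 e2].
rewrite (bigD1_seq (Num.floor (z.1 / p), Num.floor (z.2 / p)))/=; first last.
- exact: box_uniq.
- by rewrite mem_box b1 b2.
have E m : \1_(@cell R) (z - p *: lattice m) =
    (m == (Num.floor (z.1 / p), Num.floor (z.2 / p)))%:R :> R.
  rewrite indicE; congr (nat_of_bool _)%:R; apply/idP/eqP.
    rewrite inE => -[/=]; rewrite !in_itv /= /GRing.scale /= => c1 c2.
    by rewrite [m]surjective_pairing; congr (_, _); apply/eqP; rewrite -?e1 -?e2.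
  by move=> ->; rewrite inE; split; rewrite /= in_itv /= ?e1 ?e2.
rewrite E eqxx big1 ?addr0// => m mN.
by rewrite E (negbTE mN).
Qed.

(** A translation turns the integral of the m-th summand over the cell into the integral of h over
    the m-th translate of the cell; these translates tile the support of h. *)
Lemma unfolding (rho : R) (h : R * R -> R) (M : R) (N : nat) :
  measurable_fun setT (h : T2 -> R) -> (forall z, `|h z| <= M) -> supported rho h ->
  rho <= 2 * pi * N%:R ->
  Rintegral (haar R) setT (fun y => \sum_(m <- box N) h (translate m y)) =
  (2 * pi) ^- 2 * Rintegral leb2 setT h.
Proof.
move=> mh hM sh rN.
have mt m : measurable_fun setT (fun y : T2 => h (translate m y)).
  by rewrite translate_dilate; apply: measurableT_comp => //; exact: measurable_dilate.
have m1 m : measurable_fun setT (fun z : T2 => \1_(@cell R) (translate (- m) z) : R).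
  rewrite translate_dilate; apply: measurableT_comp; last exact: measurable_dilate.
  by apply: measurable_indic; exact: measurable_cell.
have b1 m z : `|\1_(@cell R) (translate (- m) z) : R| <= 1.
  by rewrite indicE; case: (_ \in _); rewrite ?normr1 ?normr0.
have ih := supported_integrable mh hM sh.
have i1 m : leb2.-integrable setT (EFin \o (fun z => h z * \1_(@cell R) (translate (- m) z))).
  exact: integrable_mul_bounded ih (m1 m) (b1 m).
rewrite Rintegral_bigsum; last by move=> m; exact: bounded_integrable (mt m) (fun z => hM _).
transitivity (\sum_(m <- box N) (2 * pi) ^- 2 *
    Rintegral leb2 setT (fun z => h z * \1_(@cell R) (translate (- m) z))).
  apply: eq_bigr => m _; rewrite (Rintegral_haar_cell (mt m) (fun z => hM _)); congr (_ * _).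
  rewrite (Rintegral_dilate ((2 * pi) *: lattice m) ltr01 (i1 m)) expr1n mul1r.
  transitivity (Rintegral leb2 setT ((fun y : T2 => h (translate m y)) \_ (@cell R))).
    exact: Rintegral_mkcond.
  apply: eq_Rintegral => z _.
  rewrite /= -translate_dilate indicE.
  have -> : translate (- m) (translate m z) = z.
    by rewrite /translate latticeN scalerN addrK.
  by case: (_ \in _); rewrite ?mulr1 ?mulr0.
rewrite -mulr_sumr -Rintegral_bigsum//; congr (_ * _); apply: eq_Rintegral => z _.
rewrite -mulr_sumr.
have [hz|] := boolP ((rho < `|z.1|) || (rho < `|z.2|)); first by rewrite sh// mul0r.
rewrite negb_or -!leNgt => /andP[z1 z2].
transitivity (h z * \sum_(m <- box N) \1_(@cell R) (z - (2 * pi) *: lattice m)).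
  by congr (_ * _); apply: eq_bigr => m _; rewrite /translate latticeN scalerN.
by rewrite cell_tiling ?mulr1//; [exact: le_trans z1 rN|exact: le_trans z2 rN].
Qed.

End unfolding.

(** * The Fourier transform of the mollifier *)

Section mollifier_transform.
Context {R : realType}.
Notation leb2 := (@lebesgue2 R).
Notation T2 := (measurableTypeR R * measurableTypeR R)%type.
Variables (theta : R * R -> R) (mol : mollifier theta).

Let cth : continuous theta := smooth_continuous (mollifier_smooth mol).

Lemma le_enorm (z : R * R) : `|z.1| <= enorm z /\ `|z.2| <= enorm z.
Proof.
by split; rewrite -sqrtr_sqr /enorm ler_sqrt ?dotp_ge0// /dotp -!expr2 ?lerDl ?lerDr ?sqr_ge0// addr_ge0 ?sqr_ge0.
Qed.

Lemma mollifier_supported : supported 1 theta.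
Proof.
move=> z hz; apply: (mollifier_support mol); have [z1 z2] := le_enorm z.
by case/orP: hz => hz; [apply: le_trans z1|apply: le_trans z2]; exact: ltW.
Qed.

Lemma mollifier_integrable : leb2.-integrable setT (EFin \o theta).
Proof. exact: continuous_supported_integrable cth mollifier_supported. Qed.

(** The real part of \hat theta, and all of it since theta is even. *)
Definition transform (xi : R * R) : R :=
  Rintegral leb2 setT (fun z => theta z * cos (dotp xi z)).

Lemma Rintegral_plane_opp (f : T2 -> R) : leb2.-integrable setT (EFin \o f) ->
  Rintegral leb2 setT f = Rintegral leb2 setT (fun z => f (- z)).
Proof.
move=> fi; have mN : measurable_fun setT (-%R : T2 -> T2).
  have -> : (-%R : T2 -> T2) = (fun z => 0 - z) by apply/funext => z; rewrite sub0r.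
  exact: measurable_sub2.
have E (A : set T2) : measurable A ->
    leb2 A = ((1%:nng%:num : R)%:E * leb2 ((-%R : T2 -> T2) @^-1` A))%E.
  move=> mA; rewrite mul1e.
  pose phi : {mfun T2 >-> T2} := HB.pack (-%R : T2 -> T2) (isMeasurableFun.Build _ _ _ _ _ mN).
  apply: (product_measure_unique (m' := pushforward leb2 phi)) => // {mA}A B mA mB.
  transitivity (lebesgue2 R ((-%R @^-1` A) `*` (-%R @^-1` B))); first by [].
  have mO (S : set (measurableTypeR R)) : measurable S ->
      measurable ((-%R : measurableTypeR R -> measurableTypeR R) @^-1` S).
    by move=> mS; rewrite -[X in measurable X]setTI; exact: oppr_measurable.
  transitivity (lebesgue_measure ((-%R : measurableTypeR R -> measurableTypeR R) @^-1` A) *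
    lebesgue_measure ((-%R : measurableTypeR R -> measurableTypeR R) @^-1` B))%E.
    by apply: product_measure1E; exact: mO.
  by congr (_ * _)%E; exact: lebesgue_measureN.
have mf : measurable_fun setT f by apply/measurable_EFinP; exact: measurable_int fi.
rewrite (Rintegral_image mN E _ mf) ?mul1r//.
move: fi => /integrableP[mf' fy]; apply/integrableP; split.
  exact: (measurableT_comp mf' mN).
have ma : measurable_fun setT (abse \o (EFin \o f)) by exact: measurableT_comp.
move: fy; rewrite (ge0_integral_image mN E measurableT ma)//.
  by rewrite mul1e.
by move=> z _; exact: abse_ge0.
Qed.

(** The sine part is the integral of an odd function. *)
Lemma transform_phase (xi : R * R) (c : R) :
  Rintegral leb2 setT (fun z => theta z * cos (dotp xi z + c)) = transform xi * cos c.
Proof.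
have mc : measurable_fun setT ((fun z => cos (dotp xi z)) : T2 -> R).
  by have := measurable_cos_dotp xi 0; under eq_fun do rewrite addr0.
have ms : measurable_fun setT ((fun z => sin (dotp xi z)) : T2 -> R).
  by have := measurable_sin_dotp xi 0; under eq_fun do rewrite addr0.
have ic := integrable_mul_bounded mollifier_integrable mc (fun z => cos_norm_le1 _).
have isn := integrable_mul_bounded mollifier_integrable ms (fun z => sin_norm_le1 _).
have s0 : Rintegral leb2 setT (fun z => theta z * sin (dotp xi z)) = 0.
  have := Rintegral_plane_opp isn.
  have -> : (fun z => theta (- z) * sin (dotp xi (- z))) =
      (fun z => -1 * (theta z * sin (dotp xi z))).
    by apply/funext => z; rewrite (mollifier_even mol) dotpNr sinN mulrN mulN1r.
  by rewrite RintegralZl//; lra.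
transitivity (Rintegral leb2 setT (fun z =>
    cos c * (theta z * cos (dotp xi z)) - sin c * (theta z * sin (dotp xi z)))).
  by apply: eq_Rintegral => z _; rewrite cosD; ring.
rewrite RintegralB//; [|exact: integrable_scale..].
by rewrite !RintegralZl// s0 mulr0 subr0 mulrC.
Qed.

Lemma fourier_plane_transform xi : fourier_plane theta xi = Complex (transform xi) 0.
Proof.
rewrite /fourier_plane /complex_integral; congr Complex.
  by apply: eq_Rintegral => z _; rewrite /cis /= cosN mul0r subr0.
have := transform_phase xi (pi / 2); rewrite cos_pihalf mulr0 => <-.
apply: eq_Rintegral => z _; rewrite /cis /= mul0r addr0 sinN cosDpihalf.
by [].
Qed.

Hypothesis rad : radial (fourier_plane theta).

Lemma transform_radial xi : transform xi = transform (enorm xi, 0).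
Proof.
have := rad (x := xi) (y := (enorm xi, 0)); rewrite !fourier_plane_transform => H.
suff /H[] : enorm xi = enorm ((enorm xi, 0) : R * R) by [].
by rewrite {2}/enorm /dotp /= mulr0 addr0 -expr2 sqrtr_sqr ger0_norm ?sqrtr_ge0.
Qed.

Lemma transform_decay (n : nat) : exists M : R, forall r, `|r ^+ n * transform (r, 0)| <= M.
Proof.
have [M HM] := axis_transform_decay n ltr01 (mollifier_smooth mol) mollifier_supported.
exists M => r; have := HM r 0; congr (`|_ * _| <= _).
by apply: eq_Rintegral => z _; rewrite /dotp /= mul0r.
Qed.

Definition lnorm (k : int * int) : R := enorm (lattice k).

Lemma lnorm_gt0 k : k != 0 -> 0 < lnorm k.
Proof.
move=> k0; have h : 0 < lnorm k ^+ 2 by rewrite /lnorm lnorm2E lt0r lnorm2_eq0 k0 lnorm2_ge0.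
by rewrite lt0r sqrtr_ge0 andbT; apply: contraTneq h => ->; rewrite expr0n ltxx.
Qed.

Lemma transform_lattice (l : R) k : 0 < l -> transform (l *: lattice k) = transform (l * lnorm k, 0).
Proof.
move=> l0; rewrite transform_radial; congr (transform (_, 0)).
rewrite /lnorm /enorm /dotp /= /GRing.scale /=.
rewrite -[in RHS](ger0_norm (ltW l0)) -sqrtr_sqr -sqrtrM ?sqr_ge0//.
by congr Num.sqrt; ring.
Qed.

Lemma transform_lattice_decay (l : R) : 0 < l -> exists A : R, forall k,
  `|transform (l *: lattice k)| <= A * (lweight 1 k.1 * lweight 1 k.2).
Proof.
move=> l0; have [M4 H4] := transform_decay 4; have [M0 H0] := transform_decay 0.
have M40 : 0 <= M4 by apply: le_trans (H4 0).
have M00 : 0 <= M0 by apply: le_trans (H0 0).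
(* M0 serves k = 0, where both weights are 1. For k <> 0, decay of order 4 gives M4 l^{-4} |k|^{-4},
   and |k|^{-4} is at most 4 times the product of the weights. *)
exists (M0 + 4 * (l ^- 4 * M4)) => k; rewrite transform_lattice// mulrDl.
have w0 : 0 <= lweight 1 k.1 * lweight 1 k.2 :> R by rewrite mulr_ge0 ?ltW ?lweight_gt0.
have [->|k0] := eqVneq k 0.
  rewrite -[leLHS]addr0 lerD//; last by rewrite !mulr_ge0// ?invr_ge0 ?exprn_ge0// ?(ltW l0) ?ltW ?lweight_gt0.
  have := H0 (l * lnorm 0); rewrite expr0 mul1r => h; apply: le_trans h _.
  by rewrite /lweight /= expr0n /= addr0 !powR1 !mulr1.
rewrite -[leLHS]add0r lerD//; first by rewrite mulr_ge0.
have n1 : 1 <= lnorm2 k :> R by exact: lnorm2_ge1.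
have n0 : 0 < lnorm2 k :> R by exact: lt_le_trans n1.
have := H4 (l * lnorm k); rewrite normrM (ger0_norm (x := _ ^+ 4)); last first.
  by rewrite exprn_ge0// mulr_ge0 ?sqrtr_ge0// ltW.
have -> : (l * lnorm k) ^+ 4 = l ^+ 4 * lnorm2 k ^+ 2.
  by rewrite exprMn -lnorm2E -exprM.
have l40 : 0 < l ^+ 4 by rewrite exprn_gt0.
have n20 : 0 < lnorm2 k ^+ 2 :> R by rewrite exprn_gt0.
rewrite -ler_pdivlMl ?mulr_gt0// => h; apply: le_trans h _.
have := @lnorm2_powR_le R 1 k ler01 k0.
rewrite powRr1// powRN powR_mulrn ?(ltW n0)// => h.
have c0 : 0 <= l ^- 4 * M4 by rewrite mulr_ge0// invr_ge0 ltW.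
have E1 : (l ^+ 4 * lnorm2 k ^+ 2)^-1 * M4 = l ^- 4 * M4 * lnorm2 k ^- 2.
  by rewrite invfM mulrAC.
rewrite E1; apply: le_trans (ler_wpM2l c0 h) _.
by rewrite [leLHS]mulrCA mulrA.
Qed.

End mollifier_transform.

(** * Fourier series of the periodized mollifier *)

Section periodization.
Context {R : realType}.
Notation leb2 := (@lebesgue2 R).
Notation T2 := (measurableTypeR R * measurableTypeR R)%type.
Variables (theta : R * R -> R) (mol : mollifier theta) (l : R) (l0 : 0 < l).

(** If |m_i| >= N + 1, then |x_i + 2 pi m_i| >= 2 pi (N + 1) - |x_i| > l, so the argument of theta
    leaves its support. *)
Lemma periodized_box (N : nat) (x : R * R) :
  `|x.1| + l <= 2 * pi * N%:R -> `|x.2| + l <= 2 * pi * N%:R ->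
  periodized theta l x =
  (2 * pi) ^+ 2 * (l ^- 2 * \sum_(m <- box N) theta (l^-1 *: translate m x)).
Proof.
move=> h1 h2; rewrite /periodized [in RHS]mulr_sumr; congr (_ * _).
transitivity (\sum_(m <- box N | m \in [set: int * int]) l ^- 2 * theta (l^-1 *: translate m x)); last first.
  by apply: eq_bigl => m; rewrite in_setT.
apply: fsbigE => //; first exact: box_uniq.
move=> m _; rewrite mem_box negb_and -!ltnNge => hm.
rewrite (mollifier_supported mol) ?mulr0//=.
have p0 := @two_pi_gt0 R; rewrite /GRing.scale /=.
have H (t : R) (n : int) : `|t| + l <= 2 * pi * N%:R -> (N < `|n|)%N ->
    1 < `|l^-1 * (t + 2 * pi * n%:~R)|.
  move=> ht hn; rewrite normrM gtr0_norm ?invr_gt0// mulrC ltr_pdivlMr// mul1r.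
  have : (N%:R : R) + 1 <= `|n%:~R|.
      have : N.+1%:Z <= `|n| by lia.
    by rewrite -(ler_int R) intr_norm natr1.
  rewrite -(ler_pM2l p0) mulrDr mulr1 => h.
  have := lerB_normD (2 * pi * n%:~R) t; rewrite normrM (gtr0_norm p0) [_ + t]addrC.
  lra.
by case/orP: hm => hm; apply/orP; [left|right]; exact: H.
Qed.

Lemma box_radius (B : R) : exists N : nat, B <= 2 * pi * N%:R.
Proof.
have p0 := @two_pi_gt0 R.
exists (Num.truncn (`|B| / (2 * pi))).+1.
apply: le_trans (ler_norm _) _; rewrite mulrC -ler_pdivrMr//.
by apply: ltW; exact: truncnS_gt.
Qed.

Lemma continuous_scaled m : continuous (fun x : R * R => theta (l^-1 *: translate m x)).
Proof.
move=> x; apply: continuous_comp; last exact: smooth_continuous (mollifier_smooth mol) _.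
by apply: cvgZr; apply: cvgD; [exact: cvg_id|exact: cvg_cst].
Qed.

Lemma continuous_box_sum (s : seq (int * int)) :
  continuous (fun x : R * R => \sum_(m <- s) theta (l^-1 *: translate m x)).
Proof.
elim: s => [|m s IH].
  have -> : (fun x : R * R => \sum_(m <- [::]) theta (l^-1 *: translate m x)) = cst 0.
    by apply/funext => x; rewrite big_nil.
  by move=> x; exact: cvg_cst.
have -> : (fun x : R * R => \sum_(m <- m :: s) theta (l^-1 *: translate m x)) =
    (fun x => theta (l^-1 *: translate m x) + \sum_(m <- s) theta (l^-1 *: translate m x)).
  by apply/funext => x; rewrite big_cons.
by move=> x; apply: cvgD; [exact: continuous_scaled|exact: IH].
Qed.

(** On the unit neighbourhood of x one finite box of translates serves all points, whence the margin
    1 in the choice of N. *)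
Lemma periodized_continuous : continuous (periodized theta l).
Proof.
move=> x; have [N] := box_radius (`|x.1| + `|x.2| + 1 + l) => hN.
pose g := fun y : R * R =>
  (2 * pi) ^+ 2 * (l ^- 2 * \sum_(m <- box N) theta (l^-1 *: translate m y)).
have E : \forall y \near x, g y = periodized theta l y.
  near=> y.
  have h1 : `|y.1| < `|x.1| + 1.
    near: y; have : {for x, continuous (fun w : R * R => `|w.1|)}.
      by apply: continuous_comp; [exact: cvg_fst|exact: norm_continuous].
    by move/cvgr_lt; apply; rewrite ltrDl.
  have h2 : `|y.2| < `|x.2| + 1.
    near: y; have : {for x, continuous (fun w : R * R => `|w.2|)}.
      by apply: continuous_comp; [exact: cvg_snd|exact: norm_continuous].
    by move/cvgr_lt; apply; rewrite ltrDl.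
  have n1 := normr_ge0 x.1; have n2 := normr_ge0 x.2.
  by rewrite (@periodized_box N)//; move: hN h1 h2 n1 n2; lra.
rewrite /continuous_at -(nbhs_singleton E).
apply: cvg_trans (near_eq_cvg E) _.
by apply: cvgMr; apply: cvgMr; exact: continuous_box_sum.
Unshelve. all: by end_near. Qed.

Lemma periodized_periodic : torus_periodic (periodized theta l).
Proof.
move=> x n; rewrite /periodized; congr (_ * _).
rewrite [RHS](reindex_fsbigT (fun m => m + n)); last first.
  by exists (fun m => m - n) => m; rewrite ?addrK ?subrK.
apply: eq_fsbigr => m _; congr (_ * theta (_ *: _)).
by rewrite latticeD scalerDr addrA addrAC.
Qed.

Lemma periodized_bounded : exists M : R, forall x, `|periodized theta l x| <= M.
Proof.
exact: periodic_continuous_bounded periodized_continuous periodized_periodic.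
Qed.

Lemma fmode_periodized k x : fmode k (periodized theta l) x =
  transform theta (l *: lattice k) * cos (dotp (lattice k) x).
Proof.
have p0 := @two_pi_gt0 R.
pose h z := theta (l^-1 *: z) * cos (dotp (lattice k) (x - z)).
have cc : continuous (fun z : R * R => cos (dotp (lattice k) (x - z))).
  have -> : (fun z : R * R => cos (dotp (lattice k) (x - z))) =
      (fun z : R * R => cos (dotp (- lattice k) z + dotp (lattice k) x)).
    by apply/funext => y; rewrite dotpDr dotpNl dotpNr addrC.
  exact: cos_dotp_continuous.
have ch : continuous h.
  move=> z; apply: cvgM.
    apply: continuous_comp; last exact: smooth_continuous (mollifier_smooth mol) _.
    by apply: cvgZr; exact: cvg_id.
  exact: cc.
have sh : supported l h.
  move=> z hz; rewrite /h (mollifier_supported mol) ?mul0r//=.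
  have H (t : R) : l < `|t| -> 1 < `|l^-1 * t|.
    by move=> lt; rewrite normrM gtr0_norm ?invr_gt0// mulrC ltr_pdivlMr// mul1r.
  by case/orP: hz => hz; apply/orP; [left|right]; exact: H.
have [M hM] := supported_bounded ch sh.
have mh := continuous_measurable2 ch.
have [N hN] := box_radius (2 * pi + l).
have [B pB] := periodized_bounded.
have mp := continuous_measurable2 periodized_continuous.
have mt m : measurable_fun setT (fun y : T2 => h (translate m y)).
  by rewrite translate_dilate; apply: measurableT_comp => //; exact: measurable_dilate.
transitivity (((2 * pi) ^+ 2 * l ^- 2) *
    Rintegral (haar R) setT (fun y => \sum_(m <- box N) h (translate m y))).
  rewrite -RintegralZl//; last first.
    by apply: integrable_bigsum => m; exact: bounded_integrable (mt m) (fun z => hM _).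
  rewrite /fmode (@Rintegral_haar_cell _ _ B); first last.
  - by move=> z; rewrite normrM -[B]mulr1 ler_pM// cos_norm_le1.
  - by apply: measurable_funM => //; exact: measurable_fmode_kernel.
  rewrite (@Rintegral_haar_cell _ _ (`|(2 * pi) ^+ 2 * l ^- 2| * \sum_(m <- box N) M)); first last.
  - move=> z; rewrite normrM ler_wpM2l//; apply: le_trans (ler_norm_sum _ _ _) _.
    by apply: ler_sum => m _; exact: hM.
  - by apply: measurable_funM => //; apply: measurable_sum => m; exact: mt.
  congr (_ * _); apply: eq_Rintegral => y; rewrite inE => -[/=]; rewrite !in_itv /=.
  move=> /andP[y1 y1'] /andP[y2 y2'].
  rewrite (@periodized_box N); [|rewrite ger0_norm//; lra..].
  rewrite -mulrA -[RHS]mulrA; apply: congr1; rewrite -mulrA; apply: congr1.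
  rewrite mulr_suml; apply: eq_bigr => m _.
  (* The cosine is periodic in y, so it may be evaluated at the translate and brought inside the
     sum. *)
  rewrite /h; congr (_ * _); rewrite /translate opprD addrA.
  have := torus_shift_dotp k (x - y) (- m).
  by rewrite latticeN scalerN => ->; rewrite cos_add_2pi.
have hl : l <= 2 * pi * N%:R by move: hN; lra.
rewrite (unfolding mh hM sh hl) (Rintegral_dilate 0 l0 (supported_integrable mh hM sh)).
have -> : Rintegral leb2 setT (h \o dilate l 0) =
    Rintegral leb2 setT (fun z => theta z * cos (dotp (- (l *: lattice k)) z + dotp (lattice k) x)).
  apply: eq_Rintegral => z _; rewrite /h /=.
  have -> : dilate l 0 z = l *: z by rewrite /dilate /= !addr0.
  rewrite scalerA mulVf ?gt_eqF// scale1r dotpDr dotpNr dotpNl; congr (_ * cos _).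
  by rewrite addrC; congr (- _ + _); rewrite /dotp /= /GRing.scale /=; ring.
rewrite (transform_phase mol).
have -> : transform theta (- (l *: lattice k)) = transform theta (l *: lattice k).
  by apply: eq_Rintegral => z _; rewrite dotpNl cosN.
have q0 : (2 * pi) ^+ 2 != 0 :> R by rewrite expf_neq0// gt_eqF.
have r0 : l ^+ 2 != 0 by rewrite expf_neq0// gt_eqF.
by rewrite mulrACA divff// mul1r mulKf.
Qed.

Hypothesis rad : radial (fourier_plane theta).

Lemma periodized_series x : periodized theta l x =
  lsum (fun k => transform theta (l *: lattice k) * cos (dotp (lattice k) x)).
Proof.
have [B pB] := periodized_bounded; have [A HA] := transform_lattice_decay mol rad l0.
rewrite -(@fourier_inversion _ (periodized theta l) x).
- by congr lsum; apply/funext => k; rewrite fmode_periodized.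
- by apply: bounded_integrable pB; exact: continuous_measurable2 periodized_continuous.
- apply: lsummable_le (lsummableZ A (@lsummable_lweight R 1 _)); last lra.
  move=> k; rewrite fmode_periodized normrM; apply: le_trans (HA k).
  by rewrite ler_piMr// cos_norm_le1.
- exact: periodic_local_bound periodized_periodic pB (periodized_continuous (x := x)).
Qed.

End periodization.

(** * Fourier series of the smoothed Biot-Savart kernel *)

Section kernel_series.
Context {R : realType}.
Notation T2 := (measurableTypeR R * measurableTypeR R)%type.
Variables (theta : R * R -> R) (mol : mollifier theta).
Hypothesis rad : radial (fourier_plane theta).
Variables (K : vfield R) (bs : biot_savart K).

(* \hat K(k) = i kappa k; kappa 0 = 0 thanks to the convention x / 0 = 0. *)
Definition kappa (k : int * int) (i : 'I_2) : R :=
  vec (perp (lattice k)) i 0 / lnorm2 k.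

Lemma kappa0 i : kappa 0 i = 0.
Proof. by rewrite /kappa /lnorm2 /= expr0n addr0 invr0 mulr0. Qed.

Lemma kappa_prod k i j : k != 0 -> kappa k i * kappa k j = leray_symbol k i j / lnorm2 k.
Proof.
move=> k0; have : lnorm2 k != 0 :> R by rewrite lnorm2_eq0.
have kE m : kcoord k m = if m == 0 then k.1%:~R else k.2%:~R :> R by rewrite /kcoord; case: eqP.
rewrite leray_symbolE /kappa /vec /perp !mxE !kE /lattice /= /lnorm2.
move: (k.1%:~R : R) (k.2%:~R : R) => a b n0; move: i j.
by do 2!apply: ord2P => /=; field.
Qed.

(** The square of a component of [kappa k] is a diagonal entry of P_k over |k|^2. *)
Lemma kappa_norm_le1 k i : `|kappa k i| <= 1.
Proof.
have [->|k0] := eqVneq k 0; first by rewrite kappa0 normr0.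
rewrite -(@ler_pXn2r _ 2)// ?nnegrE// expr1n -normrX ger0_norm ?sqr_ge0//.
rewrite expr2 kappa_prod//; have n1 := @lnorm2_ge1 R _ k0.
have n0 : 0 < lnorm2 k :> R by apply: lt_le_trans n1.
rewrite ler_pdivrMr// mul1r; apply: le_trans n1.
by apply: le_trans (ler_norm _) _; exact: leray_norm_le1.
Qed.

Lemma biot_savart_coefs k i :
  coscoef k (component K i) = 0 /\ sincoef k (component K i) = - kappa k i.
Proof.
have iK := biot_savart_integrable bs i.
have E : fourier_coef (component K i) k =
    Complex (coscoef k (component K i)) (- sincoef k (component K i)).
  rewrite /fourier_coef /complex_integral; congr Complex.
    by apply: eq_Rintegral => z _; rewrite /cis /= cosN mul0r subr0.
  rewrite -mulN1r -RintegralZl//; last exact: integrable_sink.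
  by apply: eq_Rintegral => z _; rewrite /cis /= mul0r addr0 sinN mulrN mulN1r.
have [k0|k0] := eqVneq k 0.
  move: E; rewrite k0 biot_savart_coef0// kappa0 oppr0 => E.
  split; first by have := congr1 (@complex.Re R) E; rewrite /= => <-.
  by apply: oppr_inj; have := congr1 (@complex.Im R) E; rewrite /= => <-; rewrite oppr0.
by move: E; rewrite biot_savart_coef// lnorm2E => -[<- h]; split => //; rewrite /kappa h opprK.
Qed.

(** After the reflection y -> x - y the integrand is K(y) theta_l(u - y) with u = x - x0. The series
    of theta_l converges normally and is integrated against K, each term giving a mode of K, which
    is a pure sine since \hat K is imaginary. *)
Lemma smoothed_kernel_series (l : R) (x x0 : R * R) (i : 'I_2) : 0 < l ->
  smoothed_kernel K theta l x x0 i 0 =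
  - lsum (fun k => transform theta (l *: lattice k) * (kappa k i * sin (dotp (lattice k) (x - x0)))).
Proof.
move=> l0; have [A HA] := transform_lattice_decay mol rad l0.
have iK := biot_savart_integrable bs i.
have pK : torus_periodic (component K i).
  by move=> y m; rewrite /component (biot_savart_periodic bs).
have [B pB] := periodized_bounded mol l0.
have cp := periodized_continuous mol l0.
have mK : measurable_fun setT (component K i : T2 -> R).
  by apply/measurable_EFinP; exact: measurable_int iK.
pose u := x - x0.
pose f := fun y : T2 => component K i y * periodized theta l (u - y).
rewrite mxE; transitivity (Rintegral (haar R) setT (fun y => f (x - y))).
  apply: eq_Rintegral => y _; rewrite /f /u; congr (_ * periodized _ _ _).
  by rewrite opprB [RHS]addrC [RHS]addrA subrK.
rewrite haar_reflect; first last.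
- move=> y m; rewrite /f pK; congr (_ * _).
  by rewrite opprD addrA -scalerN -latticeN (periodized_periodic theta l).
- apply: measurable_funM => //.
  by apply: (measurableT_comp (continuous_measurable2 cp)); exact: measurable_sub2.
pose F k (y : T2) := transform theta (l *: lattice k) * cos (dotp (lattice k) (u - y)).
have mF k : measurable_fun setT (F k).
  by apply: measurable_funM => //; exact: measurable_fmode_kernel.
have bF k y : `|F k y| <= A * (lweight 1 k.1 * lweight 1 k.2).
  by rewrite normrM; apply: le_trans (HA k); rewrite ler_piMr// cos_norm_le1.
have sb : lsummable (fun k : int * int => A * (lweight 1 k.1 * lweight 1 k.2)).
  by apply: lsummableZ; apply: lsummable_lweight; lra.
have [_ E] := lsum_integral sb mF bF iK.
transitivity (Rintegral (haar R) setT (fun y => lsum (F ^~ y) * component K i y)).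
  by apply: eq_Rintegral => y _; rewrite /f (periodized_series mol l0 rad) mulrC.
rewrite -E -mulN1r -lsumZ.
  congr lsum; apply/funext => k.
  transitivity (transform theta (l *: lattice k) * fmode k (component K i) u).
    rewrite -RintegralZl//; last exact: integrable_fmode.
    by apply: eq_Rintegral => y _; rewrite /F -mulrA [cos _ * _]mulrC.
  have [c0 s0] := biot_savart_coefs k i.
  by rewrite fmode_coef// c0 s0 mul0r add0r mulN1r mulNr mulrN.
apply: lsummable_le sb => k; rewrite normrM; apply: le_trans (HA k).
rewrite ler_piMr// normrM -[leRHS]mulr1 ler_pM ?kappa_norm_le1 ?sin_norm_le1//.
Qed.

End kernel_series.

(** * Covariance of the vortex field *)

Section integration_tools.
Context {R : realType}.
Notation leb := (@lebesgue_measure R).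
Notation T1 := (measurableTypeR R).
Notation T2 := (measurableTypeR R * measurableTypeR R)%type.

(** Monotone convergence along the squares: the integrals of the partial sums stay below the bound
    for the series of integrals. *)
Lemma lsum_ge0_integrable d (T : measurableType d) (mu : {measure set T -> \bar R})
    (H : int * int -> T -> R) : (forall k, mu.-integrable setT (EFin \o H k)) ->
  (forall k x, 0 <= H k x) -> (forall x, lsummable (H ^~ x)) ->
  lsummable (fun k => Rintegral mu setT (H k)) ->
  mu.-integrable setT (EFin \o (fun x => lsum (H ^~ x))).
Proof.
move=> iH H0 sH [M HM].
have mH k : measurable_fun setT (H k) by apply/measurable_EFinP; exact: measurable_int (iH k).
have ml := measurable_lsum mH sH.
have l0 x : 0 <= lsum (H ^~ x).
  have := lsum_cvg (sH x) => h; rewrite -(cvg_lim _ h)//; apply: limr_ge; first exact: cvgP h.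
  by apply: nearW => N; exact: sumr_ge0.
apply/integrableP; split; first exact/measurable_EFinP.
rewrite (eq_integral (fun x => (lsum (H ^~ x))%:E)); last first.
  by move=> x _ /=; rewrite ger0_norm.
pose g N x := (\sum_(k <- box N) H k x)%:E.
have E x : (lsum (H ^~ x))%:E = limn (g ^~ x).
  apply/esym/cvg_lim => //; apply: cvg_EFin; first exact: nearW.
  exact: lsum_cvg.
under eq_integral do rewrite E.
rewrite monotone_convergence//; first last.
- move=> x _ m n mn; rewrite lee_fin; apply: ler_sum_subset => //; [exact: box_uniq..|].
  exact: box_sub.
- by move=> n x _; rewrite lee_fin; exact: sumr_ge0.
- by move=> n; apply/measurable_EFinP; exact: measurable_sum.
have B N : (\int[mu]_x g N x <= M%:E)%E.
  have ig : mu.-integrable setT (EFin \o (fun x => \sum_(k <- box N) H k x)).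
    exact: integrable_bigsum.
  rewrite -(fineK (integrable_fin_num measurableT ig)) lee_fin.
  have := HM _ (@box_uniq N); congr (_ <= _).
  transitivity (Rintegral mu setT (fun x => \sum_(k <- box N) H k x)); last by [].
  rewrite Rintegral_bigsum//; apply: eq_bigr => k _.
  by rewrite ger0_norm//; apply: Rintegral_ge0.
apply: le_lt_trans (ltry M); apply: lime_le; last exact: nearW.
apply: ereal_nondecreasing_is_cvgn => m n mn; apply: ge0_le_integral => //.
- by move=> x _; rewrite lee_fin; exact: sumr_ge0.
- by apply/measurable_EFinP; exact: measurable_sum.
- by apply/measurable_EFinP; exact: measurable_sum.
move=> x _; rewrite lee_fin; apply: ler_sum_subset => //; [exact: box_uniq..|].
exact: box_sub.
Qed.

Lemma integral_powR (b x y : R) : b + 1 != 0 -> 0 < x -> x < y ->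
  (\int[leb]_(r in `[x, y]) (r `^ b)%:E = ((y `^ (b + 1) - x `^ (b + 1)) / (b + 1))%:E)%E.
Proof.
move=> b1 x0 xy.
have cp c (t : R) : 0 < t -> {for t, continuous (fun r : R => r `^ c)}.
  by move=> t0; exact: is_derive_continuous (is_derive1_powR c t0).
have dF (t : R) : 0 < t -> is_derive t 1 (fun r : R => (b + 1)^-1 * r `^ (b + 1)) (t `^ b).
  move=> t0; have dp := is_derive1_powR (b + 1) t0.
  apply: is_derive_eq (is_deriveZ (b + 1)^-1 dp) _.
  by rewrite addrK /GRing.scale /= mulKf.
rewrite (@continuous_FTC2 _ _ (fun r : R => (b + 1)^-1 * r `^ (b + 1)))//.
- by rewrite -EFinB -mulrBr mulrC.
- apply: continuous_in_subspaceT => t; rewrite inE /= in_itv /= => /andP[xt _].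
  by apply: cp; exact: lt_le_trans xt.
- split.
  + move=> t; rewrite in_itv /= => /andP[xt _].
    by apply: ex_derive; apply: dF; exact: lt_trans xt.
  + apply: cvg_at_right_filter; apply: is_derive_continuous (dF _ x0).
  + apply: cvg_at_left_filter; apply: is_derive_continuous (dF _ _).
    exact: lt_trans xy.
- move=> t; rewrite in_itv /= => /andP[xt _].
  by rewrite derive1E; have [_ ->] := dF _ (lt_trans x0 xt).
Qed.

Lemma segment_split (u c v r : R) : u <= c -> c <= v ->
  (u <= r <= c \/ c < r <= v) <-> u <= r <= v.
Proof.
move=> uc cv; split.
  by case=> /andP[h1 h2]; apply/andP; split; lra.
by move=> /andP[h1 h2]; case: (leP r c) => hr; [left|right]; apply/andP.
Qed.

(** The half-line is split at 1: r^a is integrable at 0 and r^{-2} at infinity. Both bounds are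
    applied on segments exhausting the half-line. *)
Lemma powR_dominated_integral (g : R -> R) (a A B : R) : -1 < a ->
  measurable_fun setT (g : T1 -> R) -> (forall r, 0 <= g r) ->
  (forall r, 0 < r -> g r <= A * r `^ a) -> (forall r, 0 < r -> g r <= B * r `^ (- 2)) ->
  (\int[leb]_(r in `]0%R, +oo[) (g r)%:E < +oo)%E.
Proof.
move=> a1 mg g0 gA gB.
have mgE : measurable_fun setT (EFin \o (g : T1 -> R)) by exact/measurable_EFinP.
have A0 : 0 <= A by have := gA 1 ltr01; rewrite powR1 mulr1; exact: le_trans.
have B0 : 0 <= B by have := gB 1 ltr01; rewrite powR1 mulr1; exact: le_trans.
have dom b c x y : b + 1 != 0 -> 0 < x -> x < y -> 0 <= c ->
    (forall r, 0 < r -> g r <= c * r `^ b) ->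
    (\int[leb]_(r in `[x, y]) (g r)%:E <= (c * ((y `^ (b + 1) - x `^ (b + 1)) / (b + 1)))%:E)%E.
  move=> b1 x0 xy c0 gc; rewrite EFinM -(integral_powR b1 x0 xy) -ge0_integralZl//; last 2 first.
  - by apply/measurable_EFinP; apply: measurable_funTS; exact: measurable_powR.
  - by move=> r _; rewrite lee_fin powR_ge0.
  apply: ge0_le_integral => //.
  - by move=> r _; rewrite lee_fin.
  - exact: measurable_funTS.
  - apply/measurable_EFinP; apply: measurable_funTS; exact: measurable_funM.
  - move=> r /=; rewrite in_itv /= => /andP[xr _]; rewrite -EFinM lee_fin.
    by apply: gc; exact: lt_le_trans xr.
(* Starting at n + 2 keeps 1/(n + 2) < 1 < n + 2 strict, so both pieces are nondegenerate. *)
pose F (n : nat) : set T1 := `[n.+2%:R^-1, 1]%classic `|` `]1, n.+2%:R]%classic.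
have F2 (n : nat) : 1 < n.+2%:R :> R by rewrite ltr1n.
have Fi (n : nat) : n.+2%:R^-1 < 1 :> R by rewrite invf_lt1// ltr0n.
have Fp (n : nat) : 0 < n.+2%:R^-1 :> R by rewrite invr_gt0 ltr0n.
have FE n r : F n r <-> n.+2%:R^-1 <= r <= n.+2%:R.
  by rewrite /F /= !in_itv /=; exact: segment_split (ltW (Fi n)) (ltW (F2 n)).
have EF : `]0%R, +oo[%classic = \bigcup_n F n.
  apply/seteqP; split => r /=.
    rewrite in_itv /= andbT => r0; exists (Num.truncn (r + r^-1)) => //; apply/FE.
    have h := truncnS_gt (r + r^-1); have ri : 0 < r^-1 by rewrite invr_gt0.
    have h2 : r + r^-1 <= (Num.truncn (r + r^-1)).+2%:R.
      by apply: ltW; apply: lt_trans h _; rewrite ltr_nat.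
    apply/andP; split; last lra.
    by rewrite -[leRHS]invrK lef_pV2 ?posrE ?ltr0n//; lra.
  by move=> [n _ /FE/andP[h _]]; rewrite in_itv /= andbT; exact: lt_le_trans h.
have mF n : measurable (F n) by apply: measurableU.
rewrite EF; have H := @ge0_nondecreasing_set_cvg_integral _ _ _ F (fun r => (g r)%:E) leb.
have ndF : nondecreasing_seq F.
  move=> m n mn; apply/subsetPset => r /FE/andP[h1 h2]; apply/FE/andP; split.
    by apply: le_trans h1; rewrite lef_pV2 ?posrE ?ltr0n// ler_nat !ltnS.
  by apply: le_trans h2 _; rewrite ler_nat !ltnS.
have {}H := H ndF mF (fun n => measurable_funTS mgE) (fun n r _ => g0 r).
have -> := esym (cvg_lim (@ereal_hausdorff R) H).
(* The integrals of r^a over ]0, 1] and of r^{-2} over [1, +oo[ are 1/(a + 1) and 1. *)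
apply: le_lt_trans (ltry (A * (a + 1)^-1 + B)); apply: lime_le; first exact: cvgP H.
apply: nearW => n; rewrite ge0_integral_setU//; first last.
- by apply/disj_setPS => r [] /=; rewrite !in_itv /= => /andP[_ r1] /andP[r1' _]; lra.
- by move=> r _; rewrite lee_fin.
- exact: measurable_funTS.
rewrite EFinD leeD//.
  have a10 : 0 < a + 1 by lra.
  have := dom a A _ _ (lt0r_neq0 a10) (Fp n) (Fi n) A0 gA; move/le_trans; apply.
  rewrite lee_fin ler_wpM2l// powR1 -[leRHS]mul1r ler_wpM2r//.
    by rewrite invr_ge0 ltW.
have b1 : - 2 + 1 != 0 :> R by rewrite lt_eqF//; lra.
have := dom _ B _ _ b1 ltr01 (F2 n) B0 gB => h.
apply: (@le_trans _ _ (\int[leb]_(r in `[1%R, n.+2%:R%R]) (g r)%:E)%E).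
  apply: ge0_subset_integral => //.
  - exact: measurable_funTS.
  - by move=> r _; rewrite lee_fin.
  - by apply: subset_itvr; rewrite bnd_simp.
apply: le_trans h _; rewrite lee_fin -[leRHS]mulr1 ler_wpM2l// powR1.
have -> : - 2 + 1 = - 1 :> R by ring.
by rewrite invrN1 mulrN1 opprB gerBl powR_ge0.
Qed.

(** f has the same integrals over measurable sets as the Radon-Nikodym derivative of nu, hence
    agrees with it almost everywhere. *)
Lemma integral_density (nu : probability T1 R) (f : T1 -> R) (psi : T1 -> \bar R) :
  measurable_fun setT f -> (forall r, 0 <= f r) ->
  (forall A, measurable A -> nu A = \int[leb]_(r in A) (f r)%:E)%E ->
  measurable_fun setT psi -> (forall r, 0 <= psi r)%E ->
  (\int[nu]_r psi r = \int[leb]_r (psi r * (f r)%:E))%E.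
Proof.
move=> mf f0 nuE mpsi psi0.
have dom : nu `<< leb.
  apply/null_content_dominatesP => A mA A0; rewrite nuE//.
  by apply: null_set_integral => //; apply/measurable_EFinP; exact: measurable_funTS.
rewrite -(Radon_Nikodym_SigmaFinite.change_of_variables dom psi0 measurableT mpsi).
have mfE : measurable_fun setT (EFin \o f) by exact/measurable_EFinP.
have iRN := Radon_Nikodym_SigmaFinite.f_integrable dom.
apply: ae_eq_integral => //.
- by apply: emeasurable_funM => //; exact: measurable_int iRN.
- exact: emeasurable_funM.
apply: ae_eqe_mul2l; apply: integral_ae_eq => // A _ mA.
by rewrite -(nuE _ mA); apply/esym; exact: (Radon_Nikodym_SigmaFinite.f_integral dom).
Qed.

End integration_tools.

(** * Average over the position of the vortex *)

Section torus_covariance.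
Context {R : realType}.
Notation T2 := (measurableTypeR R * measurableTypeR R)%type.

(** A product of sines is half the difference of two cosines, of frequencies k - l and -(k + l) in
    y, so only l = k and l = -k contribute; at k = l = 0 the two contributions cancel. *)
Lemma fmode_kernel_product (k l : int * int) (x x' : R * R) :
  Rintegral (haar R) setT (fun y =>
    sin (dotp (lattice l) (x' - y)) * sin (dotp (lattice k) (x - y))) =
  2^-1 * ((k == l)%:R - (k == - l)%:R) * cos (dotp (lattice k) (x - x')).
Proof.
pose c1 := dotp (lattice l) x' - dotp (lattice k) x : R.
pose c2 := dotp (lattice l) x' + dotp (lattice k) x : R.
pose f1 (y : T2) : R := cos (dotp (lattice (k - l)) y + c1).
pose f2 (y : T2) : R := cos (dotp (lattice (- (k + l))) y + c2).
have i1 : (haar R).-integrable setT (EFin \o f1).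
  by apply: (@bounded_integrable _ _ 1); [exact: measurable_cos_dotp|move=> y; exact: cos_norm_le1].
have i2 : (haar R).-integrable setT (EFin \o f2).
  by apply: (@bounded_integrable _ _ 1); [exact: measurable_cos_dotp|move=> y; exact: cos_norm_le1].
transitivity (Rintegral (haar R) setT (fun y => 2^-1 * f1 y + (- 2^-1) * f2 y)).
  apply: eq_Rintegral => y _; rewrite /f1 /f2.
  set u := dotp (lattice l) (x' - y); set v := dotp (lattice k) (x - y).
  have -> : dotp (lattice (k - l)) y + c1 = u - v.
    by rewrite /u /v /c1 !dotpDr !dotpNr latticeD latticeN dotpDl dotpNl; ring.
  have -> : dotp (lattice (- (k + l))) y + c2 = u + v.
    by rewrite /u /v /c2 !dotpDr !dotpNr latticeN latticeD dotpNl dotpDl; ring.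
  by rewrite cosB cosD; field.
rewrite Rintegral_lin2// !Rintegral_haar_cos subr_eq0 oppr_eq0 addr_eq0.
have E : cos (dotp (lattice k) (x - x')) = cos (dotp (lattice k) (x' - x)) :> R.
  by rewrite -opprB dotpNr cosN.
have [e1|n1] := eqVneq k l; last first.
  have [e2|n2] := eqVneq k (- l); last by rewrite /= !mulr0n; ring.
  have -> : cos c2 = cos (dotp (lattice k) (x - x')).
    have el : lattice l = - lattice k :> R * R by rewrite e2 latticeN opprK.
    by rewrite /c2 el dotpNl addrC -dotpNr -dotpDr.
  by rewrite /= !mulr0n !mulr1n; ring.
have -> : cos c1 = cos (dotp (lattice k) (x - x')).
  by rewrite E /c1 -e1 -dotpNr -dotpDr.
have [e2|n2] := eqVneq k (- l); last by rewrite /= !mulr0n !mulr1n; ring.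
have k0 : k = 0.
  have : k = - k by rewrite {1}e2 e1.
  by case: (k) => a b [] h1 h2; congr (_, _); lia.
by rewrite /c2 -e1 k0 lattice0 /dotp /= !mul0r !addr0 cos0 !mulr1n; ring.
Qed.

Variables (a : int * int -> R) (A : R).
Hypothesis aA : forall k, `|a k| <= A * (lweight 1 k.1 * lweight 1 k.2).
Hypothesis aN : forall k, a (- k) = a k.

(** For a k = \hat theta(l k) this is, up to sign, the i-th component of K_l at u = x - x0. *)
Definition sine_series (i : 'I_2) (u : R * R) : R :=
  lsum (fun k => a k * kappa k i * sin (dotp (lattice k) u)).

Let sumb : lsummable (fun k : int * int => A * (lweight 1 k.1 * lweight 1 k.2)).
Proof. by apply: lsummableZ; apply: lsummable_lweight; lra. Qed.

Let coefb i k : `|a k * kappa k i| <= A * (lweight 1 k.1 * lweight 1 k.2).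
Proof. by rewrite normrM; apply: le_trans (aA k); rewrite ler_piMr// kappa_norm_le1. Qed.

Let termb i k (u : R * R) : `|a k * kappa k i * sin (dotp (lattice k) u)| <=
  A * (lweight 1 k.1 * lweight 1 k.2).
Proof. by rewrite normrM; apply: le_trans (coefb i k); rewrite ler_piMr// sin_norm_le1. Qed.

Lemma kappaN k i : kappa (- k) i = - kappa k i :> R.
Proof.
rewrite /kappa lnorm2_opp -mulNr; congr (_ / _); rewrite !mxE latticeN /=.
by case: eqP.
Qed.

Lemma measurable_sine_term k (x : R * R) :
  measurable_fun setT ((fun y => sin (dotp (lattice k) (x - y))) : T2 -> R).
Proof.
have := @measurable_sin_dotp R (- lattice k) (dotp (lattice k) x).
by congr measurable_fun; apply/funext => y; rewrite dotpDr dotpNl dotpNr addrC.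
Qed.

Lemma sine_series_measurable i (x : R * R) :
  measurable_fun setT ((fun y => sine_series i (x - y)) : T2 -> R).
Proof.
apply: measurable_lsum.
  by move=> k; apply: measurable_funM => //; exact: measurable_sine_term.
by move=> y; apply: lsummable_le sumb => k; exact: termb.
Qed.

Lemma sine_series_bounded i u : `|sine_series i u| <= lsum (fun k => A * (lweight 1 k.1 * lweight 1 k.2)).
Proof. by apply: lsum_norm sumb => k; exact: termb. Qed.

(* The cross terms vanish except for l = k and l = -k, which contribute equally
   because a is even and kappa is odd. *)
Lemma sine_series_covariance i j (x x' : R * R) :
  Rintegral (haar R) setT (fun y => sine_series i (x - y) * sine_series j (x' - y)) =
  lsum (fun k => a k ^+ 2 * (kappa k i * kappa k j) * cos (dotp (lattice k) (x - x'))).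
Proof.
pose F k (y : T2) := a k * kappa k i * sin (dotp (lattice k) (x - y)).
pose G k (y : T2) := a k * kappa k j * sin (dotp (lattice k) (x' - y)).
have mF k : measurable_fun setT (F k).
  by apply: measurable_funM => //; exact: measurable_sine_term.
have mG k : measurable_fun setT (G k).
  by apply: measurable_funM => //; exact: measurable_sine_term.
have ij : (haar R).-integrable setT (EFin \o (fun y : T2 => sine_series j (x' - y))).
  exact: bounded_integrable (sine_series_measurable j x') (fun y => sine_series_bounded j _).
have [_ <-] := lsum_integral sumb mF (fun k y => termb i k _) ij.
congr lsum; apply/funext => k.
have is_ : (haar R).-integrable setT (EFin \o (fun y : T2 => sin (dotp (lattice k) (x - y)))).
  exact: bounded_integrable (measurable_sine_term k x) (fun y => sin_norm_le1 _).
have [iG E] := lsum_integral sumb mG (fun k y => termb j k _) is_.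
transitivity (a k * kappa k i * Rintegral (haar R) setT (fun y =>
    lsum (G ^~ y) * sin (dotp (lattice k) (x - y)))).
  by rewrite -RintegralZl//; apply: eq_Rintegral => y _; rewrite /F -mulrA [sin _ * _]mulrC.
rewrite -E; set c := cos _.
have -> : lsum (fun l => Rintegral (haar R) setT (fun y => G l y * sin (dotp (lattice k) (x - y)))) =
    lsum (fun l => (2^-1 * c) * (a l * kappa l j * (l == k)%:R) +
      (- (2^-1 * c)) * (a l * kappa l j * (l == - k)%:R)).
  congr lsum; apply/funext => l.
  transitivity (a l * kappa l j * (2^-1 * ((k == l)%:R - (k == - l)%:R) * c)).
    rewrite -fmode_kernel_product -RintegralZl//; last first.
      apply: integrable_mul_bounded _ (measurable_sine_term k x) (fun y => sin_norm_le1 _).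
      exact: bounded_integrable (measurable_sine_term l x') (fun y => sin_norm_le1 _).
    by apply: eq_Rintegral => y _; rewrite /G mulrA.
  by rewrite [l == k]eq_sym -[l == - k](inj_eq oppr_inj) opprK [- l == k]eq_sym; ring.
have sl m : lsummable (fun l => a l * kappa l j * (l == m)%:R).
  apply: lsummable_le sumb => l; rewrite normrM; apply: le_trans (coefb j l).
  by rewrite ler_piMr//; case: eqP; rewrite ?normr1 ?normr0.
have el m : lsum (fun l => a l * kappa l j * (l == m)%:R) = a m * kappa m j.
  by apply: (@lsum_single _ _ _ m); [rewrite eqxx mulr1|move=> l /negbTE ->; rewrite mulr0].
rewrite lsumD; [|exact: lsummableZ..].
rewrite !lsumZ// !el aN kappaN; by field.
Qed.

End torus_covariance.

(** * Expectations under the joint law of independent variables *)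

Section joint_law.
Context {R : realType} d (T : measurableType d) (P : probability T R).
Context d1 (T1 : measurableType d1) (X : {RV P >-> T1}).
Context d2 (T2 : measurableType d2) (Y : {RV P >-> T2}).
Hypothesis indep : independent_rv P X Y.

Let Z (w : T) : (T1 * T2)%type := (X w, Y w).

Lemma measurable_joint : measurable_fun setT Z.
Proof. by apply: measurable_fun_pair; exact: measurable_funP. Qed.

Lemma joint_law (A : set (T1 * T2)) : measurable A ->
  (distribution P X \x distribution P Y)%E A = ((1%:nng%:num : R)%:E * P (Z @^-1` A))%E.
Proof.
move=> mA; rewrite mul1e.
pose phi : {mfun T >-> (T1 * T2)%type} := HB.pack Z (isMeasurableFun.Build _ _ _ _ _ measurable_joint).
have H C B : measurable C -> measurable B ->
    pushforward P phi (C `*` B) = (distribution P X C * distribution P Y B)%E.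
  move=> mC mB; transitivity (P ((X @^-1` C) `&` (Y @^-1` B))); first by [].
  by rewrite indep.
exact: (product_measure_unique (m' := pushforward P phi) H mA).
Qed.

Lemma ge0_expectation_joint (f : T1 * T2 -> \bar R) : measurable_fun setT f ->
  (forall z, 0 <= f z)%E ->
  (\int[P]_w f (X w, Y w) = \int[distribution P Y]_l \int[distribution P X]_y f (y, l))%E.
Proof.
move=> mf f0; transitivity (\int[distribution P X \x distribution P Y]_z f z)%E.
  by rewrite (ge0_integral_image measurable_joint joint_law)// mul1e preimage_setT.
exact: fubini_tonelli2.
Qed.

Lemma expectation_joint (f : T1 * T2 -> R) : measurable_fun setT f ->
  P.-integrable setT (fun w => (f (X w, Y w))%:E) ->
  (\int[P]_w (f (X w, Y w))%:E = \int[distribution P Y]_l \int[distribution P X]_y (f (y, l))%:E)%E.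
Proof.
move=> mf fi.
have fi2 : (distribution P X \x distribution P Y)%E.-integrable setT (EFin \o f).
  apply/integrableP; split; first exact/measurable_EFinP.
  rewrite (ge0_integral_image measurable_joint joint_law)//; last first.
    by apply: measurableT_comp => //; exact/measurable_EFinP.
  by rewrite mul1e preimage_setT; have /integrableP[] := fi.
transitivity (\int[distribution P X \x distribution P Y]_z (f z)%:E)%E; last first.
  exact/esym/integral21_prod_meas1.
have := Rintegral_image measurable_joint joint_law fi mf.
rewrite mul1r /Rintegral => h; move: (congr1 EFin h).
by rewrite !fineK//; exact: integrable_fin_num.
Qed.

End joint_law.

(** * Moments of the radial transform against the power law *)

Section radial_moments.
Context {R : realType}.
Notation leb := (@lebesgue_measure R).
Notation leb2 := (@lebesgue2 R).
Notation T1 := (measurableTypeR R).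
Notation T2 := (measurableTypeR R * measurableTypeR R)%type.
Variables (theta : R * R -> R) (mol : mollifier theta).
Hypothesis rad : radial (fourier_plane theta).

Definition radial_transform (r : R) : R := transform theta (r, 0).

Lemma cos_lipschitz (a b : R) : `|cos a - cos b| <= `|a - b|.
Proof.
wlog ab : a b / a < b.
  move=> H; have [ab|ba|->] := ltgtP a b; [exact: H| |by rewrite !subrr].
  by rewrite distrC [leRHS]distrC; exact: H.
have dc (x : R) : x \in `]a, b[ -> is_derive x 1 (cos : R -> R) (- sin x).
  by move=> _; exact: is_derive_cos.
have [c _ E] := MVT ab dc (continuous_subspaceT (@continuous_cos R)).
rewrite distrC E normrM normrN [leRHS]distrC ler_piMl//; exact: sin_norm_le1.
Qed.

(** The cosine is 1-Lipschitz and |z_1| <= 1 on the support of theta. This gives continuity of the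
    radial transform, hence its measurability. *)
Lemma radial_transform_lipschitz (r s : R) :
  `|radial_transform r - radial_transform s| <= `|r - s| * Rintegral leb2 setT theta.
Proof.
have ith := mollifier_integrable mol.
have mc q : measurable_fun setT ((fun z => cos (dotp (q, 0) z)) : T2 -> R).
  by have := measurable_cos_dotp (q, 0) 0; under eq_fun do rewrite addr0.
have ic q := integrable_mul_bounded ith (mc q) (fun z => cos_norm_le1 _).
have icD := integrableB measurableT (ic r) (ic s).
have icd : leb2.-integrable setT (EFin \o (fun z : T2 =>
    theta z * cos (dotp (r, 0) z) - theta z * cos (dotp (s, 0) z))) by [].
rewrite /radial_transform /transform -RintegralB// -RintegralZl//.
apply: le_trans (le_normr_Rintegral measurableT icd) _.
apply: le_Rintegral => //; [exact: integrable_norm|exact: integrable_scale|].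
move=> z _; rewrite -mulrBr normrM (ger0_norm (mollifier_ge0 mol z)) [leRHS]mulrC.
have [h|h] := boolP ((1 < `|z.1|) || (1 < `|z.2|)).
  by rewrite (mollifier_supported mol h) !mul0r.
apply: ler_wpM2l; first exact: mollifier_ge0 mol z.
apply: le_trans (cos_lipschitz _ _) _; rewrite /dotp /= !mul0r !addr0 -mulrBl normrM.
by rewrite ler_piMr// leNgt; move: h; rewrite negb_or => /andP[].
Qed.

Lemma measurable_radial_transform : measurable_fun setT (radial_transform : T1 -> R).
Proof.
apply: continuous_measurable_fun => r; apply/cvgrPdist_le => e e0.
pose m := Rintegral leb2 setT theta.
have m0 : 0 <= m by apply: Rintegral_ge0 => z _; exact: mollifier_ge0 mol z.
have m1 : 0 < m + 1 by rewrite ltr_wpDl.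
near=> s; apply: le_trans (radial_transform_lipschitz r s) _.
have : `|r - s| <= e / (m + 1).
  by near: s; apply: cvgr_dist_le; rewrite ?divr_gt0.
rewrite ler_pdivlMr// => h; apply: le_trans h.
by rewrite ler_wpM2l// lerDl.
Unshelve. all: by end_near. Qed.

Variables (C alpha : R) (C0 : 0 < C) (alpha1 : -1 < alpha).

(** The constant D after the power law has eliminated gamma and the density. *)
Definition radial_moment : \bar R :=
  (\int[leb]_(r in `]0%R, +oo[) (C * r `^ alpha * radial_transform r ^+ 2)%:E)%E.

Lemma measurable_radial_density : measurable_fun setT
  ((fun r => C * r `^ alpha * radial_transform r ^+ 2) : T1 -> R).
Proof.
apply: measurable_funM; last first.
  by apply: measurable_funX; exact: measurable_radial_transform.
by apply: measurable_funM => //; exact: measurable_powR.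
Qed.

Lemma radial_density_ge0 r : 0 <= C * r `^ alpha * radial_transform r ^+ 2.
Proof. by apply: mulr_ge0; [apply: mulr_ge0; [exact: ltW|exact: powR_ge0]|exact: sqr_ge0]. Qed.

Lemma radial_moment_fin : (radial_moment < +oo)%E.
Proof.
have a2 : 0 <= alpha + 2 by move: alpha1; lra.
(* Chosen so that 2n >= alpha + 2: for r > 1, r^{alpha + 2} \hat theta(r)^2 is then at most (r^n
   \hat theta(r))^2 <= Mn^2. *)
pose n := (Num.truncn `|alpha|).+2.
have [M0 H0] := transform_decay mol 0; have [Mn Hn] := transform_decay mol n.
have sq (a b : R) : `|a| <= b -> a ^+ 2 <= b ^+ 2.
  by move=> ab; rewrite -[a ^+ 2]real_normK ?num_real// ler_pXn2r// nnegrE (le_trans _ ab).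
have b0 r : radial_transform r ^+ 2 <= M0 ^+ 2.
  by apply: sq; have := H0 r; rewrite expr0 mul1r.
apply: (@powR_dominated_integral _ _ alpha (C * M0 ^+ 2) (C * (M0 ^+ 2 + Mn ^+ 2))) => //.
- exact: measurable_radial_density.
- exact: radial_density_ge0.
- by move=> r r0; rewrite [leRHS]mulrAC ler_wpM2l// mulr_ge0 ?powR_ge0// ltW.
move=> r r0; rewrite -!mulrA ler_wpM2l ?(ltW C0)//.
have rne : r != 0 by rewrite gt_eqF.
have -> : r `^ alpha = r `^ (alpha + 2) * r `^ (- 2).
  by rewrite -powRD ?rne ?implybT//; congr (_ `^ _); ring.
rewrite mulrAC ler_wpM2r ?powR_ge0//.
(* For r <= 1 the factor r^{alpha + 2} is at most 1, as alpha + 2 >= 0, and the bound M0^2 suffices;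
   the constant M0^2 + Mn^2 covers both ranges. *)
have [r1|r1] := leP r 1.
  apply: (@le_trans _ _ (1 * M0 ^+ 2)); last by rewrite mul1r lerDl sqr_ge0.
  rewrite ler_pM ?powR_ge0 ?sqr_ge0//.
  by have := @ge0_ler_powR R _ a2 r 1; rewrite powR1 !nnegrE; apply => //; exact: ltW.
apply: (@le_trans _ _ (Mn ^+ 2)); last by rewrite lerDr sqr_ge0.
apply: le_trans (sq _ _ (Hn r)).
rewrite exprMn ler_wpM2r ?sqr_ge0// -exprM -powR_mulrn ?(ltW r0)//.
apply: ler_powR; first exact: ltW.
have h := truncnS_gt `|alpha|; have h2 := ler_norm alpha.
have : (Num.truncn `|alpha|).+1%:R + 1 = n%:R :> R by rewrite natr1.
rewrite natrM.
have : 0 <= (Num.truncn `|alpha|).+1%:R :> R by [].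
lra.
Qed.

(* Extended by 0 to l <= 0, where transform theta (l k) has no decay in k at l = 0. *)
Definition amplitude (k : int * int) (l : R) : R :=
  if 0 < l then radial_transform (l * lnorm k) else 0.

Lemma amplitudeE k l : 0 < l -> amplitude k l = transform theta (l *: lattice k).
Proof. by move=> l0; rewrite /amplitude l0 (transform_lattice mol rad k l0). Qed.

Lemma amplitudeN k l : amplitude (- k) l = amplitude k l.
Proof.
rewrite /amplitude /lnorm latticeN; congr (if _ then radial_transform (_ * _) else _).
by rewrite /enorm dotpNl dotpNr opprK.
Qed.

Lemma amplitude_decay l : exists A : R, forall k,
  `|amplitude k l| <= A * (lweight 1 k.1 * lweight 1 k.2).
Proof.
have [l0|l0] := ltP 0 l; last first.
  by exists 0 => k; rewrite /amplitude ltNge l0 normr0 mul0r.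
have [A HA] := transform_lattice_decay mol rad l0.
by exists A => k; rewrite amplitudeE.
Qed.

Lemma measurable_amplitude k : measurable_fun setT (amplitude k : T1 -> R).
Proof.
apply: measurable_fun_ifT => //.
  by apply: measurable_fun_ltr.
by apply: (measurableT_comp measurable_radial_transform); exact: measurable_funM.
Qed.

Lemma amplitude_sq_summable l : lsummable (fun k => amplitude k l ^+ 2).
Proof.
have [A HA] := amplitude_decay l; have [M HM] := transform_decay mol 0.
have M0 : 0 <= M by apply: le_trans (HM 0).
have bM k : `|amplitude k l| <= M.
  rewrite /amplitude; case: ifP => _; last by rewrite normr0.
  by have := HM (l * lnorm k); rewrite expr0 mul1r.
apply: lsummable_le (lsummableZ M (lsummableZ A (@lsummable_lweight R 1 _))); last lra.
by move=> k; rewrite expr2 normrM; apply: ler_pM.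
Qed.

Lemma amplitude_moment (k : int * int) : k != 0 ->
  (\int[leb]_(r in `]0%R, +oo[) (C * r `^ alpha * amplitude k r ^+ 2)%:E =
   ((lnorm k `^ (1 + alpha))^-1)%:E * radial_moment)%E.
Proof.
move=> k0; have n0 : 0 < lnorm k :> R by exact: lnorm_gt0.
set n := lnorm k in n0 *.
have mE : measurable_fun setT (fun r : T1 => (C * r `^ alpha * radial_transform r ^+ 2)%:E).
  by apply/measurable_EFinP; exact: measurable_radial_density.
rewrite /radial_moment [X in _ = (_ * X)%E](@ge0_integral_affine _ n 0 _ _ n0)//; last 2 first.
- exact: measurable_funTS.
- by move=> r _; rewrite lee_fin radial_density_ge0.
have -> : affine n 0 @^-1` `]0, +oo[ = `]0, +oo[%classic.
  by apply/seteqP; split => r /=; rewrite /affine !in_itv /= !andbT addr0 pmulr_rgt0.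
have -> : (\int[leb]_(t in `]0%R, +oo[)
      (C * (n * t + 0) `^ alpha * radial_transform (n * t + 0) ^+ 2)%:E =
    (n `^ alpha)%:E * \int[leb]_(r in `]0%R, +oo[) (C * r `^ alpha * amplitude k r ^+ 2)%:E)%E.
  rewrite -ge0_integralZl//; last 3 first.
  - apply/measurable_EFinP; apply: measurable_funTS; apply: measurable_funM.
      by apply: measurable_funM => //; exact: measurable_powR.
    by apply: measurable_funX; exact: measurable_amplitude.
  - move=> r _; rewrite lee_fin.
    by apply: mulr_ge0; [apply: mulr_ge0; [exact: ltW|exact: powR_ge0]|exact: sqr_ge0].
  - by rewrite lee_fin powR_ge0.
  apply: eq_integral => r; rewrite inE /= in_itv /= andbT => r0.
  rewrite -EFinM addr0 powRM ?(ltW n0) ?(ltW r0)// /amplitude r0 -/n [r * n]mulrC.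
  by congr EFin; ring.
rewrite !muleA -!EFinM.
have -> : (n `^ (1 + alpha))^-1 * n * n `^ alpha = 1.
  rewrite powRD ?(gt_eqF n0) ?implybT// powRr1 ?(ltW n0)//.
  by rewrite -mulrA mulVf// mulf_neq0// gt_eqF// powR_gt0.
by rewrite mul1e.
Qed.

End radial_moments.

(** * Average over the size of the vortex *)

Section vortex_covariance.
Context {R : realType}.
Notation leb := (@lebesgue_measure R).
Notation T1 := (measurableTypeR R).
Notation T2 := (measurableTypeR R * measurableTypeR R)%type.
Variables (theta : R * R -> R) (mol : mollifier theta).
Hypothesis rad : radial (fourier_plane theta).
Variables (C alpha : R) (C0 : 0 < C) (alpha1 : -1 < alpha).
Variables (law : probability T1 R) (fL gam : R -> R).
Hypothesis mfL : measurable_fun setT (fL : T1 -> R).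
Hypothesis fL0 : forall r, 0 <= fL r.
Hypothesis lawE : forall A : set T1, measurable A -> law A = (\int[leb]_(r in A) (fL r)%:E)%E.
Hypothesis power_law : forall r : R, 0 < r -> gam r ^+ 2 * fL r = C * r `^ alpha.

Notation amp := (amplitude theta).
Notation D := (fine (radial_moment theta C alpha)).

(** The power law has a positive right-hand side, so the density cannot vanish; this permits the
    division that recovers gamma^2. *)
Lemma density_gt0 r : 0 < r -> 0 < fL r.
Proof.
move=> r0; rewrite lt0r fL0 andbT; apply/eqP => f0.
have : 0 < C * r `^ alpha by rewrite mulr_gt0// powR_gt0.
by rewrite -power_law// f0 mulr0 ltxx.
Qed.

(* gamma is not assumed measurable; the power law shows that gamma^2 agrees on
   ]0, +oo[ with this measurable function. *)
Definition intensity (l : R) : R := C * l `^ alpha / fL l.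

Lemma intensityE l : 0 < l -> intensity l = gam l ^+ 2.
Proof.
by move=> l0; rewrite /intensity -power_law// mulfK// gt_eqF// density_gt0.
Qed.

Lemma intensity_ge0 l : 0 <= intensity l.
Proof. by rewrite mulr_ge0 ?invr_ge0// mulr_ge0 ?powR_ge0// ltW. Qed.

Lemma intensity_sq_ge0 l a : 0 <= intensity l * a ^+ 2.
Proof. by apply: mulr_ge0; [exact: intensity_ge0|exact: sqr_ge0]. Qed.

Lemma measurable_intensity : measurable_fun setT (intensity : T1 -> R).
Proof.
apply: measurable_funM; first by apply: measurable_funM => //; exact: measurable_powR.
have -> : (fun l => (fL l)^-1) = (fun l => fL l `^ (- 1)).
  by apply/funext => l; rewrite powRN powRr1.
exact: (measurableT_comp (measurable_powR (- 1)) mfL).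
Qed.

(** The density in the law cancels the denominator of [intensity], and the vanishing of psi for l <=
    0 restricts the integral to the half-line. *)
Lemma integral_intensity (psi : T1 -> R) : measurable_fun setT psi ->
  (forall l, 0 <= psi l) -> (forall l, l <= 0 -> psi l = 0) ->
  (\int[law]_l (intensity l * psi l)%:E =
   \int[leb]_(r in `]0%R, +oo[) (C * r `^ alpha * psi r)%:E)%E.
Proof.
move=> mpsi psi0 psiN.
have mI := measurable_intensity.
rewrite (integral_density mfL fL0 lawE); last 2 first.
- by apply/measurable_EFinP; exact: measurable_funM.
- by move=> l; rewrite lee_fin mulr_ge0// intensity_ge0.
rewrite [RHS]integral_mkcond; apply: eq_integral => r _.
rewrite patchE -EFinM; case: ifPn => [|].
  rewrite inE /= in_itv /= andbT => r0; congr EFin.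
  by rewrite /intensity mulrAC divfK// gt_eqF// density_gt0.
by rewrite notin_setE /= in_itv /= andbT => /negP; rewrite -leNgt => r0; rewrite psiN// mulr0 mul0r.
Qed.

Lemma radial_moment_fin_num : radial_moment theta C alpha \is a fin_num.
Proof.
rewrite ge0_fin_numE; first exact: radial_moment_fin.
by apply: integral_ge0 => r _; rewrite lee_fin; exact: radial_density_ge0.
Qed.

Lemma law_moment k : k != 0 ->
  (\int[law]_l (intensity l * amp k l ^+ 2)%:E = ((lnorm k `^ (1 + alpha))^-1 * D)%:E)%E.
Proof.
move=> k0; rewrite integral_intensity; last 3 first.
- by apply: measurable_funX; exact: measurable_amplitude.
- by move=> l; exact: sqr_ge0.
- by move=> l l0; rewrite /amplitude ltNge l0 /= expr0n.
by rewrite amplitude_moment// EFinM fineK//; exact: radial_moment_fin_num.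
Qed.

Lemma law_moment_integrable k : k != 0 ->
  law.-integrable setT (EFin \o (fun l => intensity l * amp k l ^+ 2)).
Proof.
move=> k0; apply/integrableP; split.
  apply/measurable_EFinP; apply: measurable_funM; first exact: measurable_intensity.
  by apply: measurable_funX; exact: measurable_amplitude.
apply: le_lt_trans (ltry ((lnorm k `^ (1 + alpha))^-1 * D)); rewrite -law_moment//.
rewrite le_eqVlt; apply/orP; left; apply/eqP; apply: eq_integral => l _ /=.
by rewrite ger0_norm// intensity_sq_ge0.
Qed.

Let kk k i j : R := kappa k i * kappa k j.

Let kk_norm k i j : `|kk k i j| <= (if k == 0 then 0 else (lnorm2 k)^-1).
Proof.
rewrite /kk; case: ifPn => [/eqP ->|k0]; first by rewrite !kappa0 mul0r normr0.
rewrite kappa_prod// normrM normfV (ger0_norm (lnorm2_ge0 k)) ler_piMl ?invr_ge0 ?lnorm2_ge0//.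
exact: leray_norm_le1.
Qed.

Let term k i j (u : R * R) (l : R) : R :=
  intensity l * (amp k l ^+ 2 * kk k i j * cos (dotp (lattice k) u)).

(** A majorant of [term] uniform in i, j and u. It keeps the factor |k|^{-2} of the kernel
    coefficients, since the moment of the amplitude alone is only of order |k|^{-1-alpha}. *)
Let dominating k (l : R) : R :=
  intensity l * amp k l ^+ 2 * (if k == 0 then 0 else (lnorm2 k)^-1).

Let dominating_ge0 k l : 0 <= dominating k l.
Proof.
apply: mulr_ge0; first exact: intensity_sq_ge0.
by case: ifP => // _; rewrite invr_ge0 lnorm2_ge0.
Qed.

Let term_norm k i j u l : `|term k i j u l| <= dominating k l.
Proof.
rewrite /term -mulrA mulrA normrM ger0_norm ?intensity_sq_ge0//.
apply: ler_wpM2l; first exact: intensity_sq_ge0.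
by rewrite normrM -[leRHS]mulr1 ler_pM ?kk_norm ?cos_norm_le1.
Qed.

Let dominating_summable l : lsummable (dominating ^~ l).
Proof.
apply: lsummable_le (lsummableZ (intensity l) (amplitude_sq_summable mol rad l)) => k.
rewrite ger0_norm ?dominating_ge0// /dominating; apply: ler_piMr.
  exact: intensity_sq_ge0.
by case: ifPn => // k0; rewrite invf_le1 ?lnorm2_ge1// (lt_le_trans ltr01)// lnorm2_ge1.
Qed.

Let term_summable i j u l : lsummable (fun k => term k i j u l).
Proof. by apply: lsummable_le (dominating_summable l) => k; exact: term_norm. Qed.

Let dominating_integrable k : law.-integrable setT (EFin \o (dominating k)).
Proof.
rewrite /dominating; case: ifPn => [_|k0].
  by under eq_fun do rewrite mulr0; exact: finite_measure_integrable_cst.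
under eq_fun do rewrite mulrC.
by apply: integrable_scale; exact: law_moment_integrable.
Qed.

Lemma law_moment_spectral k : k != 0 -> (lnorm k `^ (1 + alpha))^-1 / lnorm2 k =
  spectral_weight ((3 + alpha) / 2) k :> R.
Proof.
move=> k0; rewrite spectral_weightE// -/(lnorm k) -lnorm2E -/(lnorm k) -invfM; congr (_^-1).
have n0 : 0 < lnorm k :> R by exact: lnorm_gt0.
rewrite -powR_mulrn ?(ltW n0)// -powRD ?(gt_eqF n0) ?implybT//.
by congr (_ `^ _); field.
Qed.

Let dominating_moment k : Rintegral law setT (dominating k) =
  D * spectral_weight ((3 + alpha) / 2) k.
Proof.
rewrite /dominating; case: ifPn => [/eqP ->|k0].
  rewrite spectral_weight0 mulr0; transitivity (Rintegral law setT (fun=> 0)).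
    by apply: eq_Rintegral => l _; rewrite mulr0.
  by rewrite Rintegral_cst ?mul0r.
transitivity ((lnorm2 k)^-1 * Rintegral law setT (fun l => intensity l * amp k l ^+ 2)).
  rewrite -RintegralZl//; last exact: law_moment_integrable.
  by apply: eq_Rintegral => l _; rewrite mulrC.
rewrite {1}/Rintegral law_moment//= -law_moment_spectral//; ring.
Qed.

Let s1 : 1 < (3 + alpha) / 2.
Proof. by move: alpha1; lra. Qed.

(** The integrals of the majorants are D |k|^{-(3 + alpha)}, summable over Z^2 since 3 + alpha >
    2. *)
Let total_integrable : law.-integrable setT (EFin \o (fun l => lsum (dominating ^~ l))).
Proof.
apply: lsum_ge0_integrable; [exact: dominating_integrable|exact: dominating_ge0|
  exact: dominating_summable|].
have sw := lsummableZ D (lsummable_spectral_weight s1).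
apply: lsummable_le sw => k; rewrite ger0_norm; first by rewrite dominating_moment.
by apply: Rintegral_ge0 => l _; exact: dominating_ge0.
Qed.

Let measurable_term k i j u : measurable_fun setT (term k i j u : T1 -> R).
Proof.
apply: measurable_funM; first exact: measurable_intensity.
apply: measurable_funM => //; apply: measurable_funM => //.
by apply: measurable_funX; exact: measurable_amplitude.
Qed.

Let term_integrable k i j u : law.-integrable setT (EFin \o (term k i j u)).
Proof.
apply: le_integrable (dominating_integrable k) => //; first exact/measurable_EFinP.
by move=> l _ /=; rewrite lee_fin; apply: le_trans (term_norm _ _ _ _ _) (ler_norm _).
Qed.

Lemma covariance_series i j (u : R * R) :
  law.-integrable setT (EFin \o (fun l => lsum (fun k => term k i j u l))) /\
  Rintegral law setT (fun l => lsum (fun k => term k i j u l)) =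
  D * sfgf_kernel ((3 + alpha) / 2) u i j.
Proof.
have [|I E] := @lsum_dominated _ _ _ law (fun k l => term k i j u l) (fun l => lsum (dominating ^~ l))
  (fun k => term_integrable k i j u) (term_summable i j u) total_integrable.
  by move=> N l; apply: lsum_norm_box (dominating_summable l) => k; exact: term_norm.
split=> //; rewrite -E mxE -lsumZ; last first.
  apply: lsummable_le (lsummable_spectral_weight s1) => k; rewrite normrM.
  by apply: le_trans (kernel_coef_norm _ k i j); rewrite ler_piMr// cos_norm_le1.
congr lsum; apply/funext => k.
have [->|k0] := eqVneq k 0.
  rewrite spectral_weight0 !mul0r mulr0; transitivity (Rintegral law setT (fun=> 0)).
    by apply: eq_Rintegral => l _; rewrite /term /kk !kappa0 mul0r mulr0 mul0r mulr0.
  by rewrite Rintegral_cst ?mul0r.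
transitivity (kk k i j * cos (dotp (lattice k) u) *
    Rintegral law setT (fun l => intensity l * amp k l ^+ 2)).
  rewrite -RintegralZl//; last exact: law_moment_integrable.
  by apply: eq_Rintegral => l _; rewrite /term; ring.
rewrite {1}/Rintegral law_moment//= -law_moment_spectral// /kk kappa_prod//; ring.
Qed.

(** The product of two components of Gamma K_L for a vortex at z.1 of size z.2, with gamma^2
    replaced by [intensity] to make it jointly measurable. The signs of the two kernel series
    cancel. *)
Definition vortex_product i j (x x' : R * R) (z : T2 * T1) : R :=
  intensity z.2 * (sine_series (amp^~ z.2) i (x - z.1) * sine_series (amp^~ z.2) j (x' - z.1)).

Lemma measurable_sine_field i (x : R * R) :
  measurable_fun setT ((fun z => sine_series (amp^~ z.2) i (x - z.1)) : T2 * T1 -> R).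
Proof.
apply: measurable_lsum.
  move=> k; apply: measurable_funM.
    by apply: measurable_funM => //; apply: measurableT_comp => //; exact: measurable_amplitude.
  by apply: measurableT_comp (measurable_sine_term k x) _.
move=> [y l] /=; have [A HA] := amplitude_decay mol rad l.
apply: lsummable_le (lsummableZ A (@lsummable_lweight R 1 _)); last lra.
move=> k; rewrite normrM; apply: le_trans (HA k).
rewrite normrM -mulrA ler_piMr// -[leRHS]mulr1.
by rewrite ler_pM ?kappa_norm_le1 ?sin_norm_le1.
Qed.

Lemma measurable_vortex_product i j x x' : measurable_fun setT (vortex_product i j x x').
Proof.
apply: measurable_funM; first by apply: measurableT_comp => //; exact: measurable_intensity.
by apply: measurable_funM; exact: measurable_sine_field.
Qed.

Lemma haar_vortex_product i j x x' l :
  (\int[haar R]_y (vortex_product i j x x' (y, l))%:E = (lsum (fun k => term k i j (x - x') l))%:E)%E.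
Proof.
have [A HA] := amplitude_decay mol rad l.
have mS m z : measurable_fun setT ((fun y => sine_series (amp^~ l) m (z - y)) : T2 -> R).
  exact: sine_series_measurable HA _ _.
have bS m z (y : T2) := sine_series_bounded HA m (z - y).
have iS : (haar R).-integrable setT (EFin \o (fun y : T2 =>
    sine_series (amp^~ l) i (x - y) * sine_series (amp^~ l) j (x' - y))).
  exact: integrable_mul_bounded (bounded_integrable (mS i x) (bS i x)) (mS j x') (bS j x').
transitivity ((Rintegral (haar R) setT (fun y => vortex_product i j x x' (y, l)))%:E).
  by rewrite fineK//; apply: integrable_fin_num => //; exact: (integrable_scale (intensity l) iS).
congr EFin; transitivity (intensity l * Rintegral (haar R) setT (fun y =>
    sine_series (amp^~ l) i (x - y) * sine_series (amp^~ l) j (x' - y))).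
  by rewrite -RintegralZl.
rewrite (sine_series_covariance HA (fun k => amplitudeN theta k l)) -lsumZ//.
apply: lsummable_le (amplitude_sq_summable mol rad l) => k; rewrite -mulrA normrM.
rewrite ger0_norm ?sqr_ge0// ler_piMr ?sqr_ge0// normrM -[leRHS]mulr1.
rewrite ler_pM ?cos_norm_le1// normrM -[leRHS]mulr1.
by rewrite ler_pM ?kappa_norm_le1.
Qed.

Lemma vortex_square_ge0 i x z : 0 <= vortex_product i i x x z.
Proof. by rewrite /vortex_product -expr2 intensity_sq_ge0. Qed.

(** |ab| <= a^2 + b^2 transfers integrability from the nonnegative squares to all entries. *)
Lemma vortex_product_norm i j x x' z :
  `|vortex_product i j x x' z| <= vortex_product i i x x z + vortex_product j j x' x' z.
Proof.
rewrite /vortex_product -mulrDr normrM (ger0_norm (intensity_ge0 _)).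
apply: ler_wpM2l; first exact: intensity_ge0.
move: (sine_series _ _ _) (sine_series _ _ _) => a b.
by rewrite ler_norml; apply/andP; split; nra.
Qed.

End vortex_covariance.

(** * Expectation of the products of the vortex field *)

Section vortex_expectation.
Context {R : realType}.
Notation leb := (@lebesgue_measure R).
Notation T1 := (measurableTypeR R).
Notation T2 := (measurableTypeR R * measurableTypeR R)%type.
Variables (theta : R * R -> R) (mol : mollifier theta).
Hypothesis rad : radial (fourier_plane theta).
Variables (C alpha : R) (C0 : 0 < C) (alpha1 : -1 < alpha).
Context d (T : measurableType d) (P : probability T R).
Variables (X0 : {RV P >-> T2}) (Y : {RV P >-> T1}) (fL gam : R -> R).
Hypothesis unif : uniform_on_torus X0.
Hypothesis indep : independent_rv P X0 Y.
Hypothesis mfL : measurable_fun setT (fL : T1 -> R).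
Hypothesis fL0 : forall r, 0 <= fL r.
Hypothesis lawE : forall A : set T1, measurable A ->
  distribution P Y A = (\int[leb]_(r in A) (fL r)%:E)%E.
Hypothesis power_law : forall r : R, 0 < r -> gam r ^+ 2 * fL r = C * r `^ alpha.

Notation vp := (vortex_product theta C alpha fL).

Let unifE (f : T2 -> \bar R) : (\int[distribution P X0]_y f y = \int[haar R]_y f y)%E.
Proof. by apply: eq_measure_integral => A mA _; exact: unif. Qed.

Let mvp i j x x' := measurable_vortex_product mol rad C alpha mfL fL0 i j x x'.

Let mZ i j x x' : measurable_fun setT (fun w => (vp i j x x' (X0 w, Y w))%:E).
Proof.
apply/measurable_EFinP; apply: (measurableT_comp (mvp i j x x')).
exact: measurable_joint.
Qed.

(** The square is nonnegative, so Tonelli computes its expectation as the average over X_0 followed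
    by that over L; this is the integral of the covariance series at u = x - x, which is finite. *)
Lemma vortex_square_integrable i x :
  P.-integrable setT (fun w => (vp i i x x (X0 w, Y w))%:E).
Proof.
apply/integrableP; split => //.
have v0 z : 0 <= vp i i x x z by exact: vortex_square_ge0.
have -> : (\int[P]_w `|(vp i i x x (X0 w, Y w))%:E| = \int[P]_w (vp i i x x (X0 w, Y w))%:E)%E.
  by apply: eq_integral => w _; rewrite gee0_abs// lee_fin.
have mv : measurable_fun setT (EFin \o vp i i x x) by exact/measurable_EFinP.
have ev z : (0 <= (EFin \o vp i i x x) z)%E by rewrite lee_fin.
rewrite (ge0_expectation_joint indep mv ev).
have [I _] := covariance_series mol rad C0 alpha1 mfL fL0 lawE power_law i i (x - x).
have fin := integrable_fin_num measurableT I.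
move: fin; rewrite fin_numElt => /andP[_]; apply: le_lt_trans.
rewrite le_eqVlt; apply/orP; left; apply/eqP; apply: eq_integral => l _.
by rewrite unifE; exact: haar_vortex_product.
Qed.

Lemma vortex_product_integrable i j x x' :
  P.-integrable setT (fun w => (vp i j x x' (X0 w, Y w))%:E).
Proof.
have := integrableD measurableT (vortex_square_integrable i x) (vortex_square_integrable j x').
move/le_integrable; apply => //.
move=> w _; rewrite -EFinD lee_fin; apply: le_trans (ler_norm _).
exact: vortex_product_norm.
Qed.

Lemma expectation_vortex_product i j x x' :
  (\int[P]_w (vp i j x x' (X0 w, Y w))%:E =
   (fine (radial_moment theta C alpha) * sfgf_kernel ((3 + alpha) / 2) (x - x') i j)%:E)%E.
Proof.
rewrite (expectation_joint indep (mvp i j x x') (vortex_product_integrable i j x x')).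
have [I E] := covariance_series mol rad C0 alpha1 mfL fL0 lawE power_law i j (x - x').
rewrite -E fineK; last exact: integrable_fin_num.
by apply: eq_integral => l _; rewrite unifE; exact: haar_vortex_product.
Qed.

End vortex_expectation.

(** * The kernel as an unconditional complex sum *)

Section lattice_sum.
Context {R : realType}.

Lemma complex_norm_le (a b e : R) : `|a| <= e / 2 -> `|b| <= e / 2 ->
  (`|Complex a b| <= e%:C)%C.
Proof.
move=> ha hb; rewrite normc_def lecE /= eqxx /=.
have e0 : 0 <= e by have := le_trans (normr_ge0 a) ha; lra.
rewrite -(@ger0_norm _ e)// -sqrtr_sqr ler_sqrt ?sqr_ge0//.
have : a ^+ 2 <= (e / 2) ^+ 2.
  by rewrite -[a ^+ 2]real_normK ?num_real// ler_pXn2r// nnegrE divr_ge0.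
have : b ^+ 2 <= (e / 2) ^+ 2.
  by rewrite -[b ^+ 2]real_normK ?num_real// ler_pXn2r// nnegrE divr_ge0.
by nra.
Qed.

Lemma complex_bigsum (s : seq (int * int)) (f g : int * int -> R) :
  \sum_(k <- s | k != 0) Complex (f k) (g k) =
  Complex (\sum_(k <- s) if k == 0 then 0 else f k) (\sum_(k <- s) if k == 0 then 0 else g k).
Proof.
elim: s => [|k s IH]; first by rewrite !big_nil.
rewrite !big_cons IH; case: eqVneq => _ /=; last by [].
by rewrite !add0r.
Qed.

(** Any finite set containing a large enough square brings the real and the imaginary parts within
    half the tolerance simultaneously. *)
Lemma lsum_has_lattice_sum (f g : int * int -> R) :
  lsummable (fun k => if k == 0 then 0 else f k) ->
  lsummable (fun k => if k == 0 then 0 else g k) ->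
  has_lattice_sum (fun k => Complex (f k) (g k))
    (Complex (lsum (fun k => if k == 0 then 0 else f k)) (lsum (fun k => if k == 0 then 0 else g k))).
Proof.
move=> sf sg; have pf := @summability.totally_filter (int * int)%type.
apply/cvgrPdist_le => e e0.
have [e1 e2] : e = (complex.Re e)%:C%C /\ 0 < complex.Re e.
  by move: e0; rewrite ltcE /= => /andP[/eqP ei er]; split => //; case: e ei {er} => a b /= ->.
have e20 : 0 < complex.Re e / 2 by rewrite divr_gt0.
have [N HN] := lsum_net sf e20; have [M HM] := lsum_net sg e20.
exists [fset k in box (maxn N M)]%fset => // A /= sA.
have sub n : (n <= maxn N M)%N -> {subset box n <= enum_fset A}.
  move=> nm k kn; apply: (fsubsetP sA); rewrite in_fset.
  exact: box_sub nm k kn.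
rewrite complex_bigsum e1; apply: complex_norm_le => /=.
- by rewrite distrC; apply: HN; [exact: fset_uniq|apply: sub; exact: leq_maxl].
- by rewrite distrC; apply: HM; [exact: fset_uniq|apply: sub; exact: leq_maxr].
Qed.

(** The imaginary part is the sum of an odd family, because the weight and the symbol are even in k,
    so it vanishes. *)
Lemma kernel_lattice_sum (s : R) (x : R * R) i j : 1 < s ->
  has_lattice_sum
    (fun k => ((enorm (lattice k : R * R) `^ (2 * s))^-1 * leray_symbol k i j)%:C%C
              * cis (dotp (lattice k) x))
    (sfgf_kernel s x i j)%:C%C.
Proof.
move=> s1; pose c k : R := spectral_weight s k * leray_symbol k i j.
pose a k : R := (enorm (lattice k : R * R) `^ (2 * s))^-1 * leray_symbol k i j.
have cE k t : (if k == 0 then 0 else a k * t) = c k * t.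
  by rewrite /a /c; case: eqVneq => [->|k0]; rewrite ?spectral_weight0 ?mul0r ?spectral_weightE.
have sc (t : int * int -> R) : (forall k, `|t k| <= 1) -> lsummable (fun k => c k * t k).
  move=> t1; apply: lsummable_le (lsummable_spectral_weight s1) => k; rewrite normrM.
  by apply: le_trans (kernel_coef_norm _ k i j); rewrite ler_piMr.
have := @lsum_has_lattice_sum (fun k => a k * cos (dotp (lattice k) x))
  (fun k => a k * sin (dotp (lattice k) x)).
have -> : (fun k => if k == 0 then 0 else a k * cos (dotp (lattice k) x)) =
    (fun k => c k * cos (dotp (lattice k) x)) by apply/funext => k; rewrite cE.
have -> : (fun k => if k == 0 then 0 else a k * sin (dotp (lattice k) x)) =
    (fun k => c k * sin (dotp (lattice k) x)) by apply/funext => k; rewrite cE.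
move/(_ (sc _ (fun k => cos_norm_le1 _)) (sc _ (fun k => sin_norm_le1 _))).
rewrite [lsum (fun k => _ * sin _)]lsum_odd; last first.
  move=> k; rewrite /c leray_symbol_opp latticeN dotpNl sinN mulrN; congr (- (_ * _ * _)).
  rewrite /spectral_weight lnorm2_opp; congr (if _ then _ else _).
  by rewrite oppr_eq0.
have -> : sfgf_kernel s x i j = lsum (fun k => c k * cos (dotp (lattice k) x)) by rewrite mxE.
congr has_lattice_sum; apply/funext => k.
by rewrite /cis /a /real_complex_def; apply/eqP; rewrite eq_complex /=; apply/andP; split; apply/eqP; ring.
Qed.

End lattice_sum.

Theorem corollary10 (R : realType)
  (theta : R * R -> R)
  (theta_mollifier : mollifier theta)
  (theta_radial : radial (fourier_plane theta))
  (K : R * R -> 'cV[R]_2) (K_biot_savart : biot_savart K)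
  (d : measure_display) (T : measurableType d) (P : probability T R)
  (L : {RV P >-> R}) (Gamma : {RV P >-> R})
  (X0 : {RV P >-> (measurableTypeR R * measurableTypeR R)%type})
  (fL gamma : R -> R) (C alpha : R)
  (L_gt0 : forall w, 0 < L w)
  (L_density : has_density L fL)
  (Gamma_def : forall w, Gamma w = gamma (L w))
  (X0_uniform : uniform_on_torus X0)
  (X0_indep : independent_rv P X0
     (fun w => (Gamma w, L w) : measurableTypeR R * measurableTypeR R))
  (C_gt0 : 0 < C) (alpha_gt : -1 < alpha)
  (power_law : forall r : R, 0 < r -> gamma r ^+ 2 * fL r = C * r `^ alpha) :
  let D := (\int[lebesgue_measure]_(r in `]0%R, +oo[)
     (ComplexField.Normc.normc (fourier_plane theta (r, 0)) ^+ 2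
        * gamma r ^+ 2 * fL r)%:E)%E in
  let field := fun w x => Gamma w *: smoothed_kernel K theta (L w) x (X0 w) in
  D \is a fin_num /\
  (forall x x' i j,
     P.-integrable setT
       (fun w => ((field w x *m (field w x')^T) i j)%:E)) /\
  exists G : R * R -> 'M[R]_2,
    [/\ forall x i j,
          has_lattice_sum
            (fun k => ((enorm (lattice k : R * R) `^ (3 + alpha))^-1
                        * leray_symbol k i j)%:C%C
                      * cis (dotp (lattice k) x))
            (G x i j)%:C%C,
        forall x x',
          covariance_function P field x x' = fine D *: G (x - x')
      & forall (d' : measure_display) (T' : measurableType d')
               (P' : probability T' R)
               (X : (R * R -> 'cV[R]_2) -> {RV P' >-> R}),
          SFGF ((3 + alpha) / 2) X ->
          is_covariance_function X (fun x x' => G (x - x'))].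
Proof.
move=> D field.
have s1 : 1 < (3 + alpha) / 2 by move: alpha_gt; lra.
have mL : measurable_fun setT (L : T -> measurableTypeR R).
  exact: (measurable_funPT L).
(* The function L itself, with the target type over which the law is integrated in the lemmas
   above. *)
pose L1 : {mfun T >-> measurableTypeR R} :=
  HB.pack (L : T -> measurableTypeR R) (isMeasurableFun.Build _ _ _ _ _ mL).
have [mfL fL0 lawL] := L_density.
have lawE (A : set (measurableTypeR R)) : measurable A ->
    distribution P L1 A = (\int[lebesgue_measure]_(r in A) (fL r)%:E)%E by exact: lawL.
have indep : independent_rv P X0 L1.
  (* Rectangles with a full first side pass from the pair (Gamma, L) to L alone. *)
  move=> A B mA mB; have := X0_indep A (setT `*` B) mA (measurableX measurableT mB).
  by have -> : (fun w => (Gamma w, L w) : measurableTypeR R * measurableTypeR R) @^-1` (setT `*` B) =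
    L1 @^-1` B by apply/seteqP; split => w /= => [[]|].
have ED : D = radial_moment theta C alpha.
  apply: eq_integral => r; rewrite inE => rI.
  have r0 : 0 < r by move: rI; rewrite /= in_itv /= andbT.
  (* The transform is real, so the squared modulus in D is the square of [radial_transform]. *)
  rewrite (fourier_plane_transform theta_mollifier) -mulrA power_law// mulrC; congr (_ * _)%:E.
  by rewrite /= expr0n addr0 sqr_sqrtr// sqr_ge0.
(* An identity at every w: L w > 0 identifies the amplitudes with \hat theta(L k) and [intensity]
   with gamma(L)^2 = Gamma^2. *)
have fieldE x x' i j w : (field w x *m (field w x')^T) i j =
    vortex_product theta C alpha fL i j x x' (X0 w, L1 w).
  rewrite mxE big_ord1 !mxE.
  have kE y m : smoothed_kernel K theta (L w) y (X0 w) m 0 =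
      - sine_series (fun k => amplitude theta k (L w)) m (y - X0 w).
    rewrite (smoothed_kernel_series theta_mollifier theta_radial K_biot_savart)//.
    congr (- _); congr lsum; apply/funext => k.
    by rewrite (amplitudeE theta_mollifier theta_radial)// mulrA.
  have := kE x i; have := kE x' j; rewrite !mxE => -> ->.
  rewrite /vortex_product /= (intensityE C_gt0 fL0 power_law (L_gt0 w)) -Gamma_def.
  by ring.
split; first by rewrite ED; exact: radial_moment_fin_num.
split.
  move=> x x' i j; under eq_fun do rewrite fieldE.
  exact: (vortex_product_integrable theta_mollifier theta_radial C_gt0 alpha_gt X0_uniform indep
    mfL fL0 lawE power_law).
exists (sfgf_kernel ((3 + alpha) / 2)); split.
- move=> x i j; have := @kernel_lattice_sum R _ x i j s1.
  by rewrite [2 * _]mulrC divfK.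
- move=> x x'; apply/matrixP => i j; rewrite !mxE unlock.
  under eq_integral do rewrite fieldE.
  rewrite (expectation_vortex_product theta_mollifier theta_radial C_gt0 alpha_gt X0_uniform indep
    mfL fL0 lawE power_law) /= ED.
  by rewrite mxE.
- move=> d' T' P' X; exact: SFGF_covariance_function.
Qed.
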